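(* Let $M>0$, $n\ge3$, $\ell\ge1$, $\delta\in(0,1)$, and let $\mathcal{J}\subseteq\{J:\|J\|_\infty\le M\}$ be a collection of $n\times n$ interaction matrices. Assume that $\ell$ independent samples are obtained from $\Pr_{J^*}$ where $J^*\in\mathcal{J}$. There is an estimator $\hat J$ (a function of the $\ell$ samples) such that, with probability at least $1-\delta$, $$\|\hat J-J^*\|_F\le C(M)\sqrt{\frac{\log N(\mathcal{J},\|\cdot\|_2,1/(n\ell))+\log(1/\delta)+\log\log n}{\ell}},$$ where $C(M)$ is a (singly) exponential function of $M$. Moreover, $\hat J$ is the minimizer over $\mathcal{J}$ of a convex function on $\mathbb{R}^{n\times n}$, and it can be computed in polynomial time if $\mathcal{J}$ is convex and projection onto $\mathcal{J}$ is efficiently computable.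
   Context: An interaction matrix is a real symmetric $n\times n$ matrix $J$ with zero diagonal. The Ising model $\Pr_J$ is the distribution on $\{\pm1\}^n$ with $\Pr_J[x]\propto\exp(x^\top Jx/2)$. Norms: $\|J\|_\infty=\max_i\sum_j|J_{ij}|$, $\|\cdot\|_F$ is the Frobenius norm, $\|\cdot\|_2$ is the spectral norm. For a subset $\mathcal{V}$ of a normed space, an $\epsilon$-cover of $\mathcal{V}$ is a set $\mathcal{N}\subseteq\mathcal{V}$ such that every $v\in\mathcal{V}$ has some $u\in\mathcal{N}$ with $\|u-v\|\le\epsilon$; $N(\mathcal{V},\|\cdot\|,\epsilon)$ is the minimum cardinality of an $\epsilon$-cover. ''Singly exponential'' means bounded by $ae^{bM}$ for universal constants $a,b>0$. Computing the minimizer is understood up to optimization accuracy (additive error $\epsilon$ in the objective value, in time also polynomial in $1/\epsilon$). *)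

(* Defs.v *)
From HB Require Import structures.
From mathcomp Require Import all_boot all_order all_algebra.
From mathcomp Require Import all_classical all_reals all_analysis.

Set Implicit Arguments.
Unset Strict Implicit.
Unset Printing Implicit Defensive.

Import Order.TTheory GRing.Theory Num.Theory.
Import numFieldNormedType.Exports.

Local Open Scope classical_set_scope.
Local Open Scope card_scope.
Local Open Scope ring_scope.

(** * Matrices and norms *)

Definition interaction_matrix (R : realType) n (A : 'M[R]_n) : Prop :=
  A^T = A /\ forall i, A i i = 0.

Definition norm_inf (R : realType) n (A : 'M[R]_n) : R :=
  \big[Num.max/0]_(i < n) \sum_(j < n) `|A i j|.

(* On column vectors this is the Euclidean norm. *)
Definition norm_frob (R : realType) m n (A : 'M[R]_(m, n)) : R :=
  Num.sqrt (\sum_(i < m) \sum_(j < n) A i j ^+ 2).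

Definition norm_spec (R : realType) n (A : 'M[R]_n) : R :=
  sup [set norm_frob (A *m v) | v in [set v : 'cV[R]_n | norm_frob v <= 1]].

(** * Covering numbers *)

Definition eps_cover (R : realType) (V : zmodType) (nrm : V -> R) (eps : R)
    (A N : set V) : Prop :=
  N `<=` A /\ forall v, A v -> exists2 u, N u & nrm (u - v) <= eps.

Definition min_cover_size (R : realType) (V : zmodType) (nrm : V -> R)
    (eps : R) (A : set V) (k : nat) : Prop :=
  (exists2 N, eps_cover nrm eps A N & N #= `I_k) /\
  forall N k', eps_cover nrm eps A N -> N #= `I_k' -> (k <= k')%N.

(* The default value 0 is used only when [A] has no finite [eps]-cover. *)
Definition covering_number (R : realType) (V : zmodType) (nrm : V -> R)
    (A : set V) (eps : R) : nat :=
  xget 0%N (min_cover_size nrm eps A).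

Lemma covering_numberP (R : realType) (V : zmodType) (nrm : V -> R)
    (A : set V) (eps : R) :
  (exists2 N, eps_cover nrm eps A N & finite_set N) ->
  min_cover_size nrm eps A (covering_number nrm A eps).
Proof.
case=> N NA [k Nk].
pose P k := `[< exists2 N, eps_cover nrm eps A N & N #= `I_k >].
have exP : exists k, P k by exists k; apply/asboolP; exists N.
rewrite /covering_number; case: xgetP => [_ -> //|H].
have [m /asboolP Pm minm] := ex_minnP exP.
by have := H m; case; split=> // N' k' h1 h2; apply/minm/asboolP; exists N'.
Qed.

(** * The Ising model *)

Definition config n := {ffun 'I_n -> bool}.

Definition spins (R : realType) n (x : config n) : 'cV[R]_n :=
  \col_i (if x i then 1 else -1).

Definition ising_weight (R : realType) n (A : 'M[R]_n) (x : config n) : R :=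
  expR (((spins R x)^T *m A *m spins R x) 0 0 / 2).

Definition ising (R : realType) n (A : 'M[R]_n) (x : config n) : R :=
  ising_weight A x / \sum_(y : config n) ising_weight A y.

Definition sample n l := {ffun 'I_l -> config n}.

Definition sample_prob (R : realType) n l (A : 'M[R]_n)
    (E : sample n l -> Prop) : R :=
  \sum_(x : sample n l | `[< E x >]) \prod_(k < l) ising A (x k).

(** * Estimation and minimization *)

Definition rate (R : realType) n (l : nat) (J : set 'M[R]_n) (delta : R) : R :=
  Num.sqrt ((ln (covering_number (@norm_spec R n) J (n%:R * l%:R)^-1)%:R
             + ln delta^-1 + ln (ln n%:R)) / l%:R).

(* With [Cst := C(M)]. *)
Definition accurate_estimator (R : realType) n l (J : set 'M[R]_n)
    (delta Cst : R) (Jhat : sample n l -> 'M[R]_n) : Prop :=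
  forall Jstar, J Jstar ->
    1 - delta <= sample_prob Jstar
      (fun x => norm_frob (Jhat x - Jstar) <= Cst * rate l J delta).

Definition minimizer (R : realType) (V : Type) (J : set V) (g : V -> R)
    (A : V) : Prop :=
  J A /\ forall B, J B -> g A <= g B.

Definition approx_minimizer (R : realType) (V : Type) (J : set V) (g : V -> R)
    (eps : R) (A : V) : Prop :=
  J A /\ forall B, J B -> g A <= g B + eps.

Definition is_projection (R : realType) n (J : set 'M[R]_n)
    (proj : 'M[R]_n -> 'M[R]_n) : Prop :=
  forall A, J (proj A) /\
    forall B, J B -> norm_frob (A - proj A) <= norm_frob (A - B).

(** * Computation

   A real RAM with a projection oracle. A machine state consists of
   natural-number registers and of two-dimensional real arrays. A [cell]
   [(a, i, j)] denotes the entry of array number [a] whose row and column are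
   the current contents of registers [i] and [j].

   The only arithmetic on registers is successor, so that register contents are
   bounded by the initial contents plus the running time, and unit cost is
   harmless there. The exact real operations are the field operations and
   comparison; transcendental functions are not primitive, and the only
   constants are 0 and 1. Programs do not mention [R], the dimension or the
   oracle, so one program serves all inputs. *)

Definition cell := (nat * nat * nat)%type.

Inductive real_op := OpAdd | OpSub | OpMul | OpDiv.

Inductive test :=
| NatLt of nat & nat
| RealLt of cell & cell.

Inductive cmd :=
| Skip
| RegZero of nat
| RegSucc of nat
| RegCopy of nat & nat
| CellZero of cell
| CellOne of cell
| CellOp of real_op & cell & cell & cell
| Project of nat & nat
| Seq of cmd & cmd
| If of test & cmd & cmd
| While of test & cmd.

Record state (R : realType) := State {
  reg : nat -> nat;
  mem : nat -> nat -> nat -> R }.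

Definition read (R : realType) (s : state R) (c : cell) : R :=
  let: (a, i, j) := c in mem s a (reg s i) (reg s j).

Definition set_reg (R : realType) (s : state R) (i v : nat) : state R :=
  State (fun i' => if i' == i then v else reg s i') (mem s).

Definition write (R : realType) (s : state R) (c : cell) (v : R) : state R :=
  let: (a, i, j) := c in
  State (reg s) (fun a' p q =>
    if [&& a' == a, p == reg s i & q == reg s j] then v else mem s a' p q).

Definition get_mx (R : realType) n (s : state R) (a : nat) : 'M[R]_n :=
  \matrix_(i, j) mem s a i j.

Definition set_mx (R : realType) n (s : state R) (a : nat) (A : 'M[R]_n) :
    state R :=
  State (reg s) (fun a' p q =>
    if a' == a then
      match insub p, insub q with
      | Some i, Some j => A i j
      | _, _ => mem s a' p q
      end
    else mem s a' p q).

Definition eval_op (R : realType) (o : real_op) (u v : R) : R :=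
  match o with
  | OpAdd => u + v | OpSub => u - v | OpMul => u * v | OpDiv => u / v
  end.

Definition eval_test (R : realType) (s : state R) (t : test) : bool :=
  match t with
  | NatLt i j => (reg s i < reg s j)%N
  | RealLt c d => read s c < read s d
  end.

(* [exec proj tau p s t s']: from state [s], program [p] halts in state [s']
   after time [t], where [Project a b] stores in array [a] the image by [proj]
   of the [n] x [n] matrix held in array [b], at a cost of [tau] plus one. *)
Inductive exec (R : realType) n (proj : 'M[R]_n -> 'M[R]_n) (tau : nat) :
    cmd -> state R -> nat -> state R -> Prop :=
| ExecSkip s : exec proj tau Skip s 1 s
| ExecRegZero i s : exec proj tau (RegZero i) s 1 (set_reg s i 0)
| ExecRegSucc i s : exec proj tau (RegSucc i) s 1 (set_reg s i (reg s i).+1)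
| ExecRegCopy i j s : exec proj tau (RegCopy i j) s 1 (set_reg s i (reg s j))
| ExecCellZero c s : exec proj tau (CellZero c) s 1 (write s c 0)
| ExecCellOne c s : exec proj tau (CellOne c) s 1 (write s c 1)
| ExecCellOp o c d e s :
    exec proj tau (CellOp o c d e) s 1
      (write s c (eval_op o (read s d) (read s e)))
| ExecProject a b s :
    exec proj tau (Project a b) s tau.+1 (set_mx s a (proj (get_mx n s b)))
| ExecSeq p q s s' s'' t t' :
    exec proj tau p s t s' -> exec proj tau q s' t' s'' ->
    exec proj tau (Seq p q) s (t + t') s''
| ExecIfTrue b p q s s' t :
    eval_test s b -> exec proj tau p s t s' ->
    exec proj tau (If b p q) s t.+1 s'
| ExecIfFalse b p q s s' t :
    ~~ eval_test s b -> exec proj tau q s t s' ->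
    exec proj tau (If b p q) s t.+1 s'
| ExecWhileFalse b p s :
    ~~ eval_test s b -> exec proj tau (While b p) s 1 s
| ExecWhileTrue b p s s' s'' t t' :
    eval_test s b -> exec proj tau p s t s' ->
    exec proj tau (While b p) s' t' s'' ->
    exec proj tau (While b p) s (t + t').+1 s''.

(* Registers 0 and 1 hold [n] and [l]; array 0 holds [M] and [eps] in its
   entries (0, 0) and (0, 1); array 1 holds the samples, one per row;
   everything else is 0. *)
Definition init_state (R : realType) n l (M eps : R) (x : sample n l) :
    state R :=
  State
    (fun i => if i == 0%N then n else if i == 1%N then l else 0%N)
    (fun a p q =>
       if (a, p, q) == (0%N, 0%N, 0%N) then M
       else if (a, p, q) == (0%N, 0%N, 1%N) then eps
       else if a == 1%N then
         match insub p, insub q with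
         | Some k, Some i => spins R (x k) i 0
         | _, _ => 0
         end
       else 0).

Definition output (R : realType) n (s : state R) : 'M[R]_n := get_mx n s 2.

(* Main.v *)
Require Import Defs.
From HB Require Import structures.
From mathcomp Require Import all_boot all_order all_algebra.
From mathcomp Require Import all_classical all_reals all_analysis.
From mathcomp Require Import zify ring lra.

Set Implicit Arguments.
Unset Strict Implicit.
Unset Printing Implicit Defensive.

Import Order.TTheory GRing.Theory Num.Theory.
Import numFieldNormedType.Exports.

Local Open Scope classical_set_scope.
Local Open Scope ring_scope.

(** The estimator minimizes over the class the negative log-pseudo-likelihood
    [objective]: the sum, over samples and spins, of [logistic (x_i h_i)], where
    [h = A x] is the vector of local fields. Under the matrix [A], each term is
    minus the logarithm of the conditional probability of [x_i] given the other
    spins.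

    Accuracy. Let [J] be the true matrix, [B] a candidate, [A = B - J], and let
    [r_i = x_i - tanh (J x)_i] be the conditionally centred spins ([resid]).
    Strong convexity of [logistic] on bounded intervals bounds the excess loss
    of one sample from below by [- <r, A x> + c |A x|^2] ([pseudo_loss_gap]).
    Two things must be shown: that [<r, A x>] is dominated, and that [|A x|^2]
    is of the order of the squared Frobenius norm of [A].

    For the first, [r_i] is antisymmetric under flipping [x_i] once weighted by
    the Gibbs density, so that [E (r_i g)] only sees the change of [g] under the
    flip ([resid_antisymmetrize]). If [H] is a small multiple [s] of a sum
    [\sum_i r_i y_i] with [y_i] free of [x_i], the expectation of [H e^H] is thus
    of second order in [s] and can be compensated by quadratic terms. As
    [e^H - 1 <= H e^H], the outcome [E (H e^H) <= 0] yields [E e^H <= 1]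
    ([exp_potential_le]). Strong dependence between the spins only makes the
    admissible [s] exponentially small in [M].

    For the second, [|A x|^2 >= 2 tau <A x, A r> - tau^2 |A r|^2], and
    [<A x, A r> = <A^2 x, r>] is the sum of a part [\sum_j (A^2)_jj x_j r_j] and
    of a part of the form [\sum_i r_i y_i] above, which joins [H]. Now
    [x_j r_j = 1 - tanh (x_j (J x)_j)] is bounded below by an exponential in [M]
    for every configuration, and the [(A^2)_jj] add up to the squared Frobenius
    norm. Altogether, for one sample,
    [E exp (s (loss J - loss B)) <= exp (- gamma |B - J|_F^2)]
    ([exp_pseudo_loss_le]).

    Independence multiplies these bounds, and Markov's inequality with a union
    bound over a spectral-norm cover of radius [1 / (n l)] makes them hold at
    all points of the cover together. The objective is [2 n l]-Lipschitz in the
    spectral norm, so replacing an estimate by a point of the cover costs a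
    constant ([approx_minimizer_accurate]). The same goes for an estimate that
    is a minimizer up to the additive error 1. Constants are absorbed by
    [ln (ln n) >= ln (ln 3) > 0].

    Computation. Projected gradient descent returns the average of its iterates
    ([descent_approx]). The only transcendental function in the gradient is
    replaced by [(1 + 2 u / N)^N] ([approx_weightP]), where [N] is also the
    number of rounds. With [w = n + l + M + 1 / eps], the step [w^-8] and
    [N = ceil (w^16)] suffice ([descent_error_le]). The program is built from
    counting loops whose bounds stay fixed while they run; these have a simple
    semantics and a running time polynomial in the contents of the registers
    ([exec_den]). *)

(** * The logistic loss *)

Section Logistic.
Variable R : realType.
Implicit Types u v M : R.

Definition tanh u : R := 1 - 2 / (expR (2 * u) + 1).

(** Minus the logarithm of the conditional probability of a spin [x_i] in the
    local field [h_i], at [u = x_i * h_i]. *)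
Definition logistic u : R := ln (1 + expR (- (2 * u))).

Lemma expR2D1_gt0 u : 0 < expR (2 * u) + 1.
Proof. by rewrite addr_gt0 ?expR_gt0. Qed.

Lemma tanhE u : tanh u = (expR u - expR (- u)) / (expR u + expR (- u)).
Proof.
have e0 := expR_gt0 u; rewrite /tanh expRM_natl expRN.
have : expR u != 0 by rewrite gt_eqF.
have : expR u ^+ 2 + 1 != 0 by rewrite gt_eqF// addr_gt0 ?exprn_gt0.
by move=> *; field; do ?(apply/andP; split).
Qed.

Lemma tanhN u : tanh (- u) = - tanh u.
Proof. by rewrite !tanhE opprK -mulNr opprB (addrC (expR u) (expR (- u))). Qed.

Lemma tanh_lt1 u : tanh u < 1.
Proof. by rewrite /tanh ltrBlDr ltrDl divr_gt0 ?expR2D1_gt0. Qed.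

Lemma tanh_gtN1 u : -1 < tanh u.
Proof. by rewrite ltrNl -tanhN tanh_lt1. Qed.

(** This is [sinh (v - u) / (cosh u * cosh v)]. *)
Lemma tanhB u v : tanh v - tanh u =
  2 * (expR (v - u) - expR (u - v))
    / ((expR u + expR (- u)) * (expR v + expR (- v))).
Proof.
have eu := expR_gt0 u; have ev := expR_gt0 v.
rewrite !tanhE !expRB !expRN.
have : expR u ^+ 2 + 1 != 0 by rewrite gt_eqF// addr_gt0 ?exprn_gt0.
have : expR v ^+ 2 + 1 != 0 by rewrite gt_eqF// addr_gt0 ?exprn_gt0.
have : expR u != 0 by rewrite gt_eqF.
have : expR v != 0 by rewrite gt_eqF.
by move=> *; field; do ?(apply/andP; split).
Qed.

(** In [tanhB], the numerator is at least linear and both hyperbolic cosines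
    are at most [expR M]. *)
Lemma tanh_incr M u v : `|u| <= M -> `|v| <= M -> u <= v ->
  expR (- (2 * M)) / 2 * (v - u) <= tanh v - tanh u.
Proof.
move=> /ler_normlP[uM Mu] /ler_normlP[vM Mv] uv.
have cosh_le w : - w <= M -> w <= M -> 0 < expR w + expR (- w) <= 2 * expR M.
  move=> wM Mw; rewrite addr_gt0 ?expR_gt0//= mulr2n mulrDl mul1r.
  by rewrite lerD ?ler_expR.
have /andP[cu0 cuM] := cosh_le u uM Mu; have /andP[cv0 cvM] := cosh_le v vM Mv.
rewrite tanhB ler_pdivlMr ?mulr_gt0//.
have vu0 : 0 <= v - u by rewrite subr_ge0.
have sinh_ge : v - u <= expR (v - u) - expR (u - v).
  have := expR_ge1Dx (v - u); have : expR (u - v) <= 1; last by lra.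
  by rewrite expR_le1 subr_le0.
apply: (@le_trans _ _ (expR (- (2 * M)) / 2 * (v - u) * (2 * expR M * (2 * expR M)))).
  apply: ler_wpM2l; first by rewrite mulr_ge0 ?divr_ge0 ?expR_ge0.
  by apply: ler_pM => //; exact: ltW.
rewrite expRN expRM_natl.
suff -> : (expR M ^+ 2)^-1 / 2 * (v - u) * (2 * expR M * (2 * expR M))
   = 2 * (v - u) by rewrite ler_wpM2l.
have : expR M != 0 by rewrite gt_eqF ?expR_gt0.
by move=> ?; field.
Qed.

Lemma tanh_homo : {homo tanh : u v / u <= v}.
Proof.
move=> u v uv; rewrite -subr_ge0.
pose M := Num.max `|u| `|v|.
apply: le_trans (tanh_incr (M := M) _ _ uv); last 2 first.
- by rewrite le_max lexx.
- by rewrite le_max lexx orbT.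
by rewrite !mulr_ge0 ?expR_ge0// subr_ge0.
Qed.

(** Follows from [1 - expR (- (2 * d)) <= 2 * d] at [d = v - u], which avoids
    differentiation at the price of a larger constant. *)
Lemma tanh_lipschitz u v : `|tanh v - tanh u| <= 4 * `|v - u|.
Proof.
wlog uv : u v / u <= v.
  move=> H; have [|/ltW] := leP u v; first exact: H.
  by move=> /H; rewrite distrC (distrC u).
rewrite !ger0_norm ?subr_ge0 ?tanh_homo//.
have Eu := expR_gt0 (2 * u); have Ev := expR_gt0 (2 * v).
have -> : tanh v - tanh u =
    2 * (expR (2 * v) - expR (2 * u))
      / ((expR (2 * u) + 1) * (expR (2 * v) + 1)).
  rewrite /tanh; have := expR2D1_gt0 u; have := expR2D1_gt0 v.
  by move=> /lt0r_neq0 ? /lt0r_neq0 ?; field; do ?(apply/andP; split).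
rewrite ler_pdivrMr ?mulr_gt0 ?expR2D1_gt0//.
have dE : expR (2 * v) - expR (2 * u) <= 2 * (v - u) * expR (2 * v).
  have -> : expR (2 * u) = expR (2 * v) * expR (- (2 * (v - u))).
    by rewrite -expRD; congr expR; ring.
  have := expR_ge1Dx (- (2 * (v - u))); nra.
have : 0 <= (v - u) * expR (2 * v) * expR (2 * u).
  by rewrite !mulr_ge0 ?subr_ge0// ltW.
have : 0 <= (v - u) * expR (2 * u) by rewrite mulr_ge0 ?subr_ge0// ltW.
have : 0 <= v - u by rewrite subr_ge0.
nra.
Qed.

Lemma is_derive_logistic u : is_derive u 1 logistic (tanh u - 1).
Proof.
have p0 : 0 < 1 + expR (- (2 * u)) by rewrite addr_gt0 ?expR_gt0.
have dln := is_derive1_ln p0.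
have dg : is_derive u 1 (fun t : R => 1 + expR (- (2 * t)))
     (- 2 * expR (- (2 * u))).
  apply: is_derive_eq; rewrite /GRing.scale/=; ring.
have := @is_derive1_comp _ (@ln R) (fun t : R => 1 + expR (- (2 * t))) _ _ _ dln dg; rewrite /comp.
move=> H; apply: is_derive_eq H _.
rewrite /GRing.scale/= expRN /tanh.
have E0 := expR_gt0 (2 * u).
have : expR (2 * u) + 1 != 0 by rewrite gt_eqF// addr_gt0.
by move=> ?; field; rewrite ?gt_eqF//= addrC.
Qed.

(** By [tanh_incr], subtracting [k / 4 * t ^+ 2] from [logistic t] leaves a
    function whose derivative is nondecreasing on [[-M, M]]; the mean value
    theorem puts such a function above its tangents. *)
Lemma logistic_strong_convex M u v : `|u| <= M -> `|v| <= M ->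
  logistic u + (tanh u - 1) * (v - u) + expR (- (2 * M)) / 4 * (v - u) ^+ 2 <= logistic v.
Proof.
move=> uM vM; set k := expR (- (2 * M)).
pose F (t : R) := logistic t - k / 4 * t ^+ 2.
pose dF (t : R) := tanh t - 1 - k / 2 * t.
have dFP (t : R) : is_derive t 1 F (dF t).
  have ? := is_derive_logistic t.
  apply: is_derive_eq; by rewrite /dF /GRing.scale/=; field.
have cF (a b : R) : {within `[a, b], continuous F}.
  apply: derivable_within_continuous => z _; exact: ex_derive.
have dF_homo a b : `|a| <= M -> `|b| <= M -> a <= b -> dF a <= dF b.
  move=> aM bM ab; have := tanh_incr aM bM ab; rewrite -/k /dF; lra.
have mid a b c : `|a| <= M -> `|b| <= M -> c \in `[a, b] -> `|c| <= M.
  rewrite !ler_norml in_itv/= => /andP[? ?] /andP[? ?] /andP[? ?].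
  by apply/andP; split; lra.
suff : F u + dF u * (v - u) <= F v by rewrite /F /dF; lra.
have [uv|/ltW vu] := leP u v.
  have [c cuv cE] := MVT_segment uv (fun t _ => dFP t) (cF u v).
  have cM := mid _ _ _ uM vM cuv.
  move: cuv; rewrite in_itv/= => /andP[uc cv].
  have := dF_homo _ _ uM cM uc; have : 0 <= v - u by rewrite subr_ge0.
  nra.
have [c cuv cE] := MVT_segment vu (fun t _ => dFP t) (cF v u).
have cM := mid _ _ _ vM uM cuv.
move: cuv; rewrite in_itv/= => /andP[vc cu].
have := dF_homo _ _ cM uM cu; have : 0 <= u - v by rewrite subr_ge0.
nra.
Qed.

Lemma logistic_tangent u v : logistic u + (tanh u - 1) * (v - u) <= logistic v.
Proof.
pose M := Num.max `|u| `|v|.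
have := @logistic_strong_convex M u v; rewrite !le_max !lexx orbT => /(_ isT isT).
apply: le_trans; rewrite lerDl.
by rewrite mulr_ge0 ?sqr_ge0 ?divr_ge0 ?expR_ge0.
Qed.

Lemma logistic_lipschitz u v : `|logistic v - logistic u| <= 2 * `|v - u|.
Proof.
have := logistic_tangent u v; have := logistic_tangent v u.
have := tanh_lt1 u; have := tanh_lt1 v; have := tanh_gtN1 u; have := tanh_gtN1 v.
have := ler_norm (v - u); have := ler_norm (u - v); rewrite (distrC u).
by move=> *; rewrite ler_norml; apply/andP; split; nra.
Qed.

Lemma logistic_ge0 u : 0 <= logistic u.
Proof. by rewrite ln_ge0// lerDl expR_ge0. Qed.

(** A lower bound for [x_i * r_i], the product of a spin with its centred
    version, in any configuration. *)
Lemma tanh_gap M u : 0 <= M -> u <= M -> expR (- (2 * M)) <= 1 - tanh u.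
Proof.
move=> M0 uM; rewrite /tanh opprB addrC subrK expRN.
rewrite ler_pdivlMr ?expR2D1_gt0// mulrC ler_pdivrMr ?expR_gt0//.
have : expR (2 * u) <= expR (2 * M) by rewrite ler_expR; lra.
have : 1 <= expR (2 * M) by rewrite -[leLHS]expR0 ler_expR; lra.
lra.
Qed.

Lemma expR1_lt3 : expR 1 < 3 :> R.
Proof.
(* [e^(1/6) <= 1 / (1 - 1/6)], and [(6/5)^6 < 3]. *)
have h : expR 6^-1 <= 6 / 5 :> R.
  have := expR_ge1Dx (- 6^-1 : R); rewrite expRN => h.
  rewrite -[leLHS]invrK invf_ple ?posrE ?invr_gt0 ?expR_gt0//.
  by apply: le_trans h; lra.
have -> : 1 = 6%:R * 6^-1 :> R by rewrite divff.
rewrite expRM_natl; apply: le_lt_trans (_ : (6 / 5) ^+ 6 < _); last by lra.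
by rewrite lerXn2r ?nnegrE ?expR_ge0.
Qed.

(** The double logarithm in the rate is thus bounded away from 0 and absorbs
    additive constants. *)
Lemma ln_ln3_gt0 : 0 < ln (ln 3) :> R.
Proof. by apply: ln_gt0; rewrite -ltr_expR lnK ?posrE// expR1_lt3. Qed.

End Logistic.

(** * Inequalities for finite sums *)

Section FiniteSums.
Variables (R : realType) (I : finType).
Implicit Types (U u v P Q : I -> R).

Lemma cauchy_schwarz U u v : (forall i, 0 <= U i) ->
  (\sum_i U i * (u i * v i)) ^+ 2
    <= (\sum_i U i * u i ^+ 2) * (\sum_i U i * v i ^+ 2).
Proof.
move=> U0; rewrite -subr_ge0.
(* Lagrange's identity. *)
suff -> : (\sum_i U i * u i ^+ 2) * (\sum_i U i * v i ^+ 2)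
    - (\sum_i U i * (u i * v i)) ^+ 2
  = 2^-1 * \sum_i \sum_j U i * U j * (u i * v j - u j * v i) ^+ 2.
  rewrite mulr_ge0//; apply: sumr_ge0 => i _; apply: sumr_ge0 => j _.
  by rewrite mulr_ge0 ?sqr_ge0// mulr_ge0.
transitivity (2^-1 * ((\sum_i \sum_j (U i * u i ^+ 2) * (U j * v j ^+ 2))
  + (\sum_i \sum_j (U j * u j ^+ 2) * (U i * v i ^+ 2))
  - 2 * \sum_i \sum_j (U i * (u i * v i)) * (U j * (u j * v j)))).
  rewrite [X in _ + X - _]exchange_big/=.
  have prodE (a b : I -> R) : \sum_i \sum_j a i * b j = (\sum_i a i) * (\sum_j b j).
    by rewrite mulr_suml; apply: eq_bigr => i _; rewrite mulr_sumr.
  by rewrite !prodE; field.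
congr (_ * _); rewrite mulr_sumr -big_split/= -sumrB; apply: eq_bigr => i _.
rewrite mulr_sumr -big_split/= -sumrB; apply: eq_bigr => j _; ring.
Qed.

Lemma cauchy_schwarz1 u v :
  (\sum_i u i * v i) ^+ 2 <= (\sum_i u i ^+ 2) * (\sum_i v i ^+ 2).
Proof.
have := @cauchy_schwarz (fun=> 1) u v (fun=> ler01).
by congr (_ ^+ 2 <= _ * _); apply: eq_bigr => i _; rewrite mul1r.
Qed.

Lemma sqr_weighted_sum U v : (forall i, 0 <= U i) ->
  (\sum_i U i * v i) ^+ 2 <= (\sum_i U i) * (\sum_i U i * v i ^+ 2).
Proof.
move=> U0; have := cauchy_schwarz (fun=> 1) v U0.
congr (_ ^+ 2 <= _ * _); apply: eq_bigr => i _; first by rewrite mul1r.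
by rewrite expr1n mulr1.
Qed.

Lemma sqr_sum_le u : (\sum_i u i) ^+ 2 <= #|I|%:R * \sum_i u i ^+ 2.
Proof.
have := @sqr_weighted_sum (fun=> 1) u (fun=> ler01).
rewrite sumr_const; congr (_ ^+ 2 <= _ * _);
  by apply: eq_bigr => i _; rewrite mul1r.
Qed.

Lemma sum_sqr_le u c : (forall i, 0 <= u i) -> \sum_i u i <= c ->
  \sum_i u i ^+ 2 <= c ^+ 2.
Proof.
move=> u0 uc; have s0 : 0 <= \sum_i u i by rewrite sumr_ge0.
apply: (@le_trans _ _ ((\sum_i u i) ^+ 2)); last first.
  by rewrite lerXn2r ?nnegrE// (le_trans s0).
rewrite [leRHS]expr2 mulr_suml; apply: ler_sum => i _; rewrite expr2.
by apply: ler_wpM2l => //; rewrite (bigD1 i)//= lerDl sumr_ge0.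
Qed.

Lemma le_sum_term u i : (forall i, 0 <= u i) -> u i <= \sum_j u j.
Proof. by move=> u0; rewrite (bigD1 i)//= lerDl sumr_ge0. Qed.

(** For sums of products, a change of the factors bounded by [2 * P] and [2 * Q]
    is felt through the old factors and through one second-order term; this is
    the shape in which quadratic functions of the spins are flipped below. *)
Lemma dist_dot_le u v u' v' P Q :
  (forall i, `|u i - u' i| <= 2 * P i) -> (forall i, `|v i - v' i| <= 2 * Q i) ->
  `|\sum_i u i * v i - \sum_i u' i * v' i| <=
    2 * (\sum_i P i * `|v i|) + 2 * (\sum_i Q i * `|u i|)
      + 4 * \sum_i P i * Q i.
Proof.
move=> uP vQ; rewrite -sumrB !mulr_sumr -!big_split/=.
apply: le_trans (ler_norm_sum _ _ _) _; apply: ler_sum => i _.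
have -> : u i * v i - u' i * v' i = (u i - u' i) * v i + u i * (v i - v' i)
  - (u i - u' i) * (v i - v' i) by ring.
apply: le_trans (ler_normB _ _) _; apply: lerD.
  apply: le_trans (ler_normD _ _) _; rewrite !normrM; apply: lerD.
    by rewrite mulrA ler_wpM2r.
  by rewrite mulrC mulrA ler_wpM2r.
rewrite normrM; apply: le_trans (ler_pM _ _ (uP i) (vQ i)) _ => //.
lra.
Qed.

End FiniteSums.

(** Schur's test: Cauchy-Schwarz with the weights of each row, then summation
    along columns. *)
Lemma schur_test (R : realType) (I : finType) (U : I -> I -> R)
    (v : I -> R) (c : R) :
  (forall i j, 0 <= U i j) -> (forall i, \sum_j U i j <= c) ->
  (forall j, \sum_i U i j <= c) ->
  \sum_i (\sum_j U i j * v j) ^+ 2 <= c ^+ 2 * \sum_j v j ^+ 2.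
Proof.
move=> U0 Ur Uc.
apply: (@le_trans _ _ (\sum_i c * \sum_j U i j * v j ^+ 2)).
  apply: ler_sum => i _; apply: le_trans (sqr_weighted_sum _ (U0 i)) _.
  apply: ler_wpM2r => //; apply: sumr_ge0 => j _.
  by rewrite mulr_ge0 ?sqr_ge0.
have [c0|c0] := leP 0 c; last first.
  rewrite !big1 ?mulr0//; last first.
    move=> i _; have := le_lt_trans (Ur i) c0.
    by rewrite ltNge sumr_ge0.
  move=> i _; have := le_lt_trans (Ur i) c0.
  by rewrite ltNge sumr_ge0.
rewrite -mulr_sumr exchange_big/= expr2 -mulrA; apply: ler_wpM2l => //.
rewrite mulr_sumr; apply: ler_sum => j _; rewrite -mulr_suml.
by apply: ler_wpM2r => //; rewrite sqr_ge0.
Qed.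

(** * Spins, local fields and single spin flips *)

Section Flip.
Variables (R : realType) (n : nat).
Implicit Types (x : config n) (i j : 'I_n) (A J : 'M[R]_n).

Definition spin x i : R := if x i then 1 else -1.

Lemma spinE x i : spins R x i 0 = spin x i.
Proof. by rewrite mxE. Qed.

Lemma spin_sqr x i : spin x i * spin x i = 1.
Proof. by rewrite /spin; case: (x i); rewrite ?mulrNN mulr1. Qed.

Lemma norm_spin x i : `|spin x i| = 1.
Proof. by rewrite /spin; case: (x i); rewrite ?normrN normr1. Qed.

Definition local_field A x i : R := \sum_j A i j * spin x j.

Lemma local_fieldE A x i : (A *m spins R x) i 0 = local_field A x i.
Proof. by rewrite mxE; apply: eq_bigr => j _; rewrite spinE. Qed.

Lemma local_fieldB A B x i : local_field (A - B) x i = local_field A x i - local_field B x i.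
Proof. by rewrite -sumrB; apply: eq_bigr => j _; rewrite !mxE mulrBl. Qed.

Lemma norm_local_field_le A x i c : \sum_j `|A i j| <= c -> `|local_field A x i| <= c.
Proof.
apply: le_trans; apply: le_trans (ler_norm_sum _ _ _) _.
by apply: ler_sum => j _; rewrite normrM norm_spin mulr1.
Qed.

Definition flip_at i x : config n := [ffun j => if j == i then ~~ x j else x j].

Lemma flip_atK i : involutive (flip_at i).
Proof. by move=> x; apply/ffunP => j; rewrite !ffunE; case: eqP; rewrite ?negbK. Qed.

Lemma spin_flip i x j :
  spin (flip_at i x) j = spin x j - 2 * (j == i)%:R * spin x i.
Proof.
rewrite /spin ffunE; case: eqP => [->|_]; last by rewrite mulr0 mul0r subr0.
by case: (x i) => /=; ring.
Qed.

Lemma local_field_flip A i x j :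
  local_field A (flip_at i x) j = local_field A x j - 2 * A j i * spin x i.
Proof.
rewrite /local_field; under eq_bigr do rewrite spin_flip mulrBr.
rewrite sumrB; congr (_ - _); rewrite (bigD1 i)//= eqxx/= big1 ?addr0; first ring.
by move=> k /negbTE -> /=; ring.
Qed.

Lemma local_field_flip_diag A i x : A i i = 0 -> local_field A (flip_at i x) i = local_field A x i.
Proof. by move=> A0; rewrite local_field_flip A0 mulr0 mul0r subr0. Qed.

Lemma quadE A x :
  ((spins R x)^T *m A *m spins R x) 0 0 = \sum_i spin x i * local_field A x i.
Proof.
rewrite -mulmxA mxE; apply: eq_bigr => i _.
by rewrite local_fieldE mxE spinE.
Qed.

Lemma ising_weightE A x : ising_weight A x = expR ((\sum_i spin x i * local_field A x i) / 2).
Proof. by rewrite /ising_weight quadE. Qed.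

Lemma ising_weight_gt0 A x : 0 < ising_weight A x.
Proof. exact: expR_gt0. Qed.

Lemma ising_weight_flip A i x : interaction_matrix A ->
  ising_weight A (flip_at i x)
    = ising_weight A x * expR (- (2 * (spin x i * local_field A x i))).
Proof.
move=> [Asym A0]; rewrite !ising_weightE -expRD; congr expR.
have As k j : A k j = A j k by rewrite -[in LHS]Asym mxE.
suff -> : \sum_j spin (flip_at i x) j * local_field A (flip_at i x) j
    = \sum_j spin x j * local_field A x j - 4 * (spin x i * local_field A x i) by field.
under eq_bigr do rewrite spin_flip local_field_flip.
transitivity (\sum_j (spin x j * local_field A x j - 2 * spin x i * (A i j * spin x j)
   - 2 * spin x i * ((j == i)%:R * (local_field A x j - 2 * A j i * spin x i)))).
  by apply: eq_bigr => j _; rewrite (As i j); ring.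
rewrite !sumrB -!mulr_sumr -/(local_field A x i).
have -> : \sum_j (j == i)%:R * (local_field A x j - 2 * A j i * spin x i) = local_field A x i.
  rewrite (bigD1 i)//= eqxx/= A0 big1 => [|k /negbTE ->]; first by ring.
  by rewrite mul0r.
ring.
Qed.

(** The conditional mean of a spin given the others is the [tanh] of its local
    field, so this is the conditionally centred spin. *)
Definition resid J x i : R := spin x i - tanh (local_field J x i).

Lemma norm_resid_le J x i : `|resid J x i| <= 2.
Proof.
have := tanh_lt1 (local_field J x i); have := tanh_gtN1 (local_field J x i).
rewrite /resid /spin ler_norml; case: (x i) => ? ?; apply/andP; split; lra.
Qed.

(** Given the other spins, the two terms of the conditional mean of [resid J x i]
    come from [x] and [flip_at i x], and they cancel. *)
Lemma resid_flip J i x : interaction_matrix J ->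
  ising_weight J (flip_at i x) * resid J (flip_at i x) i
    = - (ising_weight J x * resid J x i).
Proof.
move=> Jint; have [_ J0] := Jint.
rewrite ising_weight_flip// /resid local_field_flip_diag// spin_flip eqxx mulr1.
rewrite -mulrA -[RHS]mulrN; congr (_ * _).
set h := local_field J x i; have E0 := expR_gt0 (2 * h).
have nz : expR (2 * h) + 1 != 0 by rewrite gt_eqF// addr_gt0.
rewrite /spin; case: (x i).
  rewrite mul1r expRN /tanh; field.
  by rewrite nz gt_eqF.
rewrite mulN1r mulrN opprK /tanh; field.
by rewrite nz.
Qed.

(** Averaging the sum with its image under [flip_at i] leaves only the variation
    of [g] under that flip; a function that does not depend on spin [i] is
    uncorrelated with [resid J x i]. *)
Lemma resid_antisymmetrize J i (g : config n -> R) : interaction_matrix J ->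
  \sum_x ising_weight J x * (resid J x i * g x) =
  \sum_x ising_weight J x * (resid J x i * ((g x - g (flip_at i x)) / 2)).
Proof.
move=> Jint; set S := LHS.
have SE : S = \sum_x - (ising_weight J x * (resid J x i * g (flip_at i x))).
  rewrite /S (reindex_inj (inv_inj (flip_atK i)))/=; apply: eq_bigr => x _.
  by rewrite mulrA resid_flip// mulNr mulrA.
have -> : S = (S + S) / 2 by field.
rewrite [X in (_ + X) / _]SE -big_split/= mulr_suml.
by apply: eq_bigr => x _; field.
Qed.

(** Antisymmetrization of [y_i * e^H]: the product varies through [y_i] and
    through [e^H], and the latter factor changes by at most [3 |dH|] relative to
    [e^H] because [|dH| <= 1] and [e < 3]. *)
Lemma tilted_resid_le J (H : config n -> R) (y : config n -> 'I_n -> R) :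
  interaction_matrix J ->
  (forall x i, `|H x - H (flip_at i x)| <= 1) ->
  \sum_x ising_weight J x * (expR (H x) * \sum_i resid J x i * y x i) <=
  \sum_x ising_weight J x * (expR (H x) *
    (3 * \sum_i (`|y x i - y (flip_at i x) i|
                 + `|y x i| * `|H x - H (flip_at i x)|))).
Proof.
move=> Jint H1.
have e3 : expR 1 <= 3 :> R := ltW (expR1_lt3 R).
have -> : \sum_x ising_weight J x * (expR (H x) * \sum_i resid J x i * y x i)
    = \sum_i \sum_x ising_weight J x * (resid J x i * (y x i * expR (H x))).
  rewrite exchange_big/=; apply: eq_bigr => x _.
  by rewrite !mulr_sumr; apply: eq_bigr => i _; ring.
have -> : \sum_x ising_weight J x * (expR (H x) *
    (3 * \sum_i (`|y x i - y (flip_at i x) i|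
                 + `|y x i| * `|H x - H (flip_at i x)|)))
  = \sum_i \sum_x ising_weight J x * (expR (H x) *
    (3 * (`|y x i - y (flip_at i x) i|
                 + `|y x i| * `|H x - H (flip_at i x)|))).
  rewrite exchange_big/=; apply: eq_bigr => x _.
  by rewrite !mulr_sumr.
apply: ler_sum => i _; rewrite resid_antisymmetrize//; apply: ler_sum => x _.
apply: ler_wpM2l; first exact/ltW/ising_weight_gt0.
apply: le_trans (ler_norm _) _; rewrite normrM.
set x' := flip_at i x; set D := H x - H x'; have D1 : `|D| <= 1 := H1 x i.
have -> : y x i * expR (H x) - y x' i * expR (H x') =
  expR (H x) * ((y x i - y x' i) * expR (- D) + y x i * (1 - expR (- D))).
  rewrite (_ : expR (H x') = expR (H x) * expR (- D)); first by ring.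
  by rewrite -expRD /D; congr expR; ring.
rewrite -mulrA normrM (ger0_norm (expR_ge0 _)) mulrCA.
apply: ler_wpM2l; first exact: expR_ge0.
move: D1; rewrite ler_norml => /andP[D1 D2].
have ED : expR (- D) <= 3 by apply: le_trans e3; rewrite ler_expR; lra.
have E0 := expR_ge0 (- D).
have dE : `|1 - expR (- D)| <= 3 * `|D|.
  rewrite ler_norml; apply/andP; split.
    have := expR_ge1Dx D; have : expR D * expR (- D) = 1 by rewrite -expRD subrr expR0.
    move=> h1 h2; have [D0|D0] := leP 0 D.
      have : expR (- D) <= 1 by rewrite -[leRHS]expR0 ler_expR; lra.
      by have := normr_ge0 D; lra.
    rewrite ltr0_norm//; nra.
  have := expR_ge1Dx (- D); have := ler_norm D; have := normr_ge0 D; lra.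
apply: (@le_trans _ _ (2 * ((`|y x i - y x' i| * 3 + `|y x i| * (3 * `|D|)) / 2))).
  apply: ler_pM => //; first exact: norm_resid_le.
  rewrite normrM [`|2^-1|]ger0_norm// ler_wpM2r//.
  apply: le_trans (ler_normD _ _) _; rewrite !normrM (ger0_norm E0).
  by apply: lerD; apply: ler_wpM2l.
lra.
Qed.

End Flip.

(** * An exponential inequality for centred spins *)

Section Concentration.
Variables (R : realType) (n : nat) (J A : 'M[R]_n) (mu : R).
Hypotheses (Jint : interaction_matrix J) (Aint : interaction_matrix A).
Implicit Types (x : config n) (i j k : 'I_n).

(** Bounds half of the effect that flipping spin [j] has on [resid J x i] (see
    [flip_r]); the factor 4 comes from [tanh_lipschitz]. *)
Definition influence i j : R := (i == j)%:R + 4 * `|J i j|.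

Hypotheses (mu1 : 1 <= mu) (infl_le : forall i, \sum_j influence i j <= mu)
  (A_le : forall i, \sum_j `|A i j| <= mu).

(** The same for [local_field A x i] and for [resid2 x i] (see [flip_rho]). *)
Definition influence2 i j : R := \sum_k `|A i k| * influence k j.

(** The diagonal entries of the square of [A], as [A] is symmetric. *)
Definition row_sqr i : R := \sum_j A i j ^+ 2.
Definition resid2 x i : R := \sum_k A i k * resid J x k.

Local Notation a := (local_field A).
Local Notation r := (resid J).
Local Notation rho := resid2.
Local Notation F := (\sum_i row_sqr i).
Local Notation spread i := (\sum_k influence k i * row_sqr k).

Let mu0 : 0 <= mu. Proof. exact: le_trans mu1. Qed.

Let symA i j : A i j = A j i.
Proof. by case: Aint => e _; rewrite -[in LHS]e mxE. Qed.

Let symJ i j : J i j = J j i.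
Proof. by case: Jint => e _; rewrite -[in LHS]e mxE. Qed.

Let Aii i : A i i = 0. Proof. by case: Aint. Qed.
Let Jii i : J i i = 0. Proof. by case: Jint. Qed.

Let inflC i j : influence i j = influence j i.
Proof. by rewrite /influence eq_sym symJ. Qed.

Let infl_ge0 i j : 0 <= influence i j.
Proof. by rewrite addr_ge0// mulr_ge0. Qed.

Let infl_ge1 i : 1 <= influence i i.
Proof. by rewrite /influence eqxx lerDl mulr_ge0. Qed.

Let infl_lec j : \sum_i influence i j <= mu.
Proof. by under eq_bigr do rewrite inflC; exact: infl_le. Qed.

Let A_lec j : \sum_i `|A i j| <= mu.
Proof. by under eq_bigr do rewrite symA; exact: A_le. Qed.

Let infl2_ge0 i j : 0 <= influence2 i j.
Proof. by apply: sumr_ge0 => k _; rewrite mulr_ge0. Qed.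

Let A_infl2 i j : `|A i j| <= influence2 i j.
Proof.
rewrite /influence2 (bigD1 j)//= -[leLHS]addr0 lerD//; last first.
  by apply: sumr_ge0 => k _; rewrite mulr_ge0.
by rewrite ler_peMr.
Qed.

Let infl2_le i : \sum_j influence2 i j <= mu ^+ 2.
Proof.
rewrite exchange_big/= expr2.
apply: (@le_trans _ _ (\sum_k `|A i k| * mu)).
  by apply: ler_sum => k _; rewrite -mulr_sumr ler_wpM2l.
by rewrite -mulr_suml ler_wpM2r.
Qed.

Let infl2_lec j : \sum_i influence2 i j <= mu ^+ 2.
Proof.
rewrite exchange_big/= expr2.
apply: (@le_trans _ _ (\sum_k mu * influence k j)).
  by apply: ler_sum => k _; rewrite -mulr_suml ler_wpM2r.
by rewrite -mulr_sumr ler_wpM2l.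
Qed.

Let row_sqr_ge0 i : 0 <= row_sqr i.
Proof. by apply: sumr_ge0 => j _; rewrite sqr_ge0. Qed.

Let F_ge0 : 0 <= F. Proof. exact: sumr_ge0. Qed.

Let row_sqr_le i : row_sqr i <= mu ^+ 2.
Proof.
rewrite /row_sqr; under eq_bigr do rewrite -real_normK ?num_real//.
exact: sum_sqr_le.
Qed.

Let sum_row_sqr2 : \sum_i row_sqr i ^+ 2 <= mu ^+ 2 * F.
Proof. by rewrite mulr_sumr; apply: ler_sum => i _; rewrite expr2 ler_wpM2r. Qed.

Let spread_ge0 i : 0 <= spread i.
Proof. by apply: sumr_ge0 => k _; rewrite mulr_ge0. Qed.

Let spread_le i : spread i <= mu ^+ 3.
Proof.
apply: (@le_trans _ _ (\sum_k influence k i * mu ^+ 2)).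
  by apply: ler_sum => k _; rewrite ler_wpM2l.
by rewrite -mulr_suml (exprS mu 2) ler_wpM2r ?exprn_ge0.
Qed.

Let sum_spread : \sum_i spread i <= mu * F.
Proof.
rewrite exchange_big/= mulr_sumr; apply: ler_sum => k _.
by rewrite -mulr_suml ler_wpM2r.
Qed.

Let sum_spread2 : \sum_i spread i ^+ 2 <= mu ^+ 4 * F.
Proof.
apply: (@le_trans _ _ (mu ^+ 2 * \sum_i row_sqr i ^+ 2)).
  by apply: (@schur_test _ _ (fun i k => influence k i)) => //.
by rewrite (exprD mu 2 2) -mulrA ler_wpM2l ?exprn_ge0.
Qed.

(** Cauchy-Schwarz with the weights [influence k i], of total mass at most
    [mu]. This is what keeps the sums over [i] of second-order effects below a
    multiple of [F], with no dependence on [n]. *)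
Let infl2_sqr i : \sum_j influence2 j i ^+ 2 <= mu * spread i.
Proof.
apply: (@le_trans _ _ (\sum_j mu * \sum_k influence k i * `|A j k| ^+ 2)).
  apply: ler_sum => j _; rewrite /influence2.
  under eq_bigr do rewrite mulrC.
  apply: le_trans (sqr_weighted_sum _ _) _ => //.
  apply: ler_wpM2r => //; apply: sumr_ge0 => k _.
  by rewrite mulr_ge0 ?exprn_ge0.
rewrite -mulr_sumr ler_wpM2l// exchange_big/=; apply: ler_sum => k _.
rewrite -mulr_sumr ler_wpM2l//; apply: ler_sum => j _.
by rewrite real_normK ?num_real// symA.
Qed.

Let a_le x j : `|a x j| <= mu. Proof. exact: norm_local_field_le. Qed.

Let rho_le x j : `|rho x j| <= 2 * mu.
Proof.
apply: le_trans (ler_norm_sum _ _ _) _.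
apply: (@le_trans _ _ (\sum_k `|A j k| * 2)).
  by apply: ler_sum => k _; rewrite normrM ler_wpM2l// norm_resid_le.
by rewrite -mulr_suml mulrC ler_wpM2l.
Qed.

Let flip_r x i j : `|r x j - r (flip_at i x) j| <= 2 * influence j i.
Proof.
rewrite /resid spin_flip local_field_flip.
set h := local_field J x j; set h' := h - _.
have -> : spin R x j - tanh h - (spin R x j - 2 * (j == i)%:R * spin R x i - tanh h')
  = (j == i)%:R * (2 * spin R x i) - (tanh h - tanh h') by ring.
apply: le_trans (ler_normB _ _) _; rewrite /influence mulrDr; apply: lerD.
  by rewrite !normrM norm_spin mulr1 ger0_norm// ger0_norm// mulrC.
apply: le_trans (tanh_lipschitz _ _) _.
have -> : h - h' = 2 * J j i * spin R x i by rewrite /h'; ring.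
by rewrite !normrM norm_spin mulr1 ger0_norm//; lra.
Qed.

Let flip_a x i j : `|a x j - a (flip_at i x) j| <= 2 * `|A j i|.
Proof.
by rewrite local_field_flip opprB addrC subrK !normrM norm_spin mulr1 ger0_norm.
Qed.

Let flip_rho x i j : `|rho x j - rho (flip_at i x) j| <= 2 * influence2 j i.
Proof.
rewrite -sumrB mulr_sumr; apply: le_trans (ler_norm_sum _ _ _) _.
apply: ler_sum => k _; rewrite -mulrBr normrM mulrCA ler_wpM2l//.
Qed.

(** [T2] is [<r, A^2 x>], and [T3] is the part of it in which [r_j] meets its own
    spin [x_j]; in [T1] and [T2 - T3] the coefficient of each [r_j] does not
    depend on [x_j]. *)
Let T1 x := \sum_j r x j * a x j.
Let T2 x := \sum_j rho x j * a x j.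
Let T3 x := \sum_j row_sqr j * (r x j * spin R x j).
Let T4 x := \sum_j rho x j ^+ 2.
Let T5 x := \sum_j a x j ^+ 2.

Let T1_flip x i : `|T1 x - T1 (flip_at i x)| <=
  2 * (\sum_j influence j i * `|a x j|) + 2 * `|rho x i| + 4 * influence2 i i.
Proof.
set x' := flip_at i x.
have -> : T1 x - T1 x' = \sum_j (r x j - r x' j) * a x j + 2 * spin R x i * rho x' i.
  rewrite /T1 -sumrB /resid2 mulr_sumr -big_split/=; apply: eq_bigr => j _.
  by rewrite /x' local_field_flip (symA i j); ring.
apply: le_trans (ler_normD _ _) _; rewrite -addrA; apply: lerD.
  apply: le_trans (ler_norm_sum _ _ _) _; rewrite mulr_sumr.
  by apply: ler_sum => j _; rewrite normrM mulrA ler_wpM2r// flip_r.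
have := flip_rho x i i; rewrite -/x' !normrM norm_spin mulr1 [`|2|]ger0_norm// => h.
have : `|rho x' i| <= `|rho x i| + `|rho x i - rho x' i|.
  by rewrite -{1}(subKr (rho x i) (rho x' i)) ler_normB.
lra.
Qed.

Let T2_flip x i : `|T2 x - T2 (flip_at i x)| <=
  2 * (\sum_j influence2 j i * (`|a x j| + `|rho x j|))
    + 4 * \sum_j influence2 j i ^+ 2.
Proof.
have h j : `|a x j - a (flip_at i x) j| <= 2 * influence2 j i.
  by apply: le_trans (flip_a _ _ _) _; rewrite ler_wpM2l.
apply: le_trans (dist_dot_le (flip_rho x i) h) _.
under [in leRHS]eq_bigr do rewrite mulrDr.
rewrite big_split/= mulrDr lerD2l.
by under eq_bigr do rewrite -expr2.
Qed.

(** Since the square of a spin is 1, [r_j * x_j = 1 - tanh h_j * x_j], whose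
    variation obeys the same bound as that of [r_j]. *)
Let T3_flip x i : `|T3 x - T3 (flip_at i x)| <= 2 * spread i.
Proof.
rewrite -sumrB mulr_sumr; apply: le_trans (ler_norm_sum _ _ _) _.
apply: ler_sum => j _; rewrite -mulrBr normrM ger0_norm//.
rewrite mulrA [leRHS]mulrC; apply: ler_wpM2l => //.
have e (t : R) z : (spin R z j - t) * spin R z j = 1 - t * spin R z j.
  by rewrite mulrBl spin_sqr.
rewrite /resid !e spin_flip local_field_flip.
set h := local_field J x j.
have [->|ji] := eqVneq j i.
  rewrite Jii mulr0 mul0r subr0.
  have -> : 1 - tanh h * spin R x i
      - (1 - tanh h * (spin R x i - 2 * (true)%:R * spin R x i))
    = - (2 * (tanh h * spin R x i)) by rewrite /=; ring.
  rewrite normrN !normrM norm_spin mulr1 [`|2|]ger0_norm// ler_wpM2l//.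
  apply: le_trans (infl_ge1 i); rewrite ler_norml.
  by have := tanh_lt1 h; have := tanh_gtN1 h => /ltW -> /ltW ->.
have -> : 1 - tanh h * spin R x j
   - (1 - tanh (h - 2 * J j i * spin R x i) * (spin R x j - 2 * (false)%:R * spin R x i))
  = - ((tanh h - tanh (h - 2 * J j i * spin R x i)) * spin R x j).
  by rewrite /=; ring.
rewrite normrN normrM norm_spin mulr1.
apply: le_trans (tanh_lipschitz _ _) _.
rewrite opprB addrC subrK !normrM norm_spin mulr1 [`|2|]ger0_norm//.
by rewrite /influence (negbTE ji) add0r; lra.
Qed.

Let T4_flip x i : `|T4 x - T4 (flip_at i x)| <=
  4 * (\sum_j influence2 j i * `|rho x j|) + 4 * \sum_j influence2 j i ^+ 2.
Proof.
have e y : T4 y = \sum_j rho y j * rho y j.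
  by apply: eq_bigr => j _; rewrite expr2.
rewrite !e; apply: le_trans (dist_dot_le (flip_rho x i) (flip_rho x i)) _.
rewrite [X in _ + 4 * X](eq_bigr (fun j => influence2 j i ^+ 2)) => [|j _]; last first.
  by rewrite expr2.
lra.
Qed.

Let T5_flip x i : `|T5 x - T5 (flip_at i x)| <=
  4 * (\sum_j influence2 j i * `|a x j|) + 4 * \sum_j influence2 j i ^+ 2.
Proof.
have h j : `|a x j - a (flip_at i x) j| <= 2 * influence2 j i.
  by apply: le_trans (flip_a _ _ _) _; rewrite ler_wpM2l.
have e y : T5 y = \sum_j a y j * a y j.
  by apply: eq_bigr => j _; rewrite expr2.
rewrite !e; apply: le_trans (dist_dot_le h h) _.
rewrite [X in _ + 4 * X](eq_bigr (fun j => influence2 j i ^+ 2)) => [|j _]; last first.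
  by rewrite expr2.
lra.
Qed.

Section Exponential.
Variables (s theta p q d : R).
Hypotheses (s0 : 0 <= s) (theta01 : 0 <= theta <= 1) (q0 : 0 <= q)
  (qp : q <= p) (ps : p <= s).

Let p0 : 0 <= p := le_trans q0 qp.
Let qs : q <= s := le_trans qp ps.

(** Coefficients of [potential] with respect to the [r_i] (see [sum_ry]). The
    part multiplied by [s] is free of [x_i], because the diagonal term of
    [A^2 x] is removed from it. *)
Let y x i := s * (a x i - theta * (\sum_j A i j * a x j - row_sqr i * spin R x i))
  + 2 * q * \sum_j A i j * rho x j.

(** A linear form in [r], with quadratic corrections. Passing from [potential]
    to [\sum_i r_i y_i] doubles the term [q |A r|^2], and so leaves
    [- q |A r|^2 - p |A x|^2 - d F] to compensate the errors of order [s^2]. *)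
Definition potential x : R :=
  s * (\sum_j r x j * a x j - theta * (\sum_j rho x j * a x j)
         + theta * \sum_j row_sqr j * (r x j * spin R x j))
  + q * (\sum_j rho x j ^+ 2) - p * (\sum_j a x j ^+ 2) - d * F.
Local Notation H := potential.

Let sum_ry x :
  \sum_i r x i * y x i = s * (T1 x - theta * T2 x + theta * T3 x) + 2 * q * T4 x.
Proof.
have sym_dot (u v : 'I_n -> R) :
    \sum_i u i * (\sum_j A i j * v j) = \sum_j (\sum_k A j k * u k) * v j.
  under eq_bigr do rewrite mulr_sumr.
  rewrite exchange_big/=; apply: eq_bigr => j _; rewrite mulr_suml.
  by apply: eq_bigr => i _; rewrite (symA i j); ring.
have -> : T2 x = \sum_i r x i * (\sum_j A i j * a x j) by rewrite sym_dot.
have -> : T4 x = \sum_i r x i * (\sum_j A i j * rho x j).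
  by rewrite sym_dot; apply: eq_bigr => j _; rewrite expr2.
rewrite /T1 /T3 !mulr_sumr -!sumrN -!big_split/= !mulr_sumr -!big_split/=.
by apply: eq_bigr => i _; rewrite /y; ring.
Qed.

(** [s * (g x i + E i)] bounds the change of [potential] under a flip of spin
    [i]: [g] collects the first-order terms, which are small together with
    [A x] and [A r], and [E] the second-order ones. *)
Let g x i := \sum_j (2 * influence j i + 6 * influence2 j i) * (`|a x j| + `|rho x j|).
Let E i := 4 * influence2 i i + 14 * mu * spread i.

Let gE x i : g x i = 2 * (\sum_j influence j i * `|a x j|)
  + 2 * (\sum_j influence j i * `|rho x j|)
  + 6 * (\sum_j influence2 j i * `|a x j|) + 6 * (\sum_j influence2 j i * `|rho x j|).
Proof.
rewrite !mulr_sumr -!big_split/=; apply: eq_bigr => j _; ring.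
Qed.

Let infl_term x i (u : 'I_n -> R) : `|u i| <= \sum_j influence j i * `|u j|.
Proof.
apply: le_trans (le_sum_term i _); first by rewrite ler_peMl.
by move=> j; rewrite mulr_ge0.
Qed.

Let sum_ge0 (U : 'I_n -> 'I_n -> R) (u : 'I_n -> R) i :
  (forall i j, 0 <= U i j) -> 0 <= \sum_j U j i * `|u j|.
Proof. by move=> U0; apply: sumr_ge0 => j _; rewrite mulr_ge0. Qed.

Let H_flip x i : `|H x - H (flip_at i x)| <= s * (g x i + E i).
Proof.
set x' := flip_at i x.
have -> : H x - H x' = s * (T1 x - T1 x') - s * theta * (T2 x - T2 x')
    + s * theta * (T3 x - T3 x') + q * (T4 x - T4 x') - p * (T5 x - T5 x').
  by rewrite /H /T1 /T2 /T3 /T4 /T5; ring.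
have /andP[t0 t1] := theta01.
have st : s * theta <= s by rewrite ler_piMr.
have st0 : 0 <= s * theta by rewrite mulr_ge0.
have sc (c z B : R) : 0 <= c -> c <= s -> `|z| <= B -> `|c * z| <= s * B.
  by move=> c0 cs zB; rewrite normrM ger0_norm// ler_pM.
apply: le_trans (ler_normB _ _) _.
apply: le_trans (lerD (ler_normD _ _) (lexx _)) _.
apply: le_trans (lerD (lerD (ler_normD _ _) (lexx _)) (lexx _)) _.
apply: le_trans (lerD (lerD (lerD (ler_normB _ _) (lexx _)) (lexx _)) (lexx _)) _.
apply: le_trans (lerD (lerD (lerD (lerD (sc _ _ _ s0 (lexx _) (T1_flip x i))
  (sc _ _ _ st0 st (T2_flip x i))) (sc _ _ _ st0 st (T3_flip x i)))
  (sc _ _ _ q0 qs (T4_flip x i))) (sc _ _ _ p0 ps (T5_flip x i))) _.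
rewrite -!mulrDr; apply: ler_wpM2l => //.
under [\sum_j influence2 j i * (_ + _)]eq_bigr do rewrite mulrDr.
rewrite big_split/= gE /E.
have := infl_term x i (rho x).
have := sum_ge0 (a x) i infl_ge0; have := sum_ge0 (rho x) i infl_ge0.
have := sum_ge0 (a x) i infl2_ge0; have := sum_ge0 (rho x) i infl2_ge0.
have := infl2_sqr i.
have : spread i <= mu * spread i by rewrite ler_peMl.
lra.
Qed.

Let norm_y x i : `|y x i| <= s * (g x i + row_sqr i).
Proof.
have /andP[t0 t1] := theta01.
have h1 (v : 'I_n -> R) : `|\sum_j A i j * v j| <= \sum_j influence2 j i * `|v j|.
  apply: le_trans (ler_norm_sum _ _ _) _; apply: ler_sum => j _.
  by rewrite normrM symA ler_wpM2r.
have h2 : `|y x i| <= s * (`|a x i| + (\sum_j influence2 j i * `|a x j| + row_sqr i))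
   + 2 * s * \sum_j influence2 j i * `|rho x j|.
  apply: le_trans (ler_normD _ _) _; rewrite !normrM; apply: lerD.
    rewrite ger0_norm//; apply: ler_wpM2l => //.
    apply: le_trans (ler_normB _ _) _; rewrite lerD2l normrM ger0_norm//.
    apply: (@le_trans _ _ `|\sum_j A i j * a x j - row_sqr i * spin R x i|).
      by rewrite ler_piMl.
    apply: le_trans (ler_normB _ _) _; apply: lerD => //.
    by rewrite normrM norm_spin mulr1 ger0_norm.
  rewrite [`|2|]ger0_norm// [`|q|]ger0_norm//.
  by apply: ler_pM; rewrite ?mulr_ge0// ler_wpM2l.
apply: le_trans h2 _; rewrite gE.
have := infl_term x i (a x).
have := sum_ge0 (a x) i infl_ge0; have := sum_ge0 (rho x) i infl_ge0.
have := sum_ge0 (a x) i infl2_ge0; have := sum_ge0 (rho x) i infl2_ge0.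
move=> *; rewrite [2 * s]mulrC -mulrA -mulrDr; apply: ler_wpM2l => //; lra.
Qed.

(** Only the last term of [y] involves [x_i], through [resid2]. *)
Let y_flip x i : `|y x i - y (flip_at i x) i| <= 4 * q * (mu * spread i).
Proof.
set x' := flip_at i x.
have -> : y x i - y x' i = 2 * q * \sum_j A i j * (rho x j - rho x' j).
  have aE : a x' i = a x i by rewrite local_field_flip_diag.
  have AaE : \sum_j A i j * a x j - \sum_j A i j * a x' j = 2 * row_sqr i * spin R x i.
    rewrite -sumrB /row_sqr mulr_sumr mulr_suml; apply: eq_bigr => j _.
    by rewrite /x' local_field_flip (symA j i); ring.
  have sE : spin R x' i = - spin R x i by rewrite spin_flip eqxx/=; ring.
  have -> : \sum_j A i j * (rho x j - rho x' j) =
      \sum_j A i j * rho x j - \sum_j A i j * rho x' j.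
    by rewrite -sumrB; apply: eq_bigr => j _; rewrite mulrBr.
  move/eqP: AaE; rewrite subr_eq => /eqP AaE.
  by rewrite /y aE sE AaE; ring.
rewrite normrM ger0_norm ?mulr_ge0//.
have -> : 4 * q * (mu * spread i) = 2 * q * (2 * (mu * spread i)) by ring.
apply: ler_wpM2l; first by rewrite mulr_ge0.
apply: le_trans (ler_norm_sum _ _ _) _.
apply: (@le_trans _ _ (2 * \sum_j influence2 j i ^+ 2)); last first.
  by rewrite ler_wpM2l.
rewrite mulr_sumr; apply: ler_sum => j _; rewrite normrM symA.
rewrite expr2 mulrCA; apply: ler_pM => //.
exact: flip_rho.
Qed.

Let sum_g2 x : \sum_i g x i ^+ 2 <= 128 * mu ^+ 4 * (T4 x + T5 x).
Proof.
pose U i j := 2 * influence j i + 6 * influence2 j i.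
have mu2 : mu <= mu ^+ 2 by rewrite expr2 ler_peMl.
apply: (@le_trans _ _ ((8 * mu ^+ 2) ^+ 2 *
    \sum_j (`|a x j| + `|rho x j|) ^+ 2)).
  apply: (@schur_test _ _ U) => [i j|i|j].
  - by rewrite addr_ge0// mulr_ge0.
  - rewrite big_split/= -!mulr_sumr.
    by have := infl_lec i; have := infl2_lec i; lra.
  - rewrite big_split/= -!mulr_sumr.
    by have := infl_le j; have := infl2_le j; lra.
have -> : 128 * mu ^+ 4 * (T4 x + T5 x)
    = (8 * mu ^+ 2) ^+ 2 * (2 * (T4 x + T5 x)) by ring.
apply: ler_wpM2l; first by rewrite sqr_ge0.
rewrite /T4 /T5 -big_split/= mulr_sumr; apply: ler_sum => j _.
rewrite -[a x j ^+ 2]real_normK ?num_real// -[rho x j ^+ 2]real_normK ?num_real//.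
have := sqr_ge0 (`|a x j| - `|rho x j|); lra.
Qed.

Let sum_E2 : \sum_i E i ^+ 2 <= 424 * mu ^+ 6 * F.
Proof.
have d2 i : influence2 i i ^+ 2 <= mu * spread i.
  apply: le_trans (infl2_sqr i).
  by apply: (@le_sum_term _ _ (fun j => influence2 j i ^+ 2)) => j; rewrite sqr_ge0.
apply: (@le_trans _ _ (\sum_i (32 * (mu * spread i) + 392 * mu ^+ 2 * spread i ^+ 2))).
  apply: ler_sum => i _; have := d2 i.
  by have := sqr_ge0 (4 * influence2 i i - 14 * mu * spread i); rewrite /E; nra.
rewrite big_split/= -!mulr_sumr.
have : mu ^+ 2 * \sum_i spread i ^+ 2 <= mu ^+ 6 * F.
  by rewrite (exprD mu 2 4) -mulrA ler_wpM2l ?exprn_ge0.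
have : mu * \sum_i spread i <= mu ^+ 2 * F by rewrite expr2 -mulrA ler_wpM2l.
have : mu ^+ 2 * F <= mu ^+ 6 * F.
  by rewrite ler_wpM2r// ler_weXn2l.
lra.
Qed.

Hypotheses (s_small : 42 * mu ^+ 4 * s <= 1)
  (s2q : 3825 * s ^+ 2 * mu ^+ 6 <= q) (dE : 13 * q * mu ^+ 2 <= d).

Let H_flip1 x i : `|H x - H (flip_at i x)| <= 1.
Proof.
apply: le_trans (H_flip x i) _; apply: le_trans s_small; rewrite mulrC.
apply: ler_wpM2r => //.
have m2 : mu <= mu ^+ 2 by rewrite expr2 ler_peMl.
have m34 : mu ^+ 3 <= mu ^+ 4 by rewrite ler_weXn2l.
have m24 : mu ^+ 2 <= mu ^+ 4 by rewrite ler_weXn2l.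
have gle : g x i <= 24 * mu ^+ 3.
  apply: (@le_trans _ _ (\sum_j (2 * influence j i + 6 * influence2 j i) * (3 * mu))).
    apply: ler_sum => j _; apply: ler_wpM2l; first by rewrite addr_ge0 ?mulr_ge0.
    by have := a_le x j; have := rho_le x j; lra.
  rewrite -mulr_suml big_split/= -!mulr_sumr.
  have -> : 24 * mu ^+ 3 = (2 * mu ^+ 2 + 6 * mu ^+ 2) * (3 * mu) by ring.
  apply: ler_wpM2r; first by rewrite mulr_ge0.
  by have := infl_lec i; have := infl2_lec i; lra.
have i2 : influence2 i i <= mu ^+ 2.
  by apply: le_trans (infl2_le i); apply: le_sum_term.
have : mu * spread i <= mu ^+ 4 by rewrite exprS ler_wpM2l.
rewrite /E; lra.
Qed.

(** In [tilted_resid_le], the change of [y_i] contributes a multiple of [q F],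
    and the change of [potential] contributes a multiple of
    [s^2 (|A x|^2 + |A r|^2 + F)]. The hypotheses on [q] and [d] make the negative
    terms of [potential] outweigh both, so that [E (H e^H) <= 0]. *)
Theorem exp_potential_le :
  \sum_x ising_weight J x * expR (H x) <= \sum_x ising_weight J x.
Proof.
(* [e^H - 1 <= H e^H]. *)
suff : \sum_x ising_weight J x * (expR (H x) * H x) <= 0.
  move=> h; rewrite -subr_le0 -sumrB; apply: le_trans h.
  apply: ler_sum => x _; rewrite -[X in _ - X]mulr1 -mulrBr.
  apply: ler_wpM2l; first exact/ltW/ising_weight_gt0.
  have := expR_ge1Dx (- H x); have := expR_ge0 (H x).
  have : expR (H x) * expR (- H x) = 1 by rewrite -expRD subrr expR0.
  nra.
have := tilted_resid_le y Jint H_flip1; rewrite -subr_le0 -sumrB.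
apply: le_trans.
apply: ler_sum => x _; rewrite -mulrBr.
apply: ler_wpM2l; first exact/ltW/ising_weight_gt0.
rewrite -mulrBr; apply: ler_wpM2l; first exact: expR_ge0.
rewrite sum_ry.
have mu61 : 1 <= mu ^+ 6 by rewrite exprn_ege1.
have T40 : 0 <= T4 x by apply: sumr_ge0 => j _; rewrite sqr_ge0.
have T50 : 0 <= T5 x by apply: sumr_ge0 => j _; rewrite sqr_ge0.
have h1 : \sum_i `|y x i - y (flip_at i x) i| <= 4 * q * (mu ^+ 2 * F).
  apply: le_trans (ler_sum _ (fun i _ => y_flip x i)) _.
  rewrite -!mulr_sumr; apply: ler_wpM2l; first by rewrite mulr_ge0.
  by rewrite expr2 -mulrA ler_wpM2l.
have h2 : \sum_i `|y x i| * `|H x - H (flip_at i x)|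
    <= 1275 * s ^+ 2 * mu ^+ 6 * (T4 x + T5 x + F).
  apply: (@le_trans _ _
     (s ^+ 2 * (3 * (\sum_i g x i ^+ 2 + \sum_i row_sqr i ^+ 2 + \sum_i E i ^+ 2)))).
    rewrite -!big_split/= !mulr_sumr; apply: ler_sum => i _.
    apply: le_trans (ler_pM _ _ (norm_y x i) (H_flip x i)) _ => //.
    have -> : s * (g x i + row_sqr i) * (s * (g x i + E i))
      = s ^+ 2 * ((g x i + row_sqr i) * (g x i + E i)) by ring.
    apply: ler_wpM2l; first by rewrite sqr_ge0.
    have := sqr_ge0 (g x i - row_sqr i); have := sqr_ge0 (g x i - E i).
    have := sqr_ge0 (row_sqr i - E i).
    have := sqr_ge0 (g x i); have := sqr_ge0 (row_sqr i); have := sqr_ge0 (E i).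
    lra.
  have -> : 1275 * s ^+ 2 * mu ^+ 6 * (T4 x + T5 x + F)
    = s ^+ 2 * (3 * (425 * (mu ^+ 6 * (T4 x + T5 x + F)))) by ring.
  apply: ler_wpM2l; first by rewrite sqr_ge0.
  apply: ler_wpM2l => //.
  have := sum_g2 x; have := sum_row_sqr2; have := sum_E2.
  have : mu ^+ 4 * (T4 x + T5 x) <= mu ^+ 6 * (T4 x + T5 x).
    by rewrite ler_wpM2r ?addr_ge0// ler_weXn2l.
  have : mu ^+ 2 * F <= mu ^+ 6 * F by rewrite ler_wpM2r// ler_weXn2l.
  have : 0 <= mu ^+ 6 * (T4 x + T5 x).
    by rewrite mulr_ge0 ?addr_ge0// exprn_ge0.
  lra.
rewrite big_split/=.
have h3 : 3825 * s ^+ 2 * mu ^+ 6 * (T4 x + T5 x + F) <= q * (T4 x + T5 x + F).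
  by rewrite ler_wpM2r ?addr_ge0.
have h4 : q * T5 x <= p * T5 x by rewrite ler_wpM2r.
have h5 : 13 * q * mu ^+ 2 * F <= d * F by rewrite ler_wpM2r.
have h6 : q * F <= q * mu ^+ 2 * F.
  by rewrite ler_wpM2r// ler_peMr// exprn_ege1.
rewrite /H -/(T1 x) -/(T2 x) -/(T3 x) -/(T4 x) -/(T5 x); lra.
Qed.

End Exponential.

End Concentration.

(** * Pseudo-likelihood of one sample *)

Section Norms.
Variable R : realType.

Lemma row_sum_le_norm_inf n (A : 'M[R]_n) i : \sum_j `|A i j| <= norm_inf A.
Proof. exact: (le_bigmax_cond 0 (fun i => \sum_j `|A i j|)). Qed.

Lemma norm_frob_sqr m n (A : 'M[R]_(m, n)) :
  norm_frob A ^+ 2 = \sum_i \sum_j A i j ^+ 2.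
Proof.
rewrite sqr_sqrtr//; apply: sumr_ge0 => i _; apply: sumr_ge0 => j _.
by rewrite sqr_ge0.
Qed.

Lemma norm_frob_ge0 m n (A : 'M[R]_(m, n)) : 0 <= norm_frob A.
Proof. exact: sqrtr_ge0. Qed.

End Norms.

Section PseudoLikelihood.
Variables (R : realType) (n : nat).
Implicit Types (A B J : 'M[R]_n) (x : config n).

(** The negative log-pseudo-likelihood of one sample. *)
Definition pseudo_loss A x : R := \sum_i logistic (spin R x i * local_field A x i).

(** As [1 + 4 * M <= expR (4 * M)], this bounds the rows of [influence] and of
    differences of two matrices of the class. Its inverse is at most
    [expR (- (2 * M)) / 2] and so replaces the exponentials of
    [logistic_strong_convex] and of [tanh_gap]. *)
Definition influence_bound (M : R) : R := 4 * expR (4 * M).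

(** Here [41 ^+ 4 >= 3825 * 676]: the error of order [s^2] in [potential], with
    constant 3825, must be below [q = s * w ^+ 7 / 676] (see
    [exp_pseudo_loss_le]). *)
Definition tilt (M : R) : R := (influence_bound M)^-1 ^+ 13 / 41 ^+ 4.
Definition curvature (M : R) : R := tilt M * (influence_bound M)^-1 ^+ 5 / 52.

Lemma interaction_matrixB A B : interaction_matrix A -> interaction_matrix B ->
  interaction_matrix (A - B).
Proof.
move=> [Asym A0] [Bsym B0]; split; first by rewrite linearB/= Asym Bsym.
by move=> i; rewrite !mxE A0 B0 subr0.
Qed.

Lemma tanh_spin x i (h : R) : tanh (spin R x i * h) = spin R x i * tanh h.
Proof. by rewrite /spin; case: (x i); rewrite ?mul1r// !mulN1r tanhN. Qed.

(** The derivative of the loss of spin [i] in its local field is [- resid], and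
    the local fields of matrices in the class lie in [[-M, M]]. *)
Lemma pseudo_loss_gap M J B x : interaction_matrix J -> norm_inf J <= M ->
  interaction_matrix B -> norm_inf B <= M ->
  - (\sum_i resid J x i * local_field (B - J) x i)
    + expR (- (2 * M)) / 4 * (\sum_i local_field (B - J) x i ^+ 2)
  <= pseudo_loss B x - pseudo_loss J x.
Proof.
move=> Jint JM Bint BM; rewrite -sumrB -sumrN mulr_sumr -big_split/=.
apply: ler_sum => i _.
have le_M A : norm_inf A <= M -> `|spin R x i * local_field A x i| <= M.
  move=> AM; rewrite normrM norm_spin mul1r norm_local_field_le//.
  exact: le_trans (row_sum_le_norm_inf _ _) AM.
have := logistic_strong_convex (le_M _ JM) (le_M _ BM).
rewrite -mulrBr -local_fieldB tanh_spin.
have -> : (spin R x i * local_field (B - J) x i) ^+ 2 = local_field (B - J) x i ^+ 2.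
  by rewrite exprMn expr2 spin_sqr mul1r.
have -> : (spin R x i * tanh (local_field J x i) - 1) * (spin R x i * local_field (B - J) x i)
  = (spin R x i * spin R x i * tanh (local_field J x i) - spin R x i)
     * local_field (B - J) x i by ring.
rewrite spin_sqr /resid; lra.
Qed.

(** With [w] the inverse of [influence_bound M], the excess loss is at least
    [- T1 + w / 2 * T5], with [T1 = <r, A x>] and [T5 = |A x|^2]. Multiplied by
    [s], half of the quadratic term is kept as [p * T5] in [potential]. The other
    half is at least [s * w / 4] times [2 tau <A x, A r> - tau^2 |A r|^2], with
    [tau = w ^+ 3 / 13], which dictates [theta] and [q]. Completing [<A x, A r>]
    in [potential] by its diagonal part leaves a gain of [s * theta * w] times
    the squared Frobenius norm; half of it pays for [d], and half is the
    conclusion. *)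
Lemma exp_pseudo_loss_le M J B : interaction_matrix J -> norm_inf J <= M ->
  interaction_matrix B -> norm_inf B <= M -> 0 < M ->
  \sum_x ising J x * expR (tilt M * (pseudo_loss J x - pseudo_loss B x))
    <= expR (- (curvature M * norm_frob (B - J) ^+ 2)).
Proof.
move=> Jint JM Bint BM M0; set A := B - J.
have Aint : interaction_matrix A by apply: interaction_matrixB.
set mu := influence_bound M; set w := mu^-1; set s := tilt M.
have e4 : 1 + 4 * M <= expR (4 * M) by apply: expR_ge1Dx.
have mu1 : 1 <= mu by rewrite /mu /influence_bound; lra.
have mu0 : 0 < mu by lra.
have w0 : 0 < w by rewrite invr_gt0.
have wmu : w * mu = 1 by rewrite mulVf// gt_eqF.
have w1 : w <= 1 by rewrite invf_le1.
have s0 : 0 < s by rewrite /s /tilt divr_gt0// exprn_gt0.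
have infl_le i : \sum_j influence J i j <= mu.
  rewrite /influence big_split/= -mulr_sumr.
  rewrite (bigD1 i)//= eqxx big1 ?addr0 => [|j]; last first.
    by rewrite eq_sym => /negbTE ->.
  have := le_trans (row_sum_le_norm_inf J i) JM; rewrite /mu /influence_bound /=; lra.
have A_le i : \sum_j `|A i j| <= mu.
  apply: (@le_trans _ _ (\sum_j (`|B i j| + `|J i j|))).
    by apply: ler_sum => j _; rewrite !mxE ler_normB.
  rewrite big_split/=.
  have := le_trans (row_sum_le_norm_inf J i) JM.
  have := le_trans (row_sum_le_norm_inf B i) BM.
  rewrite /mu /influence_bound /=; lra.
have wM : w <= expR (- (2 * M)) / 2.
  have E1 : 1 <= expR (2 * M) by rewrite -[leLHS]expR0 ler_expR; lra.
  have EE : expR (2 * M) * expR (- (2 * M)) = 1 by rewrite -expRD subrr expR0.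
  have : mu = 4 * expR (2 * M) ^+ 2.
    by rewrite /mu /influence_bound -expRM_natl; congr (_ * expR _); ring.
  have := expR_gt0 (- (2 * M)); have := expR_gt0 (2 * M).
  nra.
have sw : s = w ^+ 13 / 41 ^+ 4 by [].
have gammaE : curvature M = s * w ^+ 5 / 52 by [].
clearbody s w mu.
pose theta := w ^+ 4 / 26; pose p := s * w / 4.
pose q := s * w ^+ 7 / 676; pose d := s * w ^+ 5 / 52.
have wk k : 0 < w ^+ k <= 1 by rewrite exprn_gt0// exprn_ile1// ltW.
have F0 : 0 <= \sum_i row_sqr A i.
  by apply: sumr_ge0 => i _; apply: sumr_ge0 => j _; rewrite sqr_ge0.
have FE : norm_frob A ^+ 2 = \sum_i row_sqr A i by rewrite norm_frob_sqr.
have pointwise x : s * (pseudo_loss J x - pseudo_loss B x)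
    <= potential J A s theta p q d x - curvature M * norm_frob A ^+ 2.
  have gap := pseudo_loss_gap x Jint JM Bint BM; rewrite -/A in gap.
  set T1 := \sum_i resid J x i * local_field A x i in gap.
  set T5 := \sum_i local_field A x i ^+ 2 in gap.
  pose T2 := \sum_j resid2 J A x j * local_field A x j.
  pose T3 := \sum_j row_sqr A j * (resid J x j * spin R x j).
  pose T4 := \sum_j resid2 J A x j ^+ 2.
  rewrite /potential -/T1 -/T2 -/T3 -/T4 -/T5 FE.
  have T50 : 0 <= T5 by apply: sumr_ge0 => j _; rewrite sqr_ge0.
  have hT3 : w * (\sum_i row_sqr A i) <= T3.
    rewrite mulr_sumr; apply: ler_sum => i _; rewrite mulrC.
    apply: ler_wpM2l; first by apply: sumr_ge0 => j _; rewrite sqr_ge0.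
    rewrite mulrBl spin_sqr mulrC -tanh_spin.
    have hM : spin R x i * local_field J x i <= M.
      apply: le_trans (ler_norm _) _; rewrite normrM norm_spin mul1r norm_local_field_le//.
      exact: le_trans (row_sum_le_norm_inf _ _) JM.
    have := tanh_gap (ltW M0) hM; have := expR_gt0 (- (2 * M)); lra.
  have hT5 : 2 * (w ^+ 3 / 13) * T2 - (w ^+ 3 / 13) ^+ 2 * T4 <= T5.
    rewrite -subr_ge0.
    have -> : T5 - (2 * (w ^+ 3 / 13) * T2 - (w ^+ 3 / 13) ^+ 2 * T4)
      = \sum_j (local_field A x j - w ^+ 3 / 13 * resid2 J A x j) ^+ 2.
      rewrite !mulr_sumr -!sumrB; apply: eq_bigr => j _; ring.
    by apply: sumr_ge0 => j _; rewrite sqr_ge0.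
  have gap' : pseudo_loss J x - pseudo_loss B x <= T1 - w / 2 * T5.
    have : w / 2 * T5 <= expR (- (2 * M)) / 4 * T5 by apply: ler_wpM2r => //; lra.
    lra.
  have k3 := ler_wpM2l (_ : 0 <= s * theta) hT3.
  have k5 := ler_wpM2l (_ : 0 <= s * w / 4) hT5.
  have kg := ler_wpM2l (ltW s0) gap'.
  apply: le_trans kg _.
  have /k3 {}k3 : 0 <= s * theta.
    have /andP[/ltW w4 _] := wk 4.
    by rewrite mulr_ge0 ?(ltW s0)// /theta divr_ge0.
  have /k5 {}k5 : 0 <= s * w / 4.
    by rewrite divr_ge0// mulr_ge0 ?ltW.
  rewrite gammaE /theta /p /q /d.
  rewrite /theta in k3.
  set G := \sum_i row_sqr A i in F0 FE hT3 k3 *.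
  have e3 : s * (w ^+ 4 / 26) * (w * G) = 2 * (s * w ^+ 5 / 52 * G) by field.
  have e5 : s * w / 4 * (2 * (w ^+ 3 / 13) * T2 - (w ^+ 3 / 13) ^+ 2 * T4)
     = s * (w ^+ 4 / 26 * T2) - s * w ^+ 7 / 676 * T4 by field.
  rewrite e3 in k3; rewrite e5 in k5.
  lra.
have Z0 : 0 < \sum_x ising_weight J x.
  rewrite (bigD1 [ffun=> true])//= ltr_pwDl ?ising_weight_gt0//.
  by apply: sumr_ge0 => x _; exact/ltW/ising_weight_gt0.
apply: (@le_trans _ _ (\sum_x (ising_weight J x * expR (potential J A s theta p q d x))
  * (expR (- (curvature M * norm_frob A ^+ 2)) / \sum_x ising_weight J x))).
  apply: ler_sum => x _; rewrite /ising.
  have := pointwise x; rewrite -ler_expR => h.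
  rewrite mulrAC mulrA ler_pM2r ?invr_gt0// -mulrA.
  by apply: ler_wpM2l; [exact/ltW/ising_weight_gt0 | rewrite -expRD].
rewrite -mulr_suml mulrCA ler_piMr ?expR_ge0// ler_pdivrMr// mul1r.
have /andP[w40 w41] := wk 4; have /andP[w70 w71] := wk 7.
apply: (exp_potential_le (mu := mu)) => //.
- exact: ltW.
- by rewrite /theta; apply/andP; split; lra.
- have : 0 < s * w ^+ 7 by rewrite mulr_gt0.
  by rewrite /q; lra.
- have /andP[w60 w61] := wk 6.
  have -> : q = s * w * (w ^+ 6 / 676) by rewrite /q; field.
  rewrite /p; apply: ler_wpM2l; first by apply: mulr_ge0; exact: ltW.
  by lra.
- by rewrite /p; nra.
- have -> : 42 * mu ^+ 4 * s = 42 / 41 ^+ 4 * (w * mu) ^+ 4 * w ^+ 9.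
    by rewrite sw; field.
  rewrite wmu expr1n mulr1; have /andP[? ?] := wk 9; lra.
- have -> : 3825 * s ^+ 2 * mu ^+ 6
     = 3825 / 41 ^+ 4 * (s * (w * mu) ^+ 6 * w ^+ 7) by rewrite expr2 {1}sw; field.
  rewrite wmu expr1n mulr1 /q.
  have : 0 < s * w ^+ 7 by rewrite mulr_gt0.
  lra.
- have -> : 13 * q * mu ^+ 2 = s * w ^+ 5 * (w * mu) ^+ 2 / 52.
    by rewrite /q; field.
  by rewrite wmu expr1n mulr1.
Qed.

End PseudoLikelihood.

(** * The spectral norm *)

Section SpectralNorm.
Variables (R : realType) (n : nat).
Implicit Types A B : 'M[R]_n.

Lemma norm_frob_col (v : 'cV[R]_n) : norm_frob v ^+ 2 = \sum_i v i 0 ^+ 2.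
Proof.
by rewrite norm_frob_sqr; apply: eq_bigr => i _; rewrite big_ord1.
Qed.

Lemma norm_frob_mulmx_le A (v : 'cV[R]_n) :
  norm_frob (A *m v) <= norm_frob A * norm_frob v.
Proof.
rewrite -(@ler_pXn2r _ 2)// ?nnegrE ?mulr_ge0 ?norm_frob_ge0//.
rewrite exprMn !norm_frob_col norm_frob_sqr mulr_suml.
apply: ler_sum => i _; rewrite mxE.
exact: cauchy_schwarz1.
Qed.

Lemma norm_frobZ (a : R) (v : 'cV[R]_n) : norm_frob (a *: v) = `|a| * norm_frob v.
Proof.
apply: (@pexpIrn _ 2) => //; rewrite ?nnegrE ?mulr_ge0 ?norm_frob_ge0//.
rewrite exprMn real_normK ?num_real// !norm_frob_col mulr_sumr.
by apply: eq_bigr => i _; rewrite mxE exprMn.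
Qed.

Lemma norm_spec_ubound A : ubound [set norm_frob (A *m v) | v in
  [set v : 'cV[R]_n | norm_frob v <= 1]] (norm_frob A).
Proof.
move=> _ /= [v v1 <-]; apply: le_trans (norm_frob_mulmx_le _ _) _.
by rewrite ler_piMr ?norm_frob_ge0.
Qed.

Let ball_set_nonempty A : [set norm_frob (A *m v) | v in
  [set v : 'cV[R]_n | norm_frob v <= 1]] !=set0.
Proof.
exists (norm_frob (A *m (0 : 'cV[R]_n))), 0 => //=.
have -> : norm_frob (0 : 'cV[R]_n) = 0; last by [].
rewrite /norm_frob big1 ?sqrtr0// => i _; rewrite big1// => j _.
by rewrite mxE expr0n.
Qed.

Lemma norm_spec_le_frob A : norm_spec A <= norm_frob A.
Proof. by apply: ge_sup; [exact: ball_set_nonempty|exact: norm_spec_ubound]. Qed.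

Lemma norm_spec_ball A (v : 'cV[R]_n) : norm_frob v <= 1 ->
  norm_frob (A *m v) <= norm_spec A.
Proof.
move=> v1; apply: ub_le_sup; last by exists v.
by exists (norm_frob A); exact: norm_spec_ubound.
Qed.

Lemma norm_spec_ge0 A : 0 <= norm_spec A.
Proof.
apply: le_trans (norm_frob_ge0 (A *m (0 : 'cV[R]_n))) (norm_spec_ball _ _).
have := norm_frobZ 0 0; rewrite scaler0 normr0 mul0r => ->; exact: ler01.
Qed.

Lemma norm_specP A (v : 'cV[R]_n) :
  norm_frob (A *m v) <= norm_spec A * norm_frob v.
Proof.
have [v0|v0] := leP (norm_frob v) 0.
  apply: le_trans (norm_frob_mulmx_le _ _) _.
  have -> : norm_frob v = 0 by apply/le_anti; rewrite v0 norm_frob_ge0.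
  by rewrite !mulr0.
have := @norm_spec_ball A ((norm_frob v)^-1 *: v).
rewrite -scalemxAr !norm_frobZ ger0_norm ?invr_ge0 ?norm_frob_ge0//.
rewrite mulVf ?gt_eqF// => /(_ (lexx _)).
by rewrite mulrC ler_pdivrMr.
Qed.

Lemma norm_frob_le_spec A : norm_frob A ^+ 2 <= n%:R * norm_spec A ^+ 2.
Proof.
have -> : norm_frob A ^+ 2 = \sum_(j < n) norm_frob (A *m (delta_mx j 0 : 'cV[R]_n)) ^+ 2.
  rewrite norm_frob_sqr exchange_big/=; apply: eq_bigr => j _.
  by rewrite norm_frob_col -colE; apply: eq_bigr => i _; rewrite mxE.
apply: (@le_trans _ _ (\sum_(j < n) norm_spec A ^+ 2)); last first.
  by rewrite sumr_const card_ord mulr_natl.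
apply: ler_sum => j _; rewrite lerXn2r ?nnegrE ?norm_frob_ge0 ?norm_spec_ge0//.
apply: norm_spec_ball; rewrite /norm_frob (bigD1 j)//= big_ord1 mxE !eqxx.
rewrite big1 ?addr0 ?expr1n ?sqrtr1// => i /negbTE ij.
by rewrite big_ord1 mxE ij expr0n.
Qed.

Lemma norm_frobD_sqr A B :
  norm_frob (A + B) ^+ 2 <= 2 * norm_frob A ^+ 2 + 2 * norm_frob B ^+ 2.
Proof.
rewrite !norm_frob_sqr !mulr_sumr -big_split/=; apply: ler_sum => i _.
rewrite !mulr_sumr -big_split/=; apply: ler_sum => j _; rewrite mxE.
have := sqr_ge0 (A i j - B i j); lra.
Qed.

(** The vector of spins has Euclidean norm [sqrt n], and passing from the
    Euclidean norm to the sum costs another [sqrt n]. *)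
Lemma sum_local_field_le A x : \sum_i `|local_field A x i| <= n%:R * norm_spec A.
Proof.
rewrite -(@ler_pXn2r _ 2)// ?nnegrE ?sumr_ge0 ?mulr_ge0 ?norm_spec_ge0//.
apply: le_trans (sqr_sum_le _) _; rewrite card_ord exprMn expr2 -mulrA.
apply: ler_wpM2l => //.
under eq_bigr do rewrite real_normK ?num_real// -local_fieldE.
have s1 : norm_frob (spins R x) ^+ 2 = n%:R.
  rewrite norm_frob_col; under eq_bigr do rewrite spinE expr2 spin_sqr.
  by rewrite sumr_const card_ord.
rewrite -norm_frob_col -s1 mulrC -exprMn.
by rewrite lerXn2r ?nnegrE ?norm_specP ?mulr_ge0 ?norm_frob_ge0 ?norm_spec_ge0.
Qed.

End SpectralNorm.

(** * The objective *)

Section Objective.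
Variable R : realType.

Definition objective n l (x : sample n l) (A : 'M[R]_n) : R :=
  \sum_k pseudo_loss A (x k).

Lemma objective_ge0 n l (x : sample n l) A : 0 <= objective x A.
Proof.
by apply: sumr_ge0 => k _; apply: sumr_ge0 => i _; exact: logistic_ge0.
Qed.

Lemma dist_pseudo_loss_le n (A B : 'M[R]_n) x :
  `|pseudo_loss A x - pseudo_loss B x| <= 2 * \sum_i `|local_field (A - B) x i|.
Proof.
rewrite -sumrB mulr_sumr; apply: le_trans (ler_norm_sum _ _ _) _.
apply: ler_sum => i _; apply: le_trans (logistic_lipschitz _ _) _.
by rewrite -mulrBr normrM norm_spin mul1r -local_fieldB.
Qed.

Lemma dist_objective_spec_le n l (x : sample n l) (A B : 'M[R]_n) :
  `|objective x A - objective x B| <= 2 * (n%:R * l%:R) * norm_spec (A - B).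
Proof.
rewrite -sumrB; apply: le_trans (ler_norm_sum _ _ _) _.
apply: (@le_trans _ _ (\sum_(k < l) 2 * (n%:R * norm_spec (A - B)))).
  apply: ler_sum => k _; apply: le_trans (dist_pseudo_loss_le _ _ _) _.
  by rewrite ler_wpM2l// sum_local_field_le.
rewrite sumr_const card_ord -[_ *+ l]mulr_natr le_eqVlt; apply/orP; left.
by apply/eqP; ring.
Qed.

Lemma dist_objective_le n l (x : sample n l) (A B : 'M[R]_n) (e : R) :
  (forall i j, `|A i j - B i j| <= e) ->
  `|objective x A - objective x B| <= 2 * (l%:R * (n%:R * (n%:R * e))).
Proof.
move=> ABe; rewrite -sumrB; apply: le_trans (ler_norm_sum _ _ _) _.
apply: (@le_trans _ _ (\sum_(k < l) 2 * (n%:R * (n%:R * e)))); last first.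
  by rewrite sumr_const card_ord -[_ *+ l]mulr_natl mulrCA.
apply: ler_sum => k _; apply: le_trans (dist_pseudo_loss_le _ _ _) _.
apply: ler_wpM2l => //.
apply: (@le_trans _ _ (\sum_(i < n) n%:R * e)); last first.
  by rewrite sumr_const card_ord -[_ *+ n]mulr_natl.
apply: ler_sum => i _; apply: norm_local_field_le.
apply: (@le_trans _ _ (\sum_(j < n) e)); last first.
  by rewrite sumr_const card_ord -[_ *+ n]mulr_natl.
by apply: ler_sum => j _; rewrite !mxE.
Qed.

Lemma pseudo_loss_tangent n (A B : 'M[R]_n) x :
  pseudo_loss A x - \sum_i resid A x i * local_field (B - A) x i <= pseudo_loss B x.
Proof.
rewrite -sumrB; apply: ler_sum => i _.
have := logistic_tangent (spin R x i * local_field A x i) (spin R x i * local_field B x i).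
apply: le_trans; rewrite lerD2l -mulrBr -local_fieldB tanh_spin.
have -> : (spin R x i * tanh (local_field A x i) - 1) * (spin R x i * local_field (B - A) x i)
  = (spin R x i * spin R x i * tanh (local_field A x i) - spin R x i)
     * local_field (B - A) x i by ring.
rewrite spin_sqr /resid; lra.
Qed.

Lemma local_field_conv n (A B : 'M[R]_n) x i (a b : R) :
  local_field (a *: A + b *: B) x i = a * local_field A x i + b * local_field B x i.
Proof.
rewrite /local_field !mulr_sumr -big_split/=; apply: eq_bigr => j _.
by rewrite !mxE; ring.
Qed.

(** The tangent inequality at the convex combination, whose linear terms cancel
    because local fields are linear in the matrix. *)
Lemma objective_convex_comb n l (x : sample n l) (A B : 'M[R]_n) (t : R) :
  0 <= t <= 1 ->
  objective x (t *: A + (1 - t) *: B) <= t * objective x A + (1 - t) * objective x B.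
Proof.
move=> /andP[t0 t1]; rewrite !mulr_sumr -big_split/=; apply: ler_sum => k _.
set C := t *: A + (1 - t) *: B; set z := x k.
have hA := pseudo_loss_tangent C A z; have hB := pseudo_loss_tangent C B z.
have e : t * (\sum_i resid C z i * local_field (A - C) z i)
   + (1 - t) * (\sum_i resid C z i * local_field (B - C) z i) = 0.
  rewrite !mulr_sumr -big_split/= big1// => i _.
  by rewrite !local_fieldB /C local_field_conv; ring.
nra.
Qed.

Lemma objective_convex n l (x : sample n l) :
  convex_function (setT : set 'M[R]_n) (objective x).
Proof.
move=> t A B _ _; rewrite convRE.
apply: objective_convex_comb; apply/andP; split; first exact: ge0.
exact: le1.
Qed.

End Objective.

(** * Finite covers and existence of minimizers *)

Section Compactness.
Variables (R : realType) (n : nat) (J : set 'M[R]_n) (M : R).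
Hypotheses (J_le : forall A, J A -> norm_inf A <= M).

Let entry_le A i j : J A -> `|A i j| <= M.
Proof.
move=> /J_le; apply: le_trans; apply: le_trans (row_sum_le_norm_inf A i).
exact: (@le_sum_term _ _ (fun j => `|A i j|)).
Qed.

Lemma finite_cover (e : R) : 0 < e ->
  exists2 N, eps_cover (@norm_spec R n) e J N & finite_set N.
Proof.
move=> e0.
(* Entries are rounded to a grid of mesh [eta], and each grid cell that meets
   [J] is represented by one of its points in [J]. An entrywise error [eta] is
   an error [n * eta] in Frobenius norm; [n.+1] keeps [eta] defined at [n = 0]. *)
have [eta eta0 etaE] : exists2 eta, 0 < eta & e = eta * n.+1%:R.
  by exists (e / n.+1%:R); rewrite ?divr_gt0// divfK.
pose K := Num.trunc ((M + M) / eta).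
pose code (A : 'M[R]_n) : {ffun 'I_n * 'I_n -> 'I_K.+1} :=
  [ffun p => inord (Num.trunc ((A p.1 p.2 + M) / eta))].
pose rep c := xget 0 [set A | J A /\ code A = c].
have repP A : J A -> J (rep (code A)) /\ code (rep (code A)) = code A.
  by move=> JA; exact: (@xgetPex _ 0 [set B | J B /\ code B = code A]
    (ex_intro _ A (conj JA erefl))).
exists (rep @` [set c | exists2 A, J A & code A = c]); last first.
  exact/finite_image/finite_finset.
split=> [_ [_ [A JA <-] <-]|A JA]; first by case: (repP A JA).
exists (rep (code A)); first by exists (code A) => //; exists A.
have [JB codeE] := repP A JA; set B := rep _ in JB codeE *.
have close i j : `|B i j - A i j| <= eta.
  move/ffunP/(_ (i, j)): codeE; rewrite !ffunE/= => /(congr1 val)/=.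
  have pos C : J C -> 0 <= (C i j + M) / eta <= (M + M) / eta.
    move=> /(@entry_le _ i j) /ler_normlP[? ?].
    apply/andP; split; first by apply: divr_ge0; [lra|exact: ltW].
    by rewrite ler_pM2r ?invr_gt0//; lra.
  have /andP[B0 BM] := pos B JB; have /andP[A0 AM] := pos A JA.
  rewrite !inordK ?ltnS ?le_truncn// => E.
  have /andP[hB1 hB2] := truncn_itv B0; have /andP[hA1 hA2] := truncn_itv A0.
  rewrite E in hB1 hB2; move: hA1 hA2 hB1 hB2; move: (Num.trunc _) => m.
  rewrite !(ler_pdivlMr, ltr_pdivrMr)// -natr1 mulrDl mul1r => *.
  by rewrite ler_norml; apply/andP; split; lra.
apply: le_trans (norm_spec_le_frob _) _.
rewrite -(@ler_pXn2r _ 2)// ?nnegrE ?norm_frob_ge0 ?(ltW e0)// norm_frob_sqr.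
apply: (@le_trans _ _ (\sum_(i < n) \sum_(j < n) eta ^+ 2)).
  apply: ler_sum => i _; apply: ler_sum => j _; rewrite !mxE.
  by rewrite -real_normK ?num_real// lerXn2r ?nnegrE// ltW.
rewrite !sumr_const !card_ord -mulrnA -mulr_natr.
rewrite etaE exprMn ler_wpM2l ?sqr_ge0// -natrX ler_nat.
by rewrite -mulnn leq_mul.
Qed.

(** The objective is continuous and [J] is closed and bounded; matrices are
    flattened to row vectors, whose topology is the product one. *)
Lemma exists_minimizer l (x : sample n l) :
  J !=set0 -> closed J -> exists A, minimizer J (objective x) A.
Proof.
move=> [A0 JA0] clJ.
pose J' : set 'rV[R]_(n * n) := [set v | J (vec_mx v)].
have near_coord (v : 'rV[R]_(n * n)) (e : R) : 0 < e ->
    nbhs v [set w : 'rV[R]_(n * n) | forall k, `|v 0 k - w 0 k| < e].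
  move=> e0; apply: filterS (nbhsx_ballx v e e0) => w.
  by move=> [_ h] k /=; have := h 0 k; rewrite -ball_normE.
have cvec : continuous (@vec_mx R n n : 'rV[R]_(n * n) -> 'M[R]_n).
  move=> v; apply/(@cvg_ballP _ _ _ _ (nbhs_filter v)) => e e0; near=> w.
  split=> // i j; rewrite -ball_normE/= !mxE.
  by move: (mxvec_index i j); near: w; exact: near_coord.
have cobj : continuous (objective x \o vec_mx : 'rV[R]_(n * n) -> R).
  move=> v; apply/(@cvgrPdist_le _ _ _ _ (nbhs_filter v)) => e e0.
  pose c := 2 * (l%:R * (n%:R * n%:R)) + 1 : R.
  have c0 : 0 < c by rewrite ltr_wpDl// !mulr_ge0.
  have ec0 : 0 < e / c by rewrite divr_gt0.
  near=> w.
  apply: le_trans (dist_objective_le x (e := e / c) _) _.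
    move=> i j; rewrite !mxE; apply/ltW.
    by move: (mxvec_index i j); near: w; exact: near_coord.
  have -> : 2 * (l%:R * (n%:R * (n%:R * (e / c)))) = (c - 1) * (e / c).
    by rewrite /c; ring.
  rewrite mulrBl mul1r mulrCA divff ?gt_eqF// mulr1.
  by rewrite lerBlDr lerDl ltW.
have [] := @EVT_min_rV R (n * n) (objective x \o vec_mx) J'.
- by exists (mxvec A0); rewrite /J'/= mxvecK.
- apply: bounded_closed_compact; last by move/continuous_closedP: cvec; apply.
  exists M; split; first exact: num_real.
  move=> M' MM' v Jv; rewrite /= [leLHS]/Num.Def.normr/= mx_normrE; apply: bigmax_le => [|[i j] _].
    by apply: le_trans (ltW MM'); apply: le_trans (J_le JA0); exact: bigmax_ge_id.
  rewrite ord1/=; case/mxvec_indexP: j => p q.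
  have := entry_le p q Jv; rewrite mxE => h; exact: le_trans h (ltW MM').
- exact: continuous_subspaceT.
move=> v; rewrite inE => Jv vmin; exists (vec_mx v); split=> // B JB.
by have := vmin (mxvec B); rewrite inE /J'/= mxvecK; apply.
Unshelve. all: by end_near.
Qed.

End Compactness.

(** * From one sample to many *)

Section Sampling.
Variables (R : realType) (n : nat) (J : 'M[R]_n).

Let Z_gt0 : 0 < \sum_x ising_weight J x.
Proof.
rewrite (bigD1 [ffun=> true])//= ltr_pwDl ?ising_weight_gt0//.
by apply: sumr_ge0 => x _; exact/ltW/ising_weight_gt0.
Qed.

Lemma ising_ge0 x : 0 <= ising J x.
Proof. by rewrite divr_ge0 ?ltW// ising_weight_gt0. Qed.

Lemma sum_ising : \sum_x ising J x = 1.
Proof. by rewrite -mulr_suml divff// gt_eqF. Qed.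

Lemma expect_prod l (g : config n -> R) :
  \sum_(x : sample n l) (\prod_k ising J (x k)) * \prod_k g (x k)
    = (\sum_y ising J y * g y) ^+ l.
Proof.
have -> : (\sum_y ising J y * g y) ^+ l
    = \prod_(k < l) \sum_y ising J y * g y by rewrite prodr_const card_ord.
by rewrite bigA_distr_bigA; apply: eq_bigr => x _; rewrite -big_split.
Qed.

(** Markov's inequality for a function [b] that is at least 1 off the event. *)
Lemma sample_prob_ge l (E : sample n l -> Prop) (b : sample n l -> R) (delta : R) :
  (forall x, 0 <= b x) -> (forall x, ~ E x -> 1 <= b x) ->
  \sum_(x : sample n l) (\prod_k ising J (x k)) * b x <= delta ->
  1 - delta <= sample_prob J E.
Proof.
move=> b0 b1 hb; rewrite /sample_prob.
have P0 (x : sample n l) : 0 <= \prod_k ising J (x k).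
  by apply: prodr_ge0 => k _; exact: ising_ge0.
have tot : \sum_(x : sample n l) \prod_k ising J (x k) = 1.
  have := @expect_prod l (fun=> 1).
  under [in RHS]eq_bigr do rewrite mulr1.
  rewrite sum_ising expr1n => e; rewrite -[RHS]e; apply: eq_bigr => x _.
  by rewrite [X in _ * X]big1_eq mulr1.
rewrite lerBlDr -[leLHS]tot [leLHS](bigID (fun x => `[< E x >]))/=; apply: lerD; first exact: lexx.
apply: le_trans hb; rewrite [leRHS](bigID (fun x => `[< E x >]))/=.
rewrite -[leLHS]add0r lerD//.
  by apply: sumr_ge0 => x _; rewrite mulr_ge0.
by apply: ler_sum => x /asboolPn Ex; rewrite ler_peMr// b1.
Qed.

End Sampling.

(** * Accuracy of approximate minimizers *)

Section Accuracy.
Variable R : realType.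

(** Chosen so that [rate_factor_sqr] holds: [52 * 41 ^+ 4 * 4 ^+ 18] is the
    numerical part of [(curvature M)^-1], whose remaining factor is
    [expR (72 * M)]. *)
Definition rate_const : R :=
  Num.sqrt (2 * (1 + 4 / ln (ln 3)) * (52 * 41 ^+ 4 * 4 ^+ 18)).

Definition rate_factor (M : R) : R := rate_const * expR (36 * M).

Lemma curvature_gt0 (M : R) : 0 < curvature M.
Proof.
have w0 : 0 < (influence_bound M)^-1 by rewrite invr_gt0 mulr_gt0 ?expR_gt0.
by rewrite divr_gt0// mulr_gt0 ?exprn_gt0// divr_gt0 ?exprn_gt0.
Qed.

Lemma rate_factor_sqr (M : R) :
  rate_factor M ^+ 2 = 2 * (1 + 4 / ln (ln 3)) / curvature M.
Proof.
have k0 := ln_ln3_gt0 R.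
rewrite exprMn sqr_sqrtr; last by rewrite !mulr_ge0 ?addr_ge0 ?divr_ge0 ?exprn_ge0// ltW.
rewrite -expRM_natl /curvature /tilt /influence_bound.
have -> : 2%:R * (36 * M) = 18%:R * (4 * M) by ring.
rewrite expRM_natl.
have : expR (4 * M) != 0 by rewrite gt_eqF ?expR_gt0.
have : ln (ln 3) != 0 :> R by rewrite gt_eqF.
move: (expR _) (ln _) => E k kn0 En0.
rewrite -!exprVn invfM; field.
by do ?(apply/andP; split).
Qed.

Lemma tilt_le1 (M : R) : 0 < M -> tilt M <= 1.
Proof.
move=> M0; rewrite /tilt ler_pdivrMr ?exprn_gt0// mul1r.
apply: (@le_trans _ _ 1); last by rewrite exprn_ege1// ler1n.
have mu1 : 1 <= influence_bound M.
  by rewrite /influence_bound; have := expR_ge1Dx (4 * M); lra.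
rewrite exprn_ile1// ?invr_ge0 ?invf_le1//; first exact: le_trans mu1.
exact: lt_le_trans mu1.
Qed.

Lemma curvature_le1 (M : R) : 0 < M -> curvature M <= 1.
Proof.
move=> M0; have mu1 : 1 <= influence_bound M.
  by rewrite /influence_bound; have := expR_ge1Dx (4 * M); lra.
have mu0 : 0 < influence_bound M by exact: lt_le_trans mu1.
have h : (influence_bound M)^-1 ^+ 5 <= 1 by rewrite exprn_ile1// ?invr_ge0 ?invf_le1// ltW.
have h0 : 0 <= (influence_bound M)^-1 ^+ 5 by rewrite exprn_ge0// invr_ge0 ltW.
have := tilt_le1 M0; have : 0 <= tilt M by rewrite divr_ge0 ?exprn_ge0// invr_ge0 ltW.
rewrite /curvature; nra.
Qed.

(** The error is at most the distance to the point [B] of the cover plus the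
    error of [B]. The first is at most [1 / sqrt l]. As for the second, the
    objective at [B] exceeds that at [Jstar] by at most 3: 2 for the passage to
    the cover and 1 for the approximate minimization. *)
Lemma accuracy_on_good_event (M : R) n l (J : set 'M[R]_n) (delta : R)
    (x : sample n l) (Jstar Jh B : 'M[R]_n) (k : nat) :
  0 < M -> (3 <= n)%N -> (1 <= l)%N -> 0 < delta -> delta < 1 -> (0 < k)%N ->
  k = covering_number (@norm_spec R n) J (n%:R * l%:R)^-1 ->
  J Jstar -> approx_minimizer J (objective x) 1 Jh ->
  norm_spec (B - Jh) <= (n%:R * l%:R)^-1 ->
  tilt M * (objective x Jstar - objective x B)
     + curvature M * l%:R * norm_frob (B - Jstar) ^+ 2 <= ln k%:R + ln delta^-1 ->
  norm_frob (Jh - Jstar) <= rate_factor M * rate l J delta.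
Proof.
move=> M0 n3 l1 d0 d1 k0 kE Jst [JJh Jhmin] BJh good.
have l0 : 0 < l%:R :> R by rewrite ltr0n.
have n0 : 0 < n%:R :> R by rewrite ltr0n (leq_trans _ n3).
have g0 := curvature_gt0 M; have g1 := curvature_le1 M0.
have s1 := tilt_le1 M0.
have s0 : 0 <= tilt M.
  by rewrite divr_ge0 ?exprn_ge0// invr_ge0 mulr_ge0 ?expR_ge0.
have objB : objective x B - objective x Jstar <= 3.
  have := Jhmin _ Jst.
  have : objective x B - objective x Jh <= 2.
    apply: le_trans (ler_norm _) _; apply: le_trans (dist_objective_spec_le _ _ _) _.
    apply: (@le_trans _ _ (2 * (n%:R * l%:R) * (n%:R * l%:R)^-1)).
      by rewrite ler_wpM2l// !mulr_ge0.
    by rewrite -mulrA divff ?mulr1// mulf_neq0 ?gt_eqF.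
  lra.
pose K0 := ln k%:R + ln delta^-1 : R.
have K00 : 0 <= K0.
  rewrite addr_ge0// ln_ge0// ?ler1n// invf_ge1// ltW//.
pose kap := ln (ln 3) : R; have kap0 : 0 < kap := ln_ln3_gt0 R.
have kapn : kap <= ln (ln n%:R).
  have h3 : 1 < ln 3 :> R by rewrite -ltr_expR lnK ?posrE// expR1_lt3.
  have hn : ln 3 <= ln n%:R :> R by rewrite ler_ln ?posrE// ler_nat.
  by rewrite ler_ln ?posrE//; [exact: lt_trans h3|exact: lt_le_trans (lt_trans ltr01 h3) hn].
have F2 : curvature M * l%:R * norm_frob (B - Jstar) ^+ 2 <= K0 + 3.
  rewrite -/K0 in good; have : tilt M * (objective x B - objective x Jstar) <= 1 * 3.
    have [h|h] := leP 0 (objective x B - objective x Jstar); first exact: ler_pM.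
    by apply: (@le_trans _ _ 0) => //; rewrite mulr_ge0_le0// ltW.
  lra.
have frob2 : l%:R * norm_frob (Jh - B) ^+ 2 <= 1.
  apply: (@le_trans _ _ (l%:R * (n%:R * (n%:R * l%:R)^-1 ^+ 2))).
    apply: ler_wpM2l => //; apply: le_trans (norm_frob_le_spec _) _.
    apply: ler_wpM2l => //; rewrite lerXn2r ?nnegrE ?norm_spec_ge0 ?invr_ge0 ?mulr_ge0//.
    apply: le_trans BJh; rewrite -opprB.
    have -> : norm_spec (- (B - Jh)) = norm_spec (B - Jh); last by [].
    congr sup; apply/seteqP; split=> [_ [v v1 <-]|_ [v v1 <-]]; exists (- v).
    - by rewrite /= -scaleN1r norm_frobZ normrN1 mul1r.
    - by rewrite mulmxN mulNmx.
    - by rewrite /= -scaleN1r norm_frobZ normrN1 mul1r.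
    - by rewrite mulmxN mulNmx opprK.
  have -> : l%:R * (n%:R * (n%:R * l%:R)^-1 ^+ 2) = (n%:R * l%:R)^-1 :> R.
    by field; rewrite !gt_eqF.
  by rewrite invf_le1 ?mulr_gt0// -natrM ler1n muln_gt0 l1 (leq_trans _ n3).
pose K := K0 + ln (ln n%:R).
have Kk : kap <= K by rewrite /K; lra.
have final : l%:R * norm_frob (Jh - Jstar) ^+ 2 <= rate_factor M ^+ 2 * K.
  have -> : Jh - Jstar = (Jh - B) + (B - Jstar) by rewrite addrA subrK.
  apply: (@le_trans _ _ (l%:R * (2 * norm_frob (Jh - B) ^+ 2 + 2 * norm_frob (B - Jstar) ^+ 2))).
    by apply: ler_wpM2l => //; exact: norm_frobD_sqr.
  rewrite rate_factor_sqr -/kap.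
  have h1 : l%:R * norm_frob (B - Jstar) ^+ 2 <= (K0 + 3) / curvature M.
    by rewrite ler_pdivlMr// mulrC mulrA.
  have h2 : 1 <= 1 / curvature M by rewrite ler_pdivlMr// mul1r.
  have h3 : K0 + 4 <= (1 + 4 / kap) * K.
    have : 4 <= 4 / kap * K by rewrite mulrAC ler_pdivlMr// ler_wpM2l.
    by rewrite /K in Kk *; lra.
  have h4 : (K0 + 4) / curvature M <= (1 + 4 / kap) * K / curvature M.
    by rewrite ler_wpM2r// invr_ge0 ltW.
  have -> : 2 * (1 + 4 / kap) / curvature M * K = 2 * ((1 + 4 / kap) * K / curvature M) by ring.
  have : (K0 + 3) / curvature M + 1 / curvature M = (K0 + 4) / curvature M by ring.
  lra.
have rE : rate l J delta ^+ 2 = K / l%:R.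
  rewrite /rate -kE -/K0 -/K sqr_sqrtr// divr_ge0//.
  by apply: le_trans Kk; exact: ltW.
rewrite -(@ler_pXn2r _ 2)// ?nnegrE ?norm_frob_ge0//; last first.
  by rewrite !mulr_ge0 ?sqrtr_ge0 ?expR_ge0.
by rewrite exprMn rE mulrA ler_pdivlMr// mulrC.
Qed.

(** By [exp_pseudo_loss_le] and independence, [\prod_j gap i (x j)] has
    expectation at most 1 for every point [u i] of the cover. Averaging over the
    [k] points and multiplying by [delta] gives a function of expectation at
    most [delta] that is at least 1 as soon as one product exceeds
    [k / delta]. *)
Theorem approx_minimizer_accurate (M : R) n l (delta : R) (J : set 'M[R]_n)
    (Jhat : sample n l -> 'M[R]_n) :
  0 < M -> (3 <= n)%N -> (1 <= l)%N -> 0 < delta -> delta < 1 ->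
  (forall A, J A -> interaction_matrix A /\ norm_inf A <= M) ->
  (forall x, approx_minimizer J (objective x) 1 (Jhat x)) ->
  accurate_estimator J delta (rate_factor M) Jhat.
Proof.
move=> M0 n3 l1 d0 d1 JM Jhat_min Jstar Jst.
have l0 : 0 < l%:R :> R by rewrite ltr0n.
have n0 : 0 < n%:R :> R by rewrite ltr0n (leq_trans _ n3).
pose e : R := (n%:R * l%:R)^-1.
have e0 : 0 < e by rewrite invr_gt0 mulr_gt0.
have fin := @finite_cover R n J M (fun A JA => (JM A JA).2) e e0.
have [[N [NJ Ncov] /card_esym/card_set_bijP[u [uN uinj usurj]]] _] := covering_numberP fin.
set k := covering_number _ _ _ in uN uinj usurj.
have [B0 NB0 _] := Ncov _ Jst; have [i0 ik0 _] := usurj _ NB0.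
have k0 : (0 < k)%N by apply: leq_ltn_trans ik0.
pose gap (i : 'I_k) (y : config n) : R :=
  expR (tilt M * (pseudo_loss Jstar y - pseudo_loss (u i) y)) *
  expR (curvature M * norm_frob (u i - Jstar) ^+ 2).
have gap_ge0 i y : 0 <= gap i y by apply: mulr_ge0; exact: expR_ge0.
have kR0 : 0 < k%:R :> R by rewrite ltr0n.
apply: (@sample_prob_ge _ _ _ _ _ (fun x => \sum_(i < k) delta / k%:R * \prod_j gap i (x j))).
- move=> x; apply: sumr_ge0 => i _; rewrite mulr_ge0 ?divr_ge0 ?(ltW d0)//.
  by apply: prodr_ge0 => j _; exact: gap_ge0.
- move=> x bad.
  have [B NB BJ] := Ncov _ (Jhat_min x).1.
  have [i ik iB] := usurj _ NB.
  have prod0 (i' : 'I_k) : 0 <= delta / k%:R * \prod_j gap i' (x j).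
    rewrite mulr_ge0 ?divr_ge0 ?(ltW d0)//.
    by apply: prodr_ge0 => j _; exact: gap_ge0.
  apply: le_trans (le_sum_term (Ordinal ik) prod0).
  rewrite leNgt; apply/negP => small; apply: bad.
  apply: (accuracy_on_good_event M0 n3 l1 d0 d1 k0 erefl Jst (Jhat_min x) BJ).
  rewrite -iB; rewrite -lnM ?posrE ?invr_gt0// -ler_expR lnK ?posrE ?mulr_gt0 ?invr_gt0//.
  have -> : expR (tilt M * (objective x Jstar - objective x (u i))
      + curvature M * l%:R * norm_frob (u i - Jstar) ^+ 2)
    = \prod_j gap (Ordinal ik) (x j).
    rewrite big_split/= -!expR_sum -expRD; congr expR; congr (_ + _).
      by rewrite -mulr_sumr sumrB.
    by rewrite sumr_const card_ord -[RHS]mulr_natl; ring.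
  move: small; rewrite mulrAC ltr_pdivrMr// mul1r => /ltW small.
  by rewrite ler_pdivlMr// mulrC.
- under eq_bigr do rewrite mulr_sumr.
  rewrite exchange_big/=.
  have dE : delta = \sum_(i < k) delta / k%:R.
    by rewrite sumr_const card_ord -[RHS]mulr_natr divfK// gt_eqF.
  rewrite [leRHS]dE.
  apply: ler_sum => i _.
  under eq_bigr do rewrite mulrCA.
  rewrite -mulr_sumr ler_piMr ?divr_ge0 ?(ltW d0)// expect_prod exprn_ile1//.
    apply: sumr_ge0 => y _; apply: mulr_ge0; first exact: ising_ge0.
    exact: gap_ge0.
  under eq_bigr do rewrite mulrA.
  rewrite -mulr_suml.
  have [Jint JsM] := JM _ Jst; have [Bint BM] := JM _ (NJ _ (uN _ (ltn_ord i))).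
  apply: le_trans (ler_wpM2r (expR_ge0 _) (exp_pseudo_loss_le Jint JsM Bint BM M0)) _.
  by rewrite -expRD addNr expR0.
Qed.

End Accuracy.

(** * Counting-loop programs: semantics and cost *)

Local Notation mem := Defs.mem.

Inductive prog :=
| PAct of cmd
| PSeq of prog & prog
| PFor of nat & nat & prog.

Fixpoint compile (p : prog) : cmd :=
  match p with
  | PAct c => c
  | PSeq p q => Seq (compile p) (compile q)
  | PFor r b p =>
      Seq (RegZero r) (While (NatLt r b) (Seq (compile p) (RegSucc r)))
  end.

Definition is_atom (c : cmd) : bool :=
  match c with
  | Seq _ _ | If _ _ _ | While _ _ | Skip => false
  | _ => true
  end.

Fixpoint written_regs (p : prog) : seq nat :=
  match p with
  | PAct c =>
      match c with
      | RegZero i | RegSucc i | RegCopy i _ => [:: i]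
      | _ => [::]
      end
  | PSeq p q => written_regs p ++ written_regs q
  | PFor r _ p => r :: written_regs p
  end.

Fixpoint written_arrays (p : prog) : seq nat :=
  match p with
  | PAct c =>
      match c with
      | CellZero c | CellOne c | CellOp _ c _ _ => [:: c.1.1]
      | Project a _ => [:: a]
      | _ => [::]
      end
  | PSeq p q => written_arrays p ++ written_arrays q
  | PFor _ _ p => written_arrays p
  end.

(** Loop bounds are taken among the registers [fr], which the program never
    writes, and loop bodies leave the loop counter alone; a loop thus runs a
    number of times that is known when it starts. *)
Fixpoint well_formed (fr : seq nat) (p : prog) : bool :=
  match p with
  | PAct c => is_atom c && all (fun r => r \notin fr) (written_regs p)
  | PSeq p q => well_formed fr p && well_formed fr q
  | PFor r b p =>
      [&& b \in fr, r \notin fr, r \notin written_regs p & well_formed fr p]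
  end.

(** A program of size [c] and depth [d] runs in time at most [c * X ^ d], when [X]
    exceeds the loop bounds and the cost of an atomic command. The 4 pays for
    the test, the increment and the start of a loop. *)
Fixpoint psize (p : prog) : nat :=
  match p with
  | PAct _ => 1
  | PSeq p q => psize p + psize q
  | PFor _ _ p => (psize p + 4)%N
  end.

Fixpoint pdepth (p : prog) : nat :=
  match p with
  | PAct _ => 1
  | PSeq p q => maxn (pdepth p) (pdepth q)
  | PFor _ _ p => (pdepth p).+1
  end.

Section Denotation.
Variables (R : realType) (n : nat) (proj : 'M[R]_n -> 'M[R]_n) (tau : nat).
Implicit Types (s : state R) (p : prog).

Definition step (c : cmd) s : state R :=
  match c with
  | RegZero i => set_reg s i 0
  | RegSucc i => set_reg s i (reg s i).+1
  | RegCopy i j => set_reg s i (reg s j)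
  | CellZero c => write s c 0
  | CellOne c => write s c 1
  | CellOp o c d e => write s c (eval_op o (read s d) (read s e))
  | Project a b => set_mx s a (proj (get_mx n s b))
  (* Compound commands are ruled out by [is_atom]. *)
  | _ => s
  end.

Fixpoint den p s : state R :=
  match p with
  | PAct c => step c s
  | PSeq p q => den q (den p s)
  | PFor r b p =>
      iter (reg s b) (fun s' => step (RegSucc r) (den p s')) (set_reg s r 0)
  end.

Lemma reg_write s c v : reg (write s c v) = reg s.
Proof. by case: c => [[a i] j]. Qed.

Lemma mem_writeE s a i j v a' x y : mem (write s (a, i, j) v) a' x y =
  if [&& a' == a, x == reg s i & y == reg s j] then v else mem s a' x y.
Proof. by []. Qed.

Lemma mem_write_neq s a i j v a' : a' != a -> mem (write s (a, i, j) v) a' = mem s a'.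
Proof.
by move=> /negbTE ne; apply/funext => x; apply/funext => y; rewrite mem_writeE ne.
Qed.

Lemma reg_den p s r : r \notin written_regs p -> reg (den p s) r = reg s r.
Proof.
elim: p s => [c|p IHp q IHq|q b p IHp] s /=.
- by case: c => //= [i|i|i j|c|c|o c d e]; rewrite ?reg_write// inE => /negbTE ->.
- by rewrite mem_cat negb_or => /andP[rp rq]; rewrite IHq ?IHp.
- rewrite inE negb_or => /andP[/negbTE rq rp].
  elim: (reg s b) => [|k IHk] /=; first by rewrite rq.
  by rewrite rq IHp.
Qed.

Lemma mem_den p s a : a \notin written_arrays p -> mem (den p s) a = mem s a.
Proof.
elim: p s => [c|p IHp q IHq|q b p IHp] s /=.
- case: c => //= [c|c|o c d e|a' b]; rewrite ?inE.
  + by case: c => [[a' i] j] /= ne; exact: mem_write_neq.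
  + by case: c => [[a' i] j] /= ne; exact: mem_write_neq.
  + by case: c => [[a' i] j] /= ne; exact: mem_write_neq.
  + by move=> /negbTE ->.
- by rewrite mem_cat negb_or => /andP[ap aq]; rewrite IHq ?IHp.
- by move=> ap; elim: (reg s b) => [|k IHk] //=; rewrite IHp.
Qed.

Lemma well_formed_written fr p r : well_formed fr p -> r \in fr ->
  r \notin written_regs p.
Proof.
elim: p => [c|p IHp q IHq|q b p IHp] /=.
- move=> /andP[_ /allP h] rf; apply/negP => /h; by rewrite rf.
- move=> /andP[/IHp hp /IHq hq] rf.
  by rewrite mem_cat negb_or hp ?hq.
- move=> /and4P[_ qf _ /IHp hp] rf; rewrite inE negb_or hp// andbT.
  by apply: contraNneq qf => <-.
Qed.

Lemma reg_den_frozen fr p s r : well_formed fr p -> r \in fr ->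
  reg (den p s) r = reg s r.
Proof. by move=> wf rf; rewrite reg_den// (well_formed_written wf). Qed.

Lemma exec_den fr p s B : well_formed fr p ->
  (forall r, r \in fr -> reg s r <= B)%N ->
  exists2 t, exec proj tau (compile p) s t (den p s) &
    (t <= psize p * (B + tau + 2) ^ pdepth p)%N.
Proof.
set X := (B + tau + 2)%N; have X1 : (1 <= X)%N by rewrite /X addn2.
elim: p s => [c|p IHp q IHq|q b p IHp] s /=.
- rewrite mul1n expn1 => /andP[at_c _] _.
  case: c at_c => //= [i|i|i j|c|c|o c d e|a b] _;
    try by exists 1%N => //; constructor.
  exists tau.+1; first by constructor.
  rewrite /X; lia.
- move=> /andP[wp wq] hB; have [t ep tp] := IHp s wp hB.
  have [r rf|t' eq tq] := IHq (den p s) wq.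
    by rewrite (reg_den_frozen _ wp)// hB.
  exists (t + t')%N; first exact: ExecSeq ep eq.
  rewrite mulnDl leq_add//.
    by apply: leq_trans tp _; rewrite leq_mul2l leq_pexp2l ?leq_maxl ?orbT.
  by apply: leq_trans tq _; rewrite leq_mul2l leq_pexp2l ?leq_maxr ?orbT.
move=> /and4P[bf qf qp wp] hB.
set F := fun k => iter k (fun s' => step (RegSucc q) (den p s')) (set_reg s q 0).
have qb : b != q by apply: contraNneq qf => <-.
have Freg k r : r \in fr -> reg (F k) r = reg s r.
  move=> rf; have /negbTE rq : r != q by apply: contraNneq qf => <-.
  elim: k => [|k IHk]; first by rewrite /F /= rq.
  by rewrite /F iterS /= rq (reg_den_frozen _ wp).
have Fq k : reg (F k) q = k.
  elim: k => [|k IHk]; first by rewrite /F /= eqxx.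
  by rewrite /F iterS /= eqxx reg_den// IHk.
pose body := (psize p * X ^ pdepth p + 2)%N.
suff loop k : (k <= reg s b)%N -> exists2 t,
    exec proj tau (While (NatLt q b) (Seq (compile p) (RegSucc q)))
      (F (reg s b - k)%N) t (F (reg s b)) & (t <= k * body + 1)%N.
  have [t et ht] := loop (reg s b) (leqnn _).
  exists (1 + t)%N.
    apply: ExecSeq; first by constructor.
    by move: et; rewrite subnn.
  have sB : (reg s b <= X)%N by apply: leq_trans (hB _ bf) _; rewrite /X -addnA leq_addr.
  have Xk : (1 <= X ^ pdepth p)%N by rewrite expn_gt0 X1.
  apply: (@leq_trans (1 + (X * body + 1))%N).
    by rewrite leq_add2l; apply: leq_trans ht _; rewrite leq_add2r leq_mul2r sB orbT.
  have -> : (X * body = psize p * (X * X ^ pdepth p) + X * 2)%N.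
    by rewrite /body mulnDr mulnCA.
  have XX : (X <= X * X ^ pdepth p)%N by rewrite leq_pmulr.
  by rewrite mulnDl expnS; move: XX X1; move: (X * X ^ pdepth p)%N => Y; lia.
elim: k => [|k IHk] kb.
  exists 1%N => //; rewrite subn0; apply: ExecWhileFalse.
  by rewrite /= (Freg _ _ bf) Fq ltnn.
have [t et ht] := IHk (ltnW kb).
set m := (reg s b - k.+1)%N.
have mS : (reg s b - k = m.+1)%N by rewrite /m; lia.
have mb : (m < reg s b)%N by rewrite /m; lia.
have [r rf|t' et' ht'] := IHp (F m) wp; first by rewrite Freg// hB.
exists (t' + 1 + t).+1.
  apply: (@ExecWhileTrue _ _ _ _ _ _ _ (F m.+1)).
  - by rewrite /= (Freg _ _ bf) Fq.
  - by apply: ExecSeq; [exact: et'|rewrite /F iterS; constructor].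
  - by rewrite -mS.
by rewrite /body mulSn; move: ht ht'; rewrite /body; lia.
Qed.

(** The loop rule. The invariant speaks of the memory only; in each turn, the
    registers and arrays that the body does not write come for free. *)
Lemma for_mem fr (I : nat -> (nat -> nat -> nat -> R) -> Prop) r b p s :
  well_formed fr (PFor r b p) ->
  I 0%N (mem s) ->
  (forall k s', (k < reg s b)%N -> reg s' r = k ->
     (forall r', r' \notin r :: written_regs p -> reg s' r' = reg s r') ->
     (forall a, a \notin written_arrays p -> mem s' a = mem s a) ->
     I k (mem s') -> I k.+1 (mem (den p s'))) ->
  I (reg s b) (mem (den (PFor r b p) s)).
Proof.
move=> /= /and4P[bf rf rp wp] I0 IS.
set F := fun k => iter k (fun s' => step (RegSucc r) (den p s')) (set_reg s r 0).
suff : forall k, (k <= reg s b)%N -> [/\ reg (F k) r = k,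
    (forall r', r' \notin r :: written_regs p -> reg (F k) r' = reg s r'),
    (forall a, a \notin written_arrays p -> mem (F k) a = mem s a) &
    I k (mem (F k))].
  by move=> /(_ _ (leqnn _))[].
elim=> [|k IHk] kb.
  split=> //=; first by rewrite eqxx.
  by move=> r'; rewrite inE negb_or => /andP[/negbTE -> _].
have [Fr Fregs Fmem Ik] := IHk (ltnW kb).
rewrite /F iterS -/(F k); split.
- by rewrite /= eqxx reg_den// Fr.
- move=> r' h; have := h; rewrite inE negb_or => /andP[/negbTE rr' r'p].
  by rewrite /= rr' reg_den// Fregs.
- by move=> a ap; rewrite /= mem_den// Fmem.
- exact: IS.
Qed.

End Denotation.

(** * The program *)

Section Implementation.

(** Registers 0 and 1 hold [n] and [l]. Register [rZ] stays 0 and [rOne] becomes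
    1, so that the entry (0, 0) of an array serves as a scalar variable. The
    current iterate is in [aJ], the point to be projected in [aY], the sum of the
    iterates in [aOut], and the samples in [aX]. *)
Local Notation rI := 2%N.
Local Notation rJ := 3%N.
Local Notation rK := 4%N.
Local Notation rZ := 5%N.
Local Notation rOne := 6%N.
Local Notation rN := 7%N.
Local Notation rT := 8%N.
Local Notation rQ := 9%N.
Local Notation aX := 1%N.
Local Notation aOut := 2%N.
Local Notation aJ := 3%N.
Local Notation aY := 4%N.
Local Notation cOne := (10, rZ, rZ)%N.
Local Notation cW := (11, rZ, rZ)%N.
Local Notation cTmp := (12, rZ, rZ)%N.
Local Notation cU := (13, rZ, rZ)%N.
Local Notation cE := (14, rZ, rZ)%N.
Local Notation cStep := (15, rZ, rZ)%N.
Local Notation cCnt := (16, rZ, rZ)%N.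
Local Notation cZero := (17, rZ, rZ)%N.

Local Notation "p ;; q" := (PSeq p q) (at level 90, right associativity).
Local Notation add c d e := (PAct (CellOp OpAdd c d e)).
Local Notation mul c d e := (PAct (CellOp OpMul c d e)).
Local Notation div c d e := (PAct (CellOp OpDiv c d e)).

Definition dot_prog : prog :=
  PAct (CellZero cU) ;;
  PFor rJ 0 (mul cTmp (aJ, rI, rJ) (aX, rK, rJ) ;; add cU cU cTmp).

(** With [u = x_i * (A x)_i], this leaves in [cE] the step size times
    [2 / ((1 + 2 * u / N) ^+ N + 1) * x_i], an approximation of the step size
    times [resid A x i]. *)
Definition weight_prog : prog :=
  mul cU cU (aX, rK, rI) ;; add cU cU cU ;; div cU cU cCnt ;; add cU cU cOne ;;
  PAct (CellOne cE) ;; PFor rQ rN (mul cE cE cU) ;;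
  add cE cE cOne ;; div cE cStep cE ;; mul cE cE (aX, rK, rI).

Definition row_prog : prog :=
  PFor rJ 0 (mul cTmp cE (aX, rK, rJ) ;; add (aY, rI, rJ) (aY, rI, rJ) cTmp).

Definition cell_prog : prog := dot_prog ;; weight_prog ;; row_prog.

Definition gradient_prog : prog := PFor rK 1 (PFor rI 0 cell_prog).

Definition copy_prog : prog :=
  PFor rI 0 (PFor rJ 0 (add (aY, rI, rJ) (aJ, rI, rJ) cZero ;;
                        add (aOut, rI, rJ) (aOut, rI, rJ) (aJ, rI, rJ))).

Definition round_prog : prog :=
  copy_prog ;; gradient_prog ;; PAct (Project aJ aY).

Definition descent_prog : prog := PFor rT rN round_prog.

Definition average_prog : prog :=
  PFor rI 0 (PFor rJ 0 (div (aOut, rI, rJ) (aOut, rI, rJ) cCnt)).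

Definition main_prog : prog := descent_prog ;; average_prog.

Definition frozen : seq nat := [:: 0; 1; rZ; rOne; rN]%N.

(** The content of a register reaches a cell only by counting. *)
Definition count_reg (b : nat) : prog := PFor rI b (add cW cW cOne).

(** With [w = n + l + M + eps^-1], this leaves [2 * w^-8] in [cStep] and [w^16] in
    [cW]. As [aY] is initially 0, the first iterate is the projection of 0. *)
Definition setup_prog : prog :=
  (PAct (RegSucc rOne) ;; PAct (CellOne cOne) ;; PAct (Project aJ aY)) ;;
  count_reg 0 ;; count_reg 1 ;;
  (add cW cW (0, rZ, rZ)%N ;; div cTmp cOne (0, rZ, rOne)%N ;; add cW cW cTmp ;;
   mul cW cW cW ;; mul cW cW cW ;; mul cW cW cW ;;
   div cStep cOne cW ;; add cStep cStep cStep ;; mul cW cW cW).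

(** The number of rounds is counted up to a real bound, which no register
    holds; hence a loop outside [prog]. *)
Definition ceil_cmd : cmd :=
  While (RealLt cCnt cW) (Seq (CellOp OpAdd cCnt cCnt cOne) (RegSucc rN)).

Definition erm_cmd : cmd :=
  Seq (compile setup_prog) (Seq ceil_cmd (compile main_prog)).

Section Semantics.
Variables (R : realType) (n : nat) (proj : 'M[R]_n -> 'M[R]_n).
Implicit Types s : state R.
Local Notation den := (den proj).

Lemma den_seq p q s : den (p ;; q) s = den q (den p s).
Proof. by []. Qed.

Lemma dot_progE s : reg s rZ = 0%N ->
  mem (den dot_prog s) 13 0 0 =
    \sum_(0 <= j < reg s 0) mem s aJ (reg s rI) j * mem s aX (reg s rK) j.
Proof.
move=> z0.
have [s1 [s1E reg1 M1 U1]] : exists s1, [/\ s1 = write s cU 0, reg s1 = reg s,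
    forall a, a != 13%N -> mem s1 a = mem s a & mem s1 13%N 0%N 0%N = 0].
  by exists (write s cU 0); split=> // [a ?|]; [exact: mem_write_neq|rewrite /= z0].
have -> : den dot_prog s = den (PFor rJ 0 (mul cTmp (aJ, rI, rJ) (aX, rK, rJ) ;;
  add cU cU cTmp)) s1 by rewrite s1E.
have := @for_mem R n proj frozen (fun k m => m 13%N 0%N 0%N =
    \sum_(0 <= j < k) mem s aJ (reg s rI) j * mem s aX (reg s rK) j) rJ 0
    (mul cTmp (aJ, rI, rJ) (aX, rK, rJ) ;; add cU cU cTmp) s1 isT.
rewrite reg1; apply; first by rewrite big_nil.
move=> k s' kn s'J s'reg s'mem Ik; rewrite big_nat_recr//= -Ik.
have s'z : reg s' rZ = 0%N by rewrite s'reg.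
by rewrite s'z /= s'J !s'reg// (s'mem aJ)// (s'mem aX)// (M1 aJ)// (M1 aX).
Qed.

Lemma weight_progE s : reg s rZ = 0%N ->
  mem (den weight_prog s) 14 0 0 =
    mem s 15 0 0 / ((((mem s 13 0 0 * mem s aX (reg s rK) (reg s rI))
       + (mem s 13 0 0 * mem s aX (reg s rK) (reg s rI))) / mem s 16 0 0
     + mem s 10 0 0) ^+ reg s rN + mem s 10 0 0) * mem s aX (reg s rK) (reg s rI).
Proof.
move=> z0; rewrite /weight_prog.
set v : R := _ / mem s 16 0 0 + mem s 10 0 0.
set init := mul cU cU (aX, rK, rI) ;; add cU cU cU ;; div cU cU cCnt ;;
  add cU cU cOne ;; PAct (CellOne cE).
have [s1 [s1E reg1 U1 E1 M1]] : exists s1, [/\ s1 = den init s, reg s1 = reg s,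
    mem s1 13%N 0%N 0%N = v, mem s1 14%N 0%N 0%N = 1 &
    forall a, a != 13%N -> a != 14%N -> mem s1 a = mem s a].
  exists (den init s); split=> // [||a a13 a14].
  - by rewrite /= z0.
  - by rewrite /= z0.
  - by rewrite mem_den//= !inE (negbTE a13) (negbTE a14).
have [s2 [s2E reg2 E2 M2]] : exists s2, [/\ s2 = den (PFor rQ rN (mul cE cE cU)) s1,
    forall r, r != rQ -> reg s2 r = reg s r, mem s2 14%N 0%N 0%N = v ^+ reg s rN &
    forall a, a != 13%N -> a != 14%N -> mem s2 a = mem s a].
  exists (den (PFor rQ rN (mul cE cE cU)) s1); split=> //.
  - by move=> r rq; rewrite reg_den ?reg1//= inE.
  - rewrite -reg1.
    apply: (@for_mem R n proj frozen (fun k m => m 14%N 0%N 0%N = v ^+ k)) => //.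
    move=> k s' kn s'q s'reg s'mem Ik.
    have s'z : reg s' rZ = 0%N by rewrite s'reg// reg1.
    by rewrite exprSr -Ik /= s'z /= (s'mem 13%N)// U1.
  - by move=> a a13 a14; rewrite mem_den ?M1//= inE.
have -> : den (mul cU cU (aX, rK, rI) ;; add cU cU cU ;; div cU cU cCnt ;;
    add cU cU cOne ;; PAct (CellOne cE) ;; PFor rQ rN (mul cE cE cU) ;;
    add cE cE cOne ;; div cE cStep cE ;; mul cE cE (aX, rK, rI)) s
  = den (add cE cE cOne ;; div cE cStep cE ;; mul cE cE (aX, rK, rI)) s2.
  by rewrite s2E s1E.
by rewrite /= !reg2//= z0 /= E2 !M2.
Qed.

Lemma row_progE s p q : reg s rZ = 0%N ->
  mem (den row_prog s) aY p q = mem s aY p q +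
    (if (p == reg s rI) && (q < reg s 0)%N then mem s 14 0 0 * mem s aX (reg s rK) q
     else 0).
Proof.
move=> z0.
have := @for_mem R n proj frozen (fun k m => m aY p q = mem s aY p q +
    (if (p == reg s rI) && (q < k)%N then mem s 14 0 0 * mem s aX (reg s rK) q
     else 0)) rJ 0 (mul cTmp cE (aX, rK, rJ) ;; add (aY, rI, rJ) (aY, rI, rJ) cTmp)
   s isT.
apply; first by rewrite andbF addr0.
move=> k s' kn s'J s'reg s'mem Ik /=.
have s'z : reg s' rZ = 0%N by rewrite s'reg.
rewrite s'z s'J !s'reg//= (s'mem 14%N)// (s'mem aX)//.
move: Ik; case: (eqVneq p (reg s rI)) => [->|_] /= Ik; last by rewrite Ik.
move: Ik; case: (eqVneq q k) => [->|qk] Ik.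
  by rewrite Ik ltnn ltnSn addr0.
by rewrite Ik ltnS [in RHS]leq_eqVlt (negbTE qk).
Qed.

Definition coef s k i : R :=
  let u := \sum_(0 <= j < reg s 0) mem s aJ i j * mem s aX k j in
  mem s 15 0 0 / (((u * mem s aX k i + u * mem s aX k i) / mem s 16 0 0
    + mem s 10 0 0) ^+ reg s rN + mem s 10 0 0) * mem s aX k i.

Lemma eq_coef s s' k i : reg s' 0 = reg s 0 -> reg s' rN = reg s rN ->
  (forall a, a \in [:: aX; aJ; 10; 15; 16]%N -> mem s' a = mem s a) ->
  coef s' k i = coef s k i.
Proof. by move=> r0 rn sm; rewrite /coef r0 rn !sm. Qed.

Lemma cell_progE s p q : reg s rZ = 0%N ->
  mem (den cell_prog s) aY p q = mem s aY p q +
    (if (p == reg s rI) && (q < reg s 0)%N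
     then coef s (reg s rK) (reg s rI) * mem s aX (reg s rK) q else 0).
Proof.
move=> z0; have [s1 [s1E U1 reg1 M1]] : exists s1, [/\ s1 = den dot_prog s,
    mem s1 13%N 0%N 0%N = \sum_(0 <= j < reg s 0) mem s aJ (reg s rI) j * mem s aX (reg s rK) j,
    forall r, r != rJ -> reg s1 r = reg s r &
    forall a, a != 12%N -> a != 13%N -> mem s1 a = mem s a].
  exists (den dot_prog s); split=> //; first exact: dot_progE.
    by move=> r rJr; rewrite reg_den//= inE.
  by move=> a a12 a13; rewrite mem_den//= !inE !negb_or a12 a13.
have z1 : reg s1 rZ = 0%N by rewrite reg1.
have [s2 [s2E E2 reg2 M2]] : exists s2, [/\ s2 = den weight_prog s1,
    mem s2 14%N 0%N 0%N = coef s (reg s rK) (reg s rI),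
    forall r, r != rJ -> r != rQ -> reg s2 r = reg s r &
    forall a, a != 12%N -> a != 13%N -> a != 14%N -> mem s2 a = mem s a].
  exists (den weight_prog s1); split=> //.
  - by rewrite weight_progE// U1 !reg1// /coef !M1.
  - by move=> r rJr rQr; rewrite reg_den ?reg1//= inE.
  - by move=> a a12 a13 a14; rewrite mem_den ?M1//= !inE !negb_or a13 a14.
rewrite /cell_prog 2!den_seq -s1E -s2E.
by rewrite row_progE ?reg2// E2 !M2.
Qed.

Lemma gradient_progE s p q : reg s rZ = 0%N ->
  mem (den gradient_prog s) aY p q = mem s aY p q +
    (if (p < reg s 0)%N && (q < reg s 0)%N
     then \sum_(0 <= k < reg s 1) coef s k p * mem s aX k q else 0).
Proof.
move=> z0; move: p q.
apply: (@for_mem R n proj frozen (fun k m => forall p q, m aY p q = mem s aY p q +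
    (if (p < reg s 0)%N && (q < reg s 0)%N
     then \sum_(0 <= k' < k) coef s k' p * mem s aX k' q else 0))
  rK 1 (PFor rI 0 cell_prog)) => //.
  by move=> p q; rewrite big_nil if_same addr0.
move=> k s' kl s'K s'reg s'mem Ik.
have IH : forall p q, mem (den (PFor rI 0 cell_prog) s') aY p q = mem s' aY p q +
    (if (p < reg s' 0)%N && (q < reg s 0)%N then coef s k p * mem s aX k q else 0).
  apply: (@for_mem R n proj frozen (fun i m => forall p q, m aY p q = mem s' aY p q +
    (if (p < i)%N && (q < reg s 0)%N then coef s k p * mem s aX k q else 0))) => //.
    by move=> p q; rewrite addr0.
  move=> i s2 il s2i s2reg s2mem Ii p q.
  have s2r r : r \notin [:: rK, rI & written_regs cell_prog] -> reg s2 r = reg s r.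
    move=> h; have := h; rewrite in_cons negb_or => /andP[_ h'].
    by rewrite s2reg// s'reg.
  have s2m a : a \notin written_arrays cell_prog -> mem s2 a = mem s a.
    by move=> h; rewrite s2mem// s'mem.
  have [s2z s20 s2N] : [/\ reg s2 rZ = 0%N, reg s2 0 = reg s 0 & reg s2 rN = reg s rN].
    by rewrite !s2r.
  have s2K : reg s2 rK = k by rewrite s2reg.
  rewrite cell_progE// s2i s2K s20 (@eq_coef s s2)//; last first.
    by move=> a; rewrite !inE => /or4P[|||/orP[]] /eqP ->; rewrite s2m.
  rewrite (s2m aX)// Ii -addrA; congr (_ + _).
  case: (eqVneq p i) => [->|pi] /=; first by rewrite ltnn ltnSn /= add0r.
  by rewrite addr0 ltnS [in RHS]leq_eqVlt (negbTE pi).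
move=> p q; rewrite IH Ik s'reg// -addrA; congr (_ + _).
case: ifP => _; last by rewrite addr0.
by rewrite big_nat_recr.
Qed.

(** A double loop over the entries of an array, for a body that at turn [(i, j)]
    writes no other entry than [(i, j)] and whose result only depends on data
    that earlier turns leave unchanged. *)
Lemma sweep_mem body s (val : nat -> nat -> nat -> R) :
  well_formed frozen body -> written_regs body = [::] ->
  (forall s' i j, reg s' rI = i -> reg s' rJ = j ->
     (forall r, r != rI -> r != rJ -> reg s' r = reg s r) ->
     (forall a, a \notin written_arrays body -> mem s' a = mem s a) ->
     (forall a, mem s' a i j = mem s a i j) ->
     forall a p q, a \in written_arrays body -> mem (den body s') a p q =
       if (p == i) && (q == j) then val a p q else mem s' a p q) ->
  forall a p q, a \in written_arrays body -> (p < reg s 0)%N -> (q < reg s 0)%N ->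
  mem (den (PFor rI 0 (PFor rJ 0 body)) s) a p q = val a p q.
Proof.
move=> wf nregs bodyE.
have wf2 : well_formed frozen (PFor rJ 0 body) by rewrite /= nregs wf.
have wf1 : well_formed frozen (PFor rI 0 (PFor rJ 0 body)) by rewrite /= nregs wf.
have : forall a p q, a \in written_arrays body -> (q < reg s 0)%N ->
    mem (den (PFor rI 0 (PFor rJ 0 body)) s) a p q =
      if (p < reg s 0)%N then val a p q else mem s a p q.
  apply: (@for_mem R n proj frozen (fun i m => forall a p q,
    a \in written_arrays body -> (q < reg s 0)%N ->
    m a p q = if (p < i)%N then val a p q else mem s a p q)) => //.
  move=> i s' il s'i s'reg s'mem Ii.
  have s'0 : reg s' 0 = reg s 0 by rewrite s'reg//= nregs.
  have : forall a p q, a \in written_arrays body ->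
      mem (den (PFor rJ 0 body) s') a p q =
      if (p == i) && (q < reg s' 0)%N then val a p q else mem s' a p q.
    apply: (@for_mem R n proj frozen (fun j m => forall a p q,
      a \in written_arrays body ->
      m a p q = if (p == i) && (q < j)%N then val a p q else mem s' a p q)) => //.
      by move=> a p q _; rewrite andbF.
    move=> j s2 jl s2j s2reg s2mem Ij a p q aW.
    rewrite (@bodyE s2 i j)//.
    - rewrite Ij//; case: (eqVneq p i) => [->|] //=.
      case: (eqVneq q j) => [->|qj]; first by rewrite ltnSn.
      by rewrite ltnS [in RHS]leq_eqVlt (negbTE qj).
    - by rewrite s2reg// nregs.
    - move=> r ri rj; rewrite s2reg ?s'reg//= nregs !inE ?negb_or ?ri//.
    - by move=> b bW; rewrite s2mem ?s'mem.
    - move=> b; have [bW|bW] := boolP (b \in written_arrays body).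
        by rewrite Ij// ltnn andbF Ii ?ltnn// -s'0.
      by rewrite s2mem ?s'mem.
  move=> h a p q aW qn; rewrite h// s'0 qn andbT Ii//.
  case: (eqVneq p i) => [->|pi]; first by rewrite ltnSn.
  by rewrite ltnS [in RHS]leq_eqVlt (negbTE pi).
by move=> h a p q aW pn qn; rewrite h// pn.
Qed.

Lemma copy_progE s p q : reg s rZ = 0%N -> mem s 17 0 0 = 0 ->
  (p < reg s 0)%N -> (q < reg s 0)%N ->
  mem (den copy_prog s) aY p q = mem s aJ p q /\
  mem (den copy_prog s) aOut p q = mem s aOut p q + mem s aJ p q.
Proof.
move=> z0 zero pn qn.
have H a : a \in [:: aY; aOut] -> mem (den copy_prog s) a p q =
    if a == aY then mem s aJ p q else mem s aOut p q + mem s aJ p q.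
  move=> aW; apply: (@sweep_mem _ s (fun a p q => if a == aY then mem s aJ p q
     else mem s aOut p q + mem s aJ p q)) => // s' i j s'i s'j s'reg s'mem s'ij.
  move=> {aW}a {pn}p {qn}q; rewrite /= !inE => /orP[] /eqP ->.
    rewrite /= s'i s'j (s'reg rZ)// z0 (s'mem aJ)// (s'mem 17%N)// zero addr0.
    by case: ifP => // /andP[/eqP -> /eqP ->].
  rewrite /= s'i s'j (s'mem aJ)// s'ij.
  by case: ifP => // /andP[/eqP -> /eqP ->].
by split; rewrite H.
Qed.

Lemma average_progE s p q : reg s rZ = 0%N -> (p < reg s 0)%N -> (q < reg s 0)%N ->
  mem (den average_prog s) aOut p q = mem s aOut p q / mem s 16 0 0.
Proof.
move=> z0 pn qn.
apply: (@sweep_mem _ s (fun a p q => mem s aOut p q / mem s 16%N 0%N 0%N)) => //.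
move=> s' i j s'i s'j s'reg s'mem s'ij a {pn}p {qn}q; rewrite /= !inE => /eqP ->.
rewrite /= s'i s'j (s'reg rZ)// z0 (s'mem 16%N)// s'ij.
by case: ifP => // /andP[/eqP -> /eqP ->].
Qed.

Variables (l : nat) (X : nat -> nat -> R) (N : nat) (eta2 : R).

(** A step against the gradient of the objective on the space of all matrices.
    Its coefficients are [1 - tanh u = 2 / (expR (2 * u) + 1)], whence [eta2],
    twice the step size. *)
Definition ascent (A : 'M[R]_n) : 'M[R]_n :=
  \matrix_(p, q) \sum_(k < l)
    (eta2 / ((1 + 2 * (X k p * \sum_j A p j * X k j) / N%:R) ^+ N + 1)
       * X k p * X k q).

Definition descent_step (A : 'M[R]_n) : 'M[R]_n := proj (A + ascent A).

(** What the rounds read and never write. *)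
Record ready s : Prop := Ready {
  ready_n : reg s 0 = n;
  ready_l : reg s 1 = l;
  ready_z : reg s rZ = 0%N;
  ready_N : reg s rN = N;
  ready_X : mem s aX = X;
  ready_one : mem s 10 0 0 = 1;
  ready_step : mem s 15 0 0 = eta2;
  ready_cnt : mem s 16 0 0 = N%:R;
  ready_zero : mem s 17 0 0 = 0 }.

Lemma ready_den s p : well_formed frozen p ->
  all (fun a => a \notin written_arrays p) [:: aX; 10; 15; 16; 17]%N ->
  ready s -> ready (den p s).
Proof.
move=> wf /= /and5P[h1 h2 h3 h4 /andP[h5 _]] [*].
by split; rewrite ?(mem_den, reg_den_frozen _ _ wf).
Qed.

Lemma get_mx_project a b s :
  get_mx n (den (PAct (Project a b)) s) a = proj (get_mx n s b).
Proof. by apply/matrixP => p q; rewrite mxE /= eqxx !valK. Qed.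

Lemma round_progE s : ready s ->
  get_mx n (den round_prog s) aJ = descent_step (get_mx n s aJ) /\
  get_mx n (den round_prog s) aOut = get_mx n s aOut + get_mx n s aJ.
Proof.
move=> rs; have [rn rl rz rN' rX r1 r2 r3 r4] := rs.
set s1 := den copy_prog s; set s2 := den gradient_prog s1.
have rs1 : ready s1 by apply: ready_den.
have [sn sl sz sN' sX s_1 s_2 s_3 s_4] := rs1.
have J1 : mem s1 aJ = mem s aJ by rewrite mem_den.
have Y2 : get_mx n s2 aY = get_mx n s aJ + ascent (get_mx n s aJ).
  apply/matrixP => p q; rewrite !mxE gradient_progE// sn !ltn_ord sl /=.
  have -> : mem s1 aY p q = mem s aJ p q.
    by case: (@copy_progE s p q rz r4); rewrite ?rn.
  congr (_ + _); rewrite big_mkord; apply: eq_bigr => k _.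
  rewrite /coef J1 sX s_1 s_2 s_3 sN' sn big_mkord.
  congr (_ / (_ ^+ _ + 1) * _ * _); rewrite addrC; congr (1 + _ / _).
  have -> : \sum_(j < n) get_mx n s aJ p j * X k j = \sum_(j < n) mem s aJ p j * X k j.
    by apply: eq_bigr => j _; rewrite mxE.
  by ring.
split.
  by rewrite /round_prog !den_seq -/s1 -/s2 get_mx_project Y2.
apply/matrixP => p q; rewrite !mxE /round_prog !den_seq -/s1 -/s2.
have -> : mem (den (PAct (Project aJ aY)) s2) aOut = mem s1 aOut.
  by rewrite mem_den// mem_den.
by case: (@copy_progE s p q rz r4); rewrite ?rn.
Qed.

Lemma main_progE s : ready s -> get_mx n s aOut = 0 ->
  get_mx n (den main_prog s) aOut =
    N%:R^-1 *: \sum_(t < N) iter t descent_step (get_mx n s aJ).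
Proof.
move=> rs out0; have [rn rl rz rN' rX r1 r2 r3 r4] := rs.
pose mx (m : nat -> nat -> nat -> R) a : 'M[R]_n := \matrix_(p, q) m a p q.
have mxmem s' a : mx (mem s') a = get_mx n s' a by [].
set s1 := den descent_prog s.
have rs1 : ready s1 by apply: ready_den.
have [_ H] : mx (mem s1) aJ = iter N descent_step (get_mx n s aJ) /\
    mx (mem s1) aOut = \sum_(t < N) iter t descent_step (get_mx n s aJ).
  rewrite -rN' /s1 /descent_prog.
  apply: (@for_mem R n proj frozen (fun t m =>
    mx m aJ = iter t descent_step (get_mx n s aJ) /\
    mx m aOut = \sum_(t' < t) iter t' descent_step (get_mx n s aJ))) => //.
    by rewrite big_ord0.
  move=> t s' tN s't s'reg s'mem [IJ IO].
  have rs' : ready s' by split; rewrite ?s'reg// ?s'mem.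
  have [EJ EO] := round_progE rs'.
  rewrite !mxmem in IJ IO *; rewrite EJ EO IJ IO.
  by rewrite iterS big_ord_recr.
apply/matrixP => p q; rewrite mxE.
have [sn sl sz sN' sX s_1 s_2 s_3 s_4] := rs1.
rewrite /main_prog den_seq -/s1.
rewrite average_progE ?sn// s_3 mxE mulrC; congr (_ * _).
by rewrite -H mxE.
Qed.

End Semantics.

Section Run.
Variables (R : realType) (n : nat) (proj : 'M[R]_n -> 'M[R]_n) (tau : nat).
Implicit Types s : state R.
Local Notation den := (den proj).

Lemma exec_ceil s (W : R) (fuel : nat) :
  reg s rZ = 0%N -> mem s 10 0 0 = 1 -> mem s 11 0 0 = W ->
  mem s 16 0 0 = (reg s rN)%:R -> (reg s rN)%:R < W + 1 ->
  W <= (reg s rN + fuel)%:R ->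
  exists t s', [/\ exec proj tau ceil_cmd s t s', (t <= 3 * fuel + 1)%N,
    W <= (reg s' rN)%:R < W + 1 /\ mem s' 16 0 0 = (reg s' rN)%:R,
    forall r, r != rN -> reg s' r = reg s r &
    forall a, a != 16%N -> mem s' a = mem s a].
Proof.
elim: fuel s => [|fuel IH] s z0 one W0 cnt cW Wf.
  exists 1%N, s; split=> //; last by rewrite -{1}(addn0 (reg s rN)) Wf cW.
  by apply: ExecWhileFalse; rewrite /= z0 cnt W0 -leNgt -(addn0 (reg s rN)).
have [done|more] := leP W (reg s rN)%:R.
  exists 1%N, s; split=> //; last by rewrite done cW.
  by apply: ExecWhileFalse; rewrite /= z0 cnt W0 -leNgt.
pose s1 := write s cCnt (eval_op OpAdd (read s cCnt) (read s cOne)).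
pose s2 := set_reg s1 rN (reg s1 rN).+1.
have m2 a : a != 16%N -> mem s2 a = mem s a by move=> ?; exact: mem_write_neq.
have N2 : reg s2 rN = (reg s rN).+1 by [].
have c2 : mem s2 16 0 0 = (reg s2 rN)%:R.
  by rewrite /= z0 /= cnt one natr1.
have [||||||t [s' [ex ht hN hr hm]]] := IH s2.
- by [].
- by rewrite m2.
- by rewrite m2.
- by [].
- by rewrite N2 -natr1 ltrD2r.
- by rewrite N2 addSn -addnS.
exists (1 + 1 + t).+1, s'; split=> //.
- apply: (ExecWhileTrue (s' := s2)) => //.
    by rewrite /= z0 cnt W0.
  by apply: (ExecSeq (s' := s1)); constructor.
- by move: ht; lia.
- by move=> r rr; rewrite hr//= (negbTE rr).
- by move=> a aa; rewrite hm// m2.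
Qed.

Lemma count_regE b s : well_formed [:: 0; 1; rZ]%N (count_reg b) ->
  reg s rZ = 0%N -> mem s 10 0 0 = 1 ->
  mem (den (count_reg b) s) 11 0 0 = mem s 11 0 0 + (reg s b)%:R.
Proof.
move=> wf z0 one.
apply: (@for_mem R n proj [:: 0; 1; rZ]%N (fun k m =>
  m 11%N 0%N 0%N = mem s 11 0 0 + k%:R)) => //; first by rewrite addr0.
move=> k s' kb s'I s'reg s'mem Ik.
have s'z : reg s' rZ = 0%N by rewrite s'reg.
by rewrite /= s'z /= (s'mem 10%N)// Ik one -addrA natr1.
Qed.

Lemma setup_progE l (M eps w : R) (x : sample n l) s0 s :
  w = n%:R + l%:R + M + eps^-1 -> s0 = init_state M eps x ->
  s = den setup_prog s0 ->
  [/\ [/\ reg s 0 = n, reg s 1 = l, reg s rZ = 0%N, reg s rOne = 1%N & reg s rN = 0%N],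
      [/\ mem s 10 0 0 = 1, mem s 11 0 0 = w ^+ 16,
           mem s 15 0 0 = (w ^+ 8)^-1 + (w ^+ 8)^-1, mem s 16 0 0 = 0 &
           mem s 17 0 0 = 0],
      mem s aX = mem s0 aX, get_mx n s aJ = proj 0 & get_mx n s aOut = 0].
Proof.
move=> wE s0E sE.
have regs r : r \notin written_regs setup_prog -> reg s r = reg s0 r.
  by move=> h; rewrite sE reg_den.
have mems a : a \notin written_arrays setup_prog -> mem s a = mem s0 a.
  by move=> h; rewrite sE mem_den.
have Y0 a : a \in [:: aY; aOut] -> get_mx n s0 a = 0.
  by rewrite !inE s0E => /orP[] /eqP ->; apply/matrixP => p q; rewrite !mxE.
have [r0 r1 rz ro rn] : [/\ reg s0 0 = n, reg s0 1 = l, reg s0 rZ = 0%N,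
    reg s0 rOne = 0%N & reg s0 rN = 0%N] by rewrite s0E.
have [m0 m0' m11 m16 m17] : [/\ mem s0 0 0 0 = M, mem s0 0 0 1 = eps,
    mem s0 11 0 0 = 0, mem s0 16 0 0 = 0 & mem s0 17 0 0 = 0] by rewrite s0E.
clear s0E.
set initial := (PAct (RegSucc rOne) ;; PAct (CellOne cOne) ;; PAct (Project aJ aY)).
have [s1 [s1E [z1 o1 n1 l1] one1 J1 m1]] : exists s1, [/\ s1 = den initial s0,
    [/\ reg s1 rZ = 0%N, reg s1 rOne = 1%N, reg s1 0 = n & reg s1 1 = l],
    mem s1 10%N 0%N 0%N = 1, get_mx n s1 aJ = proj 0 &
    forall a, a != 10%N -> a != 3%N -> mem s1 a = mem s0 a].
  exists (den initial s0); split=> //.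
  - by rewrite /= ro.
  - by rewrite /= rz.
  - rewrite /initial !den_seq get_mx_project -(Y0 aY)//.
  - by move=> a a10 a3; rewrite mem_den// !inE negb_or a10.
have [s2 [s2E [z2 o2] W2 m2]] : exists s2, [/\ s2 = den (count_reg 1) (den (count_reg 0) s1),
    reg s2 rZ = 0%N /\ reg s2 rOne = 1%N,
    mem s2 11%N 0%N 0%N = n%:R + l%:R &
    forall a, a != 11%N -> mem s2 a = mem s1 a].
  exists (den (count_reg 1) (den (count_reg 0) s1)); split=> //.
  - by rewrite !reg_den.
  - by rewrite !count_regE ?mem_den ?reg_den// n1 l1 m1// m11 add0r.
  - by move=> a a11; rewrite !mem_den//= inE.
set final := (add cW cW (0, rZ, rZ)%N ;; div cTmp cOne (0, rZ, rOne)%N ;; add cW cW cTmp ;;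
   mul cW cW cW ;; mul cW cW cW ;; mul cW cW cW ;;
   div cStep cOne cW ;; add cStep cStep cStep ;; mul cW cW cW).
have {}sE : s = den final s2 by rewrite s2E s1E sE.
clear s2E s1E.
have one2 : mem s2 10 0 0 = 1 by rewrite m2.
have in2 : mem s2 0 0 0 = M by rewrite m2 ?m1.
have in2' : mem s2 0 0 1 = eps by rewrite m2 ?m1.
split.
- by split; do ?[by rewrite regs]; rewrite sE reg_den.
- split.
  + by rewrite sE mem_den.
  + rewrite sE /= z2 o2 /= one2 in2 in2' W2 (mul1r eps^-1) -wE; ring.
  + rewrite sE /= z2 o2 /= one2 in2 in2' W2 !mul1r -wE.
    by congr (_^-1 + _^-1); ring.
  + by rewrite mems ?m16.
  + by rewrite mems ?m17.
- by rewrite mems.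
- rewrite -J1; apply/matrixP => p q; by rewrite !mxE sE mem_den// m2.
- rewrite -[RHS](Y0 aOut)//; by apply/matrixP => p q; rewrite !mxE mems.
Qed.

End Run.

End Implementation.

(** * Convergence of projected gradient descent *)

Section Projection.
Variables (R : realType) (n : nat) (J : set 'M[R]_n) (proj : 'M[R]_n -> 'M[R]_n).
Hypotheses (projP : is_projection J proj)
  (convJ : forall A B (t : R), 0 <= t <= 1 -> J A -> J B -> J (t *: A + (1 - t) *: B)).

Definition frob_dot (A B : 'M[R]_n) : R := \sum_i \sum_j A i j * B i j.

Lemma norm_frobD_dot (A B : 'M[R]_n) : norm_frob (A + B) ^+ 2 =
  norm_frob A ^+ 2 + 2 * frob_dot A B + norm_frob B ^+ 2.
Proof.
rewrite !norm_frob_sqr /frob_dot mulr_sumr -!big_split/=; apply: eq_bigr => i _.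
rewrite mulr_sumr -!big_split/=; apply: eq_bigr => j _; rewrite mxE; ring.
Qed.

Lemma frob_dotZr (A B : 'M[R]_n) (a : R) : frob_dot A (a *: B) = a * frob_dot A B.
Proof.
rewrite /frob_dot mulr_sumr; apply: eq_bigr => i _.
by rewrite mulr_sumr; apply: eq_bigr => j _; rewrite mxE mulrCA.
Qed.

Lemma norm_frobZ_sqr (A : 'M[R]_n) (a : R) :
  norm_frob (a *: A) ^+ 2 = a ^+ 2 * norm_frob A ^+ 2.
Proof.
rewrite !norm_frob_sqr mulr_sumr; apply: eq_bigr => i _.
by rewrite mulr_sumr; apply: eq_bigr => j _; rewrite mxE exprMn.
Qed.

(** The distance from [A] to the point at parameter [t] of the segment from
    [proj A] to [B] is minimal at [t = 0]; a positive scalar product [c] would be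
    contradicted at [t = c / q], or at [t = 1] when [q < c]. *)
Lemma proj_obtuse A B : J B -> frob_dot (A - proj A) (B - proj A) <= 0.
Proof.
move=> JB; have [Jp pmin] := projP A; set p := proj A in Jp pmin *.
set c := frob_dot _ _; set q := norm_frob (B - p) ^+ 2.
have q0 : 0 <= q by rewrite sqr_ge0.
have key t : 0 <= t <= 1 -> 2 * t * c <= t ^+ 2 * q.
  move=> t01; set C := t *: B + (1 - t) *: p.
  have h : norm_frob (A - p) ^+ 2 <= norm_frob (A - C) ^+ 2.
    by rewrite lerXn2r ?nnegrE ?norm_frob_ge0// pmin//; exact: convJ.
  move: h; have -> : A - C = (A - p) + (- t) *: (B - p).
    by apply/matrixP => i j; rewrite !mxE; ring.
  rewrite [leRHS]norm_frobD_dot frob_dotZr norm_frobZ_sqr -/c -/q; lra.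
rewrite leNgt; apply/negP => c0.
have [qc|cq] := leP q c.
  by have := key 1; rewrite ler01 lexx => /(_ isT); nra.
have q1 : 0 < q by exact: lt_trans cq.
have cq01 : 0 <= c / q <= 1.
  by rewrite divr_ge0 ?(ltW c0)//= ler_pdivrMr// mul1r (ltW cq).
have := key _ cq01.
have -> : 2 * (c / q) * c = 2 * (c ^+ 2 / q) by ring.
have -> : (c / q) ^+ 2 * q = c ^+ 2 / q by field; rewrite gt_eqF.
by have : 0 < c ^+ 2 / q by [rewrite divr_gt0// exprn_gt0]; lra.
Qed.

Lemma proj_contract A B : J B ->
  norm_frob (proj A - B) ^+ 2 <= norm_frob (A - B) ^+ 2.
Proof.
move=> JB; have := proj_obtuse A JB; set p := proj A => h.
have -> : A - B = (A - p) + (-1) *: (B - p).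
  by apply/matrixP => i j; rewrite !mxE; ring.
have -> : norm_frob (p - B) ^+ 2 = norm_frob (B - p) ^+ 2.
  rewrite -opprB -scaleN1r norm_frobZ_sqr; ring.
rewrite [leRHS]norm_frobD_dot frob_dotZr norm_frobZ_sqr.
have := sqr_ge0 (norm_frob (A - p)); lra.
Qed.

End Projection.

Section ExpApprox.
Variable R : realType.
Implicit Types (u v M : R) (N : nat).

Lemma bernoulli_ge v N : 0 <= v <= 1 -> 1 - N%:R * v <= (1 - v) ^+ N.
Proof.
move=> /andP[v0 v1]; elim: N => [|N IH]; first by rewrite mul0r subr0.
have := ler_wpM2l (_ : 0 <= 1 - v) IH; rewrite subr_ge0 => /(_ v1).
rewrite exprS -natr1; have : 0 <= N%:R * v ^+ 2 by rewrite mulr_ge0 ?sqr_ge0.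
by lra.
Qed.

Definition approx_weight N u : R := 2 / ((1 + 2 * u / N%:R) ^+ N + 1).

(** With [v = 2 * u / N], [(1 - v ^+ 2) * expR v <= 1 + v <= expR v]; raised to
    the power [N], this shows by [bernoulli_ge] that [(1 + v) ^+ N] approximates
    [expR (2 * u)] with relative error at most
    [N * v ^+ 2 = 4 * u ^+ 2 / N]. *)
Lemma approx_weightP M N u : (0 < N)%N -> 4 * M <= N%:R -> `|u| <= M ->
  [/\ 0 <= approx_weight N u, approx_weight N u <= 2 &
      `|approx_weight N u - (1 - tanh u)| <= 8 * M ^+ 2 / N%:R].
Proof.
move=> N0 MN uM; have NR : 0 < N%:R :> R by rewrite ltr0n.
rewrite /approx_weight; set v := 2 * u / N%:R.
have uE : 2 * u = N%:R * v by rewrite /v [RHS]mulrC divfK ?gt_eqF.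
have [u1 u2] : - M <= u /\ u <= M by move: uM; rewrite ler_norml => /andP[].
have v1 : - (1 / 2) <= v <= 1 / 2.
  by rewrite /v ler_pdivlMr// ler_pdivrMr//; apply/andP; split; lra.
have v20 : v ^+ 2 <= 1 by case/andP: v1 => *; nra.
have EE : expR (2 * u) = expR v ^+ N by rewrite uE expRM_natl.
set E := expR (2 * u) in EE; set E' := (1 + v) ^+ N.
have pos : 0 < 1 + v by case/andP: v1 => *; lra.
have E0 : 0 < E by exact: expR_gt0.
have E'0 : 0 < E' by exact: exprn_gt0.
have E'E : E' <= E.
  by rewrite /E' EE lerXn2r ?nnegrE ?expR_ge0 ?(ltW pos)// expR_ge1Dx.
have EE' : E - E' <= N%:R * v ^+ 2 * E.
  have := @bernoulli_ge (v ^+ 2) N; rewrite sqr_ge0 v20 => /(_ isT) h.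
  have hE : (1 - v ^+ 2) ^+ N * E <= E'.
    rewrite EE -exprMn /E' lerXn2r ?nnegrE ?mulr_ge0 ?expR_ge0 ?subr_ge0 ?(ltW pos)//.
    have : expR v * expR (- v) = 1 by rewrite -expRD subrr expR0.
    have := expR_ge1Dx (- v); have := expR_gt0 v.
    move=> e0 e1 e2.
    have : (1 - v) * expR v <= 1 by nra.
    by nra.
  have := le_trans (ler_wpM2r (ltW E0) h) hE; lra.
have N2 : N%:R * v ^+ 2 = 4 * u ^+ 2 / N%:R.
  by rewrite /v; field; rewrite gt_eqF.
split.
- by rewrite divr_ge0// addr_ge0// ltW.
- by rewrite ler_pdivrMr ?addr_gt0//; lra.
have -> : 2 / (E' + 1) - (1 - tanh u) = 2 * (E - E') / ((E + 1) * (E' + 1)).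
  rewrite /tanh -/E; field; apply/andP; split; rewrite gt_eqF ?addr_gt0//.
rewrite ger0_norm; last first.
  by rewrite divr_ge0 ?mulr_ge0 ?subr_ge0 ?addr_ge0// ltW.
rewrite ler_pdivrMr ?mulr_gt0 ?addr_gt0//.
have u2M : u ^+ 2 <= M ^+ 2 by nra.
have h8 : 2 * (N%:R * v ^+ 2) <= 8 * M ^+ 2 / N%:R.
  by rewrite N2 mulrA ler_pM2r ?invr_gt0//; lra.
have q0 : 0 <= 8 * M ^+ 2 / N%:R by rewrite divr_ge0// mulr_ge0// sqr_ge0.
apply: (@le_trans _ _ (8 * M ^+ 2 / N%:R * E)); first by nra.
by apply: ler_wpM2l => //; nra.
Qed.

End ExpApprox.

Lemma sum_const2 (R : pzRingType) (a b : nat) (c : R) :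
  \sum_(i < a) \sum_(j < b) c = a%:R * (b%:R * c).
Proof. by rewrite !sumr_const !card_ord -[c *+ b]mulr_natl -[_ *+ a]mulr_natl. Qed.

Section Descent.
Variables (R : realType) (n l : nat) (x : sample n l) (J : set 'M[R]_n)
  (proj : 'M[R]_n -> 'M[R]_n) (X : nat -> nat -> R) (M : R) (N : nat) (eta : R).
Hypotheses (projP : is_projection J proj)
  (convJ : forall A B (t : R), 0 <= t <= 1 -> J A -> J B -> J (t *: A + (1 - t) *: B))
  (J_le : forall A, J A -> norm_inf A <= M)
  (XE : forall (k : 'I_l) (i : 'I_n), X k i = spin R (x k) i)
  (N0 : (0 < N)%N) (MN : 4 * M <= N%:R) (eta0 : 0 < eta).

Local Notation f := (objective x).
Local Notation next := (descent_step proj l X N (eta + eta)).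

Let NR : 0 < N%:R :> R. Proof. by rewrite ltr0n. Qed.

Let score (A : 'M[R]_n) k i : R :=
  approx_weight N (spin R (x k) i * local_field A (x k) i) * spin R (x k) i.

Let ascentE A i j :
  ascent l X N (eta + eta) A i j = eta * \sum_k score A k i * spin R (x k) j.
Proof.
rewrite mxE mulr_sumr; apply: eq_bigr => k _.
rewrite !XE /score /approx_weight -/(local_field A (x k) i).
have -> : \sum_j0 A i j0 * X k j0 = local_field A (x k) i.
  by apply: eq_bigr => q _; rewrite XE.
by move: (_ ^+ N + 1) => d; ring.
Qed.

Let row_le A i : J A -> \sum_j `|A i j| <= M.
Proof. by move=> /J_le; apply: le_trans; exact: row_sum_le_norm_inf. Qed.

Let norm_u_le A k i : J A -> `|spin R (x k) i * local_field A (x k) i| <= M.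
Proof. by move=> JA; rewrite normrM norm_spin mul1r norm_local_field_le// row_le. Qed.

Let norm_score_le A k i : J A -> `|score A k i| <= 2.
Proof.
move=> JA; have [w0 w2 _] := approx_weightP N0 MN (norm_u_le k i JA).
by rewrite normrM norm_spin mulr1 ger0_norm.
Qed.

Let score_close A k i : J A ->
  `|score A k i - resid A (x k) i| <= 8 * M ^+ 2 / N%:R.
Proof.
move=> JA; have [_ _] := approx_weightP N0 MN (norm_u_le k i JA).
rewrite tanh_spin /score /resid; set W := approx_weight _ _.
have -> : W * spin R (x k) i - (spin R (x k) i - tanh (local_field A (x k) i))
  = (W - (1 - spin R (x k) i * tanh (local_field A (x k) i))) * spin R (x k) i
    + (1 - spin R (x k) i * spin R (x k) i) * tanh (local_field A (x k) i) by ring.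
by rewrite spin_sqr subrr mul0r addr0 normrM norm_spin mulr1.
Qed.

Let objective_tangent (A B : 'M[R]_n) :
  f A - f B <= - \sum_k \sum_i resid A (x k) i * local_field (A - B) (x k) i.
Proof.
rewrite -sumrB -sumrN; apply: ler_sum => k _.
have := pseudo_loss_tangent A B (x k).
have -> : \sum_i resid A (x k) i * local_field (B - A) (x k) i
   = - \sum_i resid A (x k) i * local_field (A - B) (x k) i.
  by rewrite -sumrN; apply: eq_bigr => i _; rewrite !local_fieldB; ring.
lra.
Qed.

Let dot_ascent A D : frob_dot D (ascent l X N (eta + eta) A)
  = eta * \sum_k \sum_i score A k i * local_field D (x k) i.
Proof.
rewrite /frob_dot exchange_big/=.
transitivity (eta * \sum_i \sum_k score A k i * local_field D (x k) i); last first.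
  by rewrite exchange_big.
rewrite exchange_big mulr_sumr; apply: eq_bigr => i _.
under eq_bigr do rewrite ascentE mulrCA mulr_sumr.
rewrite -mulr_sumr exchange_big/=; congr (_ * _); apply: eq_bigr => k _.
by rewrite mulr_sumr; apply: eq_bigr => j _; ring.
Qed.

(** The first term bounds the squared length of a step, the second the effect
    of the approximate exponential. *)
Let slack : R := eta ^+ 2 * (4 * n%:R ^+ 2 * l%:R ^+ 2)
  + 2 * eta * (16 * M ^+ 3 * l%:R * n%:R / N%:R).

(** Projecting does not increase the distance to [B], and moving against the
    gradient decreases its square in proportion to the gap in the objective. *)
Let step_progress A B : J A -> J B ->
  norm_frob (next A - B) ^+ 2 <=
    norm_frob (A - B) ^+ 2 - 2 * eta * (f A - f B) + slack.
Proof.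
move=> JA JB; apply: le_trans (proj_contract projP convJ _ JB) _.
set G := ascent _ _ _ _ _.
have -> : A + G - B = (A - B) + G by rewrite addrAC.
rewrite norm_frobD_dot dot_ascent.
have G2 : norm_frob G ^+ 2 <= eta ^+ 2 * (4 * n%:R ^+ 2 * l%:R ^+ 2).
  rewrite norm_frob_sqr.
  apply: (@le_trans _ _ (\sum_(i < n) \sum_(j < n) (eta * (l%:R * 2)) ^+ 2)).
    apply: ler_sum => i _; apply: ler_sum => j _.
    rewrite -real_normK ?num_real// lerXn2r ?nnegrE ?mulr_ge0 ?(ltW eta0)//.
    rewrite /G ascentE normrM gtr0_norm// ler_wpM2l ?(ltW eta0)//.
    apply: le_trans (ler_norm_sum _ _ _) _.
    apply: (@le_trans _ _ (\sum_(k < l) 2)); last first.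
      by rewrite sumr_const card_ord mulr_natl.
    by apply: ler_sum => k _; rewrite normrM norm_spin mulr1 norm_score_le.
  rewrite sum_const2.
  by rewrite le_eqVlt; apply/orP; left; apply/eqP; ring.
have cross : \sum_k \sum_i score A k i * local_field (A - B) (x k) i
    <= - (f A - f B) + 16 * M ^+ 3 * l%:R * n%:R / N%:R.
  have tan := objective_tangent A B.
  suff : \sum_k \sum_i score A k i * local_field (A - B) (x k) i
      - \sum_k \sum_i resid A (x k) i * local_field (A - B) (x k) i
      <= 16 * M ^+ 3 * l%:R * n%:R / N%:R by lra.
  rewrite -sumrB.
  apply: (@le_trans _ _ (\sum_(k < l) \sum_(i < n) 8 * M ^+ 2 / N%:R * (2 * M))).
    apply: ler_sum => k _; rewrite -sumrB; apply: ler_sum => i _.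
    rewrite -mulrBl; apply: le_trans (ler_norm _) _; rewrite normrM.
    apply: ler_pM => //; first exact: score_close.
    rewrite local_fieldB; apply: le_trans (ler_normB _ _) _.
    have := norm_local_field_le (x k) (row_le i JA).
    have := norm_local_field_le (x k) (row_le i JB).
    lra.
  rewrite sum_const2.
  by rewrite le_eqVlt; apply/orP; left; apply/eqP; ring.
have := ler_wpM2l (ltW eta0) cross; rewrite /slack; lra.
Qed.

Let iterates A t : J A -> J (iter t next A).
Proof. by case: t => //= t _; exact: (projP _).1. Qed.

Let total_progress A B T : J A -> J B ->
  2 * eta * (\sum_(t < T) (f (iter t next A) - f B))
    + norm_frob (iter T next A - B) ^+ 2 <= norm_frob (A - B) ^+ 2 + T%:R * slack.
Proof.
move=> JA JB; elim: T => [|T IH]; first by rewrite big_ord0 mulr0 add0r mul0r addr0.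
rewrite big_ord_recr/= -natr1.
have := step_progress (iterates T JA) JB; lra.
Qed.

(** Each average is a convex combination of the previous one and of the next
    iterate. *)
Lemma average_mem A T : J A -> J (T.+1%:R^-1 *: \sum_(t < T.+1) iter t next A).
Proof.
move=> JA; elim: T => [|T IH]; first by rewrite big_ord1 invr1 scale1r.
rewrite big_ord_recr/=.
set S := \sum_(t < T.+1) _ in IH *; set B := next _.
have T1 : T.+1%:R != 0 :> R by rewrite pnatr_eq0.
have T2 : T.+2%:R != 0 :> R by rewrite pnatr_eq0.
have -> : T.+2%:R^-1 *: (S + B) =
    (T.+1%:R / T.+2%:R) *: (T.+1%:R^-1 *: S) + (1 - T.+1%:R / T.+2%:R) *: B.
  rewrite scalerDr scalerA mulrAC divff// mul1r; congr (_ + _ *: _).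
  rewrite -(natr1 T.+1) in T2 *; move: T1 T2; move: (T.+1%:R : R) => c c0 c1.
  by field.
apply: convJ => //; last exact: (iterates T.+1).
by rewrite divr_ge0//= ler_pdivrMr ?ltr0n// mul1r ler_nat.
Qed.

(** Jensen's inequality, from the tangent inequality at the average. *)
Lemma objective_average_le A T : (0 < T)%N ->
  f (T%:R^-1 *: \sum_(t < T) iter t next A)
    <= T%:R^-1 * \sum_(t < T) f (iter t next A).
Proof.
move=> T0; set C := T%:R^-1 *: _.
have TR : 0 < T%:R :> R by rewrite ltr0n.
rewrite ler_pdivlMl//.
have h (t : 'I_T) : f C - \sum_k \sum_i resid C (x k) i * local_field (iter t next A - C) (x k) i
    <= f (iter t next A).
  by rewrite -sumrB; apply: ler_sum => k _; exact: pseudo_loss_tangent.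
apply: le_trans (ler_sum _ (fun t _ => h t)).
rewrite sumrB sumr_const card_ord -[f C *+ T]mulr_natl.
rewrite [X in _ - X](_ : _ = 0) ?subr0//.
rewrite exchange_big/= big1// => k _; rewrite exchange_big/= big1// => i _.
rewrite -mulr_sumr; set S := \sum_t _.
suff -> : S = 0 by rewrite mulr0.
rewrite /S; under eq_bigr do rewrite local_fieldB.
rewrite sumrB sumr_const card_ord -[local_field C (x k) i *+ T]mulr_natl.
have -> : local_field C (x k) i = T%:R^-1 * \sum_(t < T) local_field (iter t next A) (x k) i.
  rewrite /local_field exchange_big/= mulr_sumr; apply: eq_bigr => j _.
  by rewrite !mxE summxE -mulr_suml mulrA.
by rewrite mulrA divff ?gt_eqF// mul1r subrr.
Qed.

Lemma descent_approx A B : J A -> J B ->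
  f (N%:R^-1 *: \sum_(t < N) iter t next A) <= f B +
    (2 * n%:R * M ^+ 2 / (eta * N%:R) + 2 * eta * n%:R ^+ 2 * l%:R ^+ 2
       + 16 * M ^+ 3 * l%:R * n%:R / N%:R).
Proof.
move=> JA JB; apply: le_trans (objective_average_le _ N0) _.
have := total_progress N JA JB.
rewrite sumrB sumr_const card_ord -[f B *+ N]mulr_natl.
set S := \sum_(t < N) f _.
have D0 : norm_frob (A - B) ^+ 2 <= n%:R * (2 * M) ^+ 2.
  rewrite norm_frob_sqr mulr_natl -[X in _ *+ X]card_ord -sumr_const.
  apply: ler_sum => i _; under eq_bigr do rewrite -real_normK ?num_real//.
  apply: sum_sqr_le => //.
  apply: (@le_trans _ _ (\sum_j (`|A i j| + `|B i j|))).
    by apply: ler_sum => j _; rewrite !mxE ler_normB.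
  by rewrite big_split/=; have := row_le i JA; have := row_le i JB; lra.
have := sqr_ge0 (norm_frob (iter N next A - B)).
move=> q0 prog.
have {prog q0} D0 : 2 * eta * (S - N%:R * f B) <= n%:R * (2 * M) ^+ 2 + N%:R * slack by lra.
rewrite -lerBlDl.
have -> : N%:R^-1 * S - f B = (2 * eta * (S - N%:R * f B)) / (2 * eta * N%:R).
  by field; rewrite !gt_eqF.
have -> : 2 * n%:R * M ^+ 2 / (eta * N%:R) + 2 * eta * n%:R ^+ 2 * l%:R ^+ 2
       + 16 * M ^+ 3 * l%:R * n%:R / N%:R
  = (n%:R * (2 * M) ^+ 2 + N%:R * slack) / (2 * eta * N%:R).
  by rewrite /slack; field; rewrite !gt_eqF.
by rewrite ler_pM2r// invr_gt0 !mulr_gt0.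
Qed.

End Descent.

(** * Error and running time *)

Lemma convex_setP (R : realType) n (J : set 'M[R]_n) :
  convex_set (J : set (convex_lmodType 'M[R]_n)) ->
  forall A B (t : R), 0 <= t <= 1 -> J A -> J B -> J (t *: A + (1 - t) *: B).
Proof.
move=> cJ A B t /andP[t0 t1] /mem_set JA /mem_set JB.
exact/set_mem/(cJ _ _ (Itv01 t0 t1) JA JB).
Qed.

Section Complexity.
Variable R : realType.

(** Every loop bound is at most [3 * (w + tau) ^+ 16], because the number of
    rounds is of order [w ^+ 16]; the 4 is the share of [ceil_cmd]. *)
Definition time_const : nat :=
  ((psize setup_prog + psize main_prog + 4) * 3 ^ (pdepth setup_prog + pdepth main_prog))%N.

Definition time_degree : nat := (16 * (pdepth setup_prog + pdepth main_prog))%N.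

(** Each of the three terms is at most a quarter of [w^-1 <= eps]. The powers 8
    and 16 leave enough room for constants to be absorbed by [w >= 4]. *)
Lemma descent_error_le (w n l M N : R) :
  4 <= w -> 0 <= n <= w -> 0 <= l <= w -> 0 <= M <= w -> w ^+ 16 <= N ->
  2 * n * M ^+ 2 / ((w ^+ 8)^-1 * N) + 2 * (w ^+ 8)^-1 * n ^+ 2 * l ^+ 2
    + 16 * M ^+ 3 * l * n / N <= w^-1.
Proof.
move=> w4 /andP[n0 nw] /andP[l0 lw] /andP[M0 Mw] NW.
have w0 : 0 < w by lra.
have wk k : 0 < w ^+ k by exact: exprn_gt0.
have N0 : 0 < N by exact: lt_le_trans NW.
have w64 : 64 <= w ^+ 3.
  by have -> : 64 = 4 ^+ 3 :> R by [rewrite -natrX]; rewrite lerXn2r ?nnegrE// ltW.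
have le_pow (u : R) k : 0 <= u <= w -> u ^+ k <= w ^+ k.
  by move=> /andP[u0 uw]; rewrite lerXn2r ?nnegrE// ltW.
have h1 : 2 * n * M ^+ 2 / ((w ^+ 8)^-1 * N) <= w^-1 / 4.
  rewrite ler_pdivrMr ?mulr_gt0 ?invr_gt0//.
  apply: (@le_trans _ _ (2 * w ^+ 3)).
    rewrite -mulrA ler_wpM2l// (exprS w 2) ler_pM ?sqr_ge0//.
    by apply: le_pow; rewrite M0 Mw.
  apply: (@le_trans _ _ (w^-1 / 4 * ((w ^+ 8)^-1 * w ^+ 16))); last first.
    by rewrite !ler_wpM2l ?divr_ge0 ?invr_ge0 ?exprn_ge0// ltW.
  have -> : w^-1 / 4 * ((w ^+ 8)^-1 * w ^+ 16) = w ^+ 3 * (w ^+ 3 * w) / 4.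
    by field; rewrite gt_eqF.
  have yw : 8 <= w ^+ 3 * w by nra.
  have := ler_wpM2l (ltW (wk 3%N)) yw; lra.
have h2 : 2 * (w ^+ 8)^-1 * n ^+ 2 * l ^+ 2 <= w^-1 / 4.
  apply: (@le_trans _ _ (2 * (w ^+ 8)^-1 * w ^+ 2 * w ^+ 2)).
    rewrite ler_pM ?mulr_ge0 ?invr_ge0 ?sqr_ge0 ?exprn_ge0 ?(ltW w0)//.
      rewrite ler_wpM2l ?mulr_ge0 ?invr_ge0 ?exprn_ge0 ?(ltW w0)//.
      by apply: le_pow; rewrite n0 nw.
    by apply: le_pow; rewrite l0 lw.
  have -> : 2 * (w ^+ 8)^-1 * w ^+ 2 * w ^+ 2 = w^-1 * (2 / w ^+ 3).
    by field; rewrite gt_eqF.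
  rewrite ler_wpM2l ?invr_ge0 ?(ltW w0)// ler_pdivrMr//; lra.
have h3 : 16 * M ^+ 3 * l * n / N <= w^-1 / 4.
  rewrite ler_pdivrMr//.
  apply: (@le_trans _ _ (16 * w ^+ 3 * w * w)).
    have M3 : M ^+ 3 <= w ^+ 3 by apply: le_pow; rewrite M0 Mw.
    apply: ler_pM => //; first by rewrite !mulr_ge0 ?exprn_ge0.
    apply: ler_pM => //; first by rewrite !mulr_ge0 ?exprn_ge0.
    by rewrite ler_wpM2l.
  apply: (@le_trans _ _ (w^-1 / 4 * w ^+ 16)); last first.
    by rewrite ler_wpM2l ?divr_ge0 ?invr_ge0// ltW.
  have -> : w^-1 / 4 * w ^+ 16 = (w ^+ 3 * w * w) * (w ^+ 3 * w ^+ 3 * w ^+ 3 * w / 4).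
    by field; rewrite gt_eqF.
  have -> : 16 * w ^+ 3 * w * w = (w ^+ 3 * w * w) * 16 by ring.
  apply: ler_wpM2l; first by rewrite !mulr_ge0 ?exprn_ge0 ?(ltW w0).
  have y1 : 1 <= w ^+ 3 * w ^+ 3 by nra.
  have y2 : 64 <= w ^+ 3 * w by nra.
  have := ler_pM ler01 (ler0n _ _) y1 y2; lra.
have : 0 < w^-1 by rewrite invr_gt0.
lra.
Qed.

Lemma time_le (n l tau N fuel t1 t2 t3 : nat) (w : R) :
  4 <= w -> n%:R + l%:R <= w -> N%:R <= w ^+ 16 + 1 -> fuel%:R <= w ^+ 16 + 1 ->
  (t1 <= psize setup_prog * (n + l + tau + 2) ^ pdepth setup_prog)%N ->
  (t2 <= 3 * fuel + 1)%N ->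
  (t3 <= psize main_prog * (n + l + N + 1 + tau + 2) ^ pdepth main_prog)%N ->
  (t1 + (t2 + t3))%:R <= time_const%:R * (w + tau%:R) ^+ time_degree.
Proof.
move=> w4 nlw Nw fw h1 h2 h3.
have [v vE] : exists v, v = w + tau%:R by eexists.
have tau0 : 0 <= tau%:R :> R by [].
have v4 : 4 <= v by lra.
have v0 : 0 <= v by lra.
have vk : v <= v ^+ 16 by rewrite -{1}(expr1 v) ler_weXn2l//; lra.
have wv : w ^+ 16 <= v ^+ 16 by rewrite lerXn2r ?nnegrE//; lra.
have [Y YE] : exists Y, Y = 3 * v ^+ 16 by eexists.
have {}Nw : N%:R <= v ^+ 16 + 1 by lra.
have {}fw : fuel%:R <= v ^+ 16 + 1 by lra.
have Y1 : 1 <= Y by lra.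
have Y0 : 0 <= Y by lra.
have bound1 : (n + l + tau + 2)%:R <= Y by rewrite !natrD; lra.
have bound3 : (n + l + N + 1 + tau + 2)%:R <= Y by rewrite !natrD; lra.
have bound2 : (3 * fuel + 1)%:R <= 4 * Y by rewrite natrD natrM; lra.
set D := (pdepth setup_prog + pdepth main_prog)%N.
have powers (t sz b k : nat) : (t <= sz * b ^ k)%N -> b%:R <= Y -> (k <= D)%N ->
    t%:R <= sz%:R * Y ^+ D.
  move=> ht hb kD; apply: (@le_trans _ _ (sz%:R * Y ^+ k)); last first.
    by rewrite ler_wpM2l// ler_weXn2l.
  apply: (@le_trans _ _ (sz * b ^ k)%:R); first by rewrite ler_nat.
  by rewrite natrM natrX ler_wpM2l// lerXn2r ?nnegrE.
have k1 := powers _ _ _ _ h1 bound1 (leq_addr _ _).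
have k3 := powers _ _ _ _ h3 bound3 (leq_addl _ _).
have k2 : t2%:R <= 4 * Y ^+ D.
  apply: (@le_trans _ _ (3 * fuel + 1)%:R); first by rewrite ler_nat.
  by apply: le_trans bound2 _; rewrite ler_wpM2l// -{1}(expr1 Y) ler_weXn2l.
rewrite -vE /time_const /time_degree -/D natrM natrX exprM -mulrA -exprMn -YE.
move: (psize setup_prog) (psize main_prog) k1 k3 => c1 c3 k1 k3.
by rewrite !natrD; lra.
Qed.

Lemma le_sum4 (a b c : nat) : [/\ a <= a + b + c + 1, b <= a + b + c + 1,
  c <= a + b + c + 1 & 1 <= a + b + c + 1]%N.
Proof. by split; lia. Qed.

Theorem erm_cmd_correct (n l : nat) (M eps : R) (J : set 'M[R]_n)
    (proj : 'M[R]_n -> 'M[R]_n) (tau : nat) (x : sample n l) :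
  0 < M -> (3 <= n)%N -> (1 <= l)%N -> 0 < eps ->
  (forall A, J A -> norm_inf A <= M) ->
  convex_set (J : set (convex_lmodType 'M[R]_n)) -> is_projection J proj ->
  exists (t : nat) (s : state R),
    [/\ exec proj tau erm_cmd (init_state M eps x) t s,
        t%:R <= time_const%:R * (n%:R + l%:R + M + eps^-1 + tau%:R) ^+ time_degree &
        approx_minimizer J (objective x) eps (output n s)].
Proof.
move=> M0 n3 l1 eps0 JM /convex_setP convJ projP.
have n3R : 3 <= n%:R :> R by rewrite ler_nat.
have l1R : 1 <= l%:R :> R by rewrite ler1n.
have e0 : 0 < eps^-1 by rewrite invr_gt0.
have [w wE] : exists w, w = n%:R + l%:R + M + eps^-1 by eexists.
have w4 : 4 <= w by lra.
have [s0 s0E] : exists s0, s0 = init_state M eps x by eexists.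
have [s1 s1E] : exists s1, s1 = den proj setup_prog s0 by eexists.
have [[r0 r1 rz ro rn] [m10 m11 m15 m16 m17] mX mJ mO] := setup_progE wE s0E s1E.
have [t1 ex1 ht1] := @exec_den R n proj tau [:: 0; 1; 5]%N setup_prog s0 (n + l)%N isT
  (fun r => ltac:(rewrite !inE s0E => /or3P[] /eqP -> /=; lia)).
have tW : 0 <= w ^+ 16 by rewrite exprn_ge0//; lra.
have /andP[tr1 tr2] := truncn_itv tW.
have [t2 [s2 [ex2 ht2 [/andP[N1 N2] m16'] reg2 mem2]]] :=
  @exec_ceil R n proj tau s1 (w ^+ 16) (Num.trunc (w ^+ 16)).+1 rz m10 m11
    (ltac:(by rewrite rn m16)) (ltac:(rewrite rn; lra)) (ltac:(rewrite rn add0n; exact: ltW)).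
set N := reg s2 7 in N1 N2 m16'.
have hB r : r \in frozen -> (reg s2 r <= n + l + N + 1)%N.
  have [h1 h2 h3 h4] := le_sum4 n l N.
  rewrite !inE => /or4P[|||/orP[]] /eqP ->.
  - by rewrite (reg2 0%N isT) r0.
  - by rewrite (reg2 1%N isT) r1.
  - by rewrite (reg2 5%N isT) rz.
  - by rewrite (reg2 6%N isT) ro.
  - exact: h3.
have [t3 ex3 ht3] := @exec_den R n proj tau frozen main_prog s2 (n + l + N + 1)%N isT hB.
have Nw : 0 < N%:R :> R by apply: lt_le_trans N1; rewrite exprn_gt0//; lra.
have N0 : (0 < N)%N by rewrite -(ltr0n R).
exists (t1 + (t2 + t3))%N, (den proj main_prog s2); split.
- rewrite -s0E; apply: ExecSeq; first exact: ex1.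
  by rewrite -s1E; exact: ExecSeq ex2 ex3.
- rewrite -wE; apply: (time_le (fuel := (Num.trunc (w ^+ 16)).+1) w4 _ (ltW N2) _ ht1 ht2 ht3).
    by lra.
  by rewrite -natr1 lerD2r.
pose X := mem s0 1%N; pose eta := (w ^+ 8)^-1.
have eta0 : 0 < eta by rewrite invr_gt0 exprn_gt0//; lra.
have rs2 : ready n l X N (eta + eta) s2.
  by split; rewrite ?(reg2 0%N isT) ?(reg2 1%N isT) ?(reg2 5%N isT) ?(mem2 1%N isT)
    ?(mem2 10%N isT) ?(mem2 15%N isT) ?(mem2 17%N isT).
have out0 : get_mx n s2 2 = 0.
  by rewrite -[RHS]mO; apply/matrixP => p q; rewrite !mxE mem2.
have J2 : get_mx n s2 3 = proj 0.
  by rewrite -[RHS]mJ; apply/matrixP => p q; rewrite !mxE mem2.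
have XE (k : 'I_l) (i : 'I_n) : X k i = spin R (x k) i.
  by rewrite /X s0E /= !valK spinE.
have wge4 : 4 * M <= N%:R.
  apply: le_trans N1; apply: (@le_trans _ _ (w * w)).
    by apply: ler_pM => //; [exact: ltW|lra].
  by rewrite -expr2 ler_weXn2l//; lra.
rewrite /output (main_progE proj rs2 out0) J2.
have Jp0 : J (proj 0) := (projP 0).1.
split.
  by rewrite -(prednK N0); exact: average_mem.
move=> B JB.
apply: le_trans (descent_approx projP convJ JM XE N0 wge4 eta0 Jp0 JB) _.
rewrite lerD2l; apply: (@le_trans _ _ w^-1).
  by apply: descent_error_le => //; apply/andP; split; lra.
by rewrite -[leRHS]invrK lef_pV2 ?posrE//; lra.
Qed.

End Complexity.

Theorem corollary5 (R : realType) :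
  exists (C : R -> R) (a b : R),
    [/\ 0 < a, 0 < b, (forall M, 0 < M -> C M <= a * expR (b * M)) &
  exists (f : forall n l, sample n l -> 'M[R]_n -> R) (eps0 : R)
         (P : cmd) (c d : nat),
    [/\ 0 < eps0,
        (forall n l (x : sample n l),
           convex_function (setT : set 'M[R]_n) (f n l x)) &
  forall (M : R) (n l : nat) (delta : R) (J : set 'M[R]_n),
    0 < M -> (3 <= n)%N -> (1 <= l)%N -> 0 < delta -> delta < 1 ->
    (forall A, J A -> interaction_matrix A /\ norm_inf A <= M) ->
    J !=set0 ->
    [/\ exists Jhat : sample n l -> 'M[R]_n,
          [/\ accurate_estimator J delta (C M) Jhat,
              (forall x, J (Jhat x)) &
              (forall x, (exists A, minimizer J (f n l x) A) ->
                 minimizer J (f n l x) (Jhat x))],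
        closed J -> (forall x, exists A, minimizer J (f n l x) A),
        (forall Jhat : sample n l -> 'M[R]_n,
           (forall x, approx_minimizer J (f n l x) eps0 (Jhat x)) ->
           accurate_estimator J delta (C M) Jhat) &
        convex_set (J : set (convex_lmodType 'M[R]_n)) ->
        forall (proj : 'M[R]_n -> 'M[R]_n) (tau : nat),
          is_projection J proj ->
          forall (eps : R) (x : sample n l), 0 < eps ->
          exists (t : nat) (s : state R),
            [/\ exec proj tau P (init_state M eps x) t s,
                t%:R <= c%:R * (n%:R + l%:R + M + eps^-1 + tau%:R) ^+ d &
                approx_minimizer J (f n l x) eps (output n s)]]]].
Proof.
exists (@rate_factor R), (rate_const R), 36; split=> //.
  by rewrite sqrtr_gt0 !mulr_gt0 ?exprn_gt0// addr_gt0// divr_gt0// ln_ln3_gt0.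
exists (@objective R), 1, erm_cmd, time_const, time_degree; split=> //.
  exact: objective_convex.
move=> M n l delta J M0 n3 l1 d0 d1 JM Jne.
have JM' A : J A -> norm_inf A <= M by case/JM.
split.
(* Over a set [J] that is not closed the minimum may fail to be attained; a
   point whose objective is within 1 of the infimum then serves. *)
- have sel (x : sample n l) : {A | approx_minimizer J (objective x) 1 A /\
      ((exists B, minimizer J (objective x) B) -> minimizer J (objective x) A)}.
    apply: cid; have [[A Amin]|nomin] := pselect (exists B, minimizer J (objective x) B).
      exists A; split=> //; split; first exact: Amin.1.
      by move=> B /Amin.2 h; rewrite ler_wpDr.
    have [A0 JA0] := Jne.
    pose V := [set objective x A | A in J].
    have hV : has_inf V.
      split; first by exists (objective x A0), A0.
      by exists 0 => _ [A _ <-]; exact: objective_ge0.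
    have [_ [A JA <-] hA] := inf_adherent ltr01 hV.
    exists A; split=> //; split=> // B JB.
    apply: le_trans (ltW hA) _; rewrite lerD2r.
    by apply: (ge_inf hV.2); exists B.
  exists (fun x => sval (sel x)); split=> [|x|x].
  + apply: approx_minimizer_accurate => // x; exact: (svalP (sel x)).1.
  + exact: (svalP (sel x)).1.1.
  + exact: (svalP (sel x)).2.
- by move=> clJ x; apply: exists_minimizer clJ => //; exact: JM'.
- by move=> Jhat; exact: approx_minimizer_accurate.
- move=> cJ proj tau projP eps x eps0.
  exact: erm_cmd_correct.
Qed.
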